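(* Let $a>0$, $p$, $n$, $\mu$ be fixed and let $w$ be a solution of $$\partial_s w=\frac1\rho\,\mathrm{div}(\rho\nabla w)-\frac{w}{p-1}+|w|^{p-1}w+e^{-\frac{ps}{p-1}}h\left(e^{\frac{s}{p-1}}w\right),\qquad y\in\mathbb{R}^n,\ s\ge-\log T .$$ Then there exist $\hat s_0=\hat s_0(a,p,n,\mu)$, $\hat\theta_0=\hat\theta_0(a,p,n,\mu)$ and $\gamma=\gamma(a,p,n,\mu)$ such that, if $\theta\ge\hat\theta_0$, the functional $$\mathcal{J}_a[w](s)=\mathcal{E}[w](s)\,e^{\frac{\gamma}{a}s^{-a}}+\theta s^{-a}$$ satisfies, for all $s_2>s_1\ge\max\{\hat s_0,-\log T\}$, $$\mathcal{J}_a[w](s_2)-\mathcal{J}_a[w](s_1)\le-\frac12\int_{s_1}^{s_2}\int_{\mathbb{R}^n}(\partial_s w)^2\rho\,dy\,ds .$$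
   Context: Here $n\ge1$, $p>1$, with $p<\frac{n+2}{n-2}$ if $n\ge3$, $a>0$, $\mu\in\mathbb{R}$, and $$h(z)=\mu\frac{|z|^{p-1}z}{\log^a(2+z^2)},\qquad H(z)=\int_0^z h(\xi)\,d\xi,\qquad \rho(y)=\left(\frac1{4\pi}\right)^{n/2}e^{-|y|^2/4}.$$ The equation for $w$ arises as follows. Let $u$ be a classical solution in $L^\infty(\mathbb{R}^n)$ of $u_t=\Delta u+|u|^{p-1}u+h(u)$, $u(\cdot,0)=u_0\in L^\infty(\mathbb{R}^n)$, blowing up at a finite time $T>0$ (that is, $u$ is defined on $\mathbb{R}^n\times[0,T)$ and $\|u(t)\|_{L^\infty}\to+\infty$ as $t\to T$). For $b\in\mathbb{R}^n$ (a blow-up point or not) set $y=\frac{x-b}{\sqrt{T-t}}$, $s=-\log(T-t)$, $w(y,s)=w_{b,T}(y,s)=(T-t)^{\frac1{p-1}}u(x,t)$; then $w$ satisfies the equation for all $s\ge-\log T$, $y\in\mathbb{R}^n$. The functional $\mathcal{E}$ is $$\mathcal{E}[w](s)=\int_{\mathbb{R}^n}\left(\frac12|\nabla w|^2+\frac1{2(p-1)}|w|^2-\frac1{p+1}|w|^{p+1}\right)\rho\,dy-e^{-\frac{p+1}{p-1}s}\int_{\mathbb{R}^n}H\left(e^{\frac{s}{p-1}}w\right)\rho\,dy .$$ The constants $\gamma,\theta$ are positive, and $\hat s_0>0$ (so that $s^{-a}$ makes sense for $s\ge\hat s_0$). *)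

(* Defs.v *)
From HB Require Import structures.
From mathcomp Require Import all_boot all_order all_algebra.
From mathcomp Require Import all_classical all_reals all_analysis.

Set Implicit Arguments.
Unset Strict Implicit.
Unset Printing Implicit Defensive.

Import Order.TTheory GRing.Theory Num.Theory.
Import numFieldNormedType.Exports.

Local Open Scope classical_set_scope.
Local Open Scope ring_scope.

(* The library puts the product sigma-algebra on tuples but no product measure
   there: the Lebesgue measure on R^(n+1) is the image of
   (Lebesgue on R) \x (Lebesgue on R^n) under (x, t) |-> x :: t. *)
Section LebesgueStep.
Local Open Scope ereal_scope.
Context {R : realType} {n : nat}.
Variable mu : {sigma_finite_measure set (n.-tuple (measurableTypeR R)) -> \bar R}.

Let prod : {measure
    set (measurableTypeR R * n.-tuple (measurableTypeR R))%type -> \bar R} :=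
  (@lebesgue_measure R \x mu).

Definition cons_pair (x : measurableTypeR R * n.-tuple (measurableTypeR R)) :
    n.+1.-tuple (measurableTypeR R) :=
  [the n.+1.-tuple (measurableTypeR R) of x.1 :: x.2].

Lemma measurable_cons_pair : measurable_fun setT cons_pair.
Proof. exact: measurable_cons. Qed.

Definition lebesgue_cons :
    set (n.+1.-tuple (measurableTypeR R)) -> \bar R :=
  pushforward (@lebesgue_measure R \x mu) cons_pair.

Let lebesgue_cons0 : lebesgue_cons set0 = 0.
Proof. by rewrite /lebesgue_cons /pushforward preimage_set0 measure0. Qed.

Let lebesgue_cons_ge0 A : 0 <= lebesgue_cons A.
Proof. exact: (measure_ge0 prod). Qed.

Let lebesgue_cons_additive : semi_sigma_additive lebesgue_cons.
Proof.
move=> F mF tF mUF; rewrite /lebesgue_cons /pushforward preimage_bigcup.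
apply: measure_semi_sigma_additive.
- by move=> k; rewrite -[X in measurable X]setTI; exact: measurable_cons_pair.
- apply/trivIsetP => /= i j _ _ ij; rewrite -preimage_setI.
  by move/trivIsetP : tF => /(_ _ _ _ _ ij) ->//; rewrite preimage_set0.
- rewrite -preimage_bigcup -[X in measurable X]setTI.
  exact: measurable_cons_pair.
Qed.

HB.instance Definition _ := isMeasure.Build _ _ _ lebesgue_cons
  lebesgue_cons0 lebesgue_cons_ge0 lebesgue_cons_additive.

Let lebesgue_cons_sigma_finite : sigma_finite setT lebesgue_cons.
Proof.
have /sigma_finiteP[F [TF ndF Foo]] := sigma_finiteT (@lebesgue_measure R).
have /sigma_finiteP[G [TG ndG Goo]] := sigma_finiteT mu.
pose split_tuple (t : n.+1.-tuple (measurableTypeR R)) :=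
  (thead t, [tuple of behead t]) :
    measurableTypeR R * n.-tuple (measurableTypeR R).
have msplit : measurable_fun setT split_tuple.
  apply/measurable_fun_pairP; split => /=.
    exact: measurable_tnth.
  exact: measurable_behead.
have splitK x : split_tuple (cons_pair x) = x.
  by case: x => x t; congr pair; apply/val_inj.
exists (fun k => split_tuple @^-1` (F k `*` G k)).
  apply/seteqP; split => // t _.
  have [i _ Fi] : (\bigcup_i F i) (split_tuple t).1 by rewrite -TF.
  have [j _ Gj] : (\bigcup_j G j) (split_tuple t).2 by rewrite -TG.
  exists (maxn i j) => //; split.
    by move: Fi; apply/subsetPset/ndF/leq_maxl.
  by move: Gj; apply/subsetPset/ndG/leq_maxr.
move=> k; have [mFk Fkoo] := Foo k; have [mGk Gkoo] := Goo k; split.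
  rewrite -[X in measurable X]setTI; apply: msplit => //.
  exact: measurableX.
rewrite /lebesgue_cons /pushforward.
rewrite (_ : cons_pair @^-1` _ = F k `*` G k); last first.
  rewrite -comp_preimage (_ : _ \o _ = id) ?preimage_id//.
  by apply/funext => x; exact: splitK.
by rewrite product_measure1E// lte_mul_pinfty// ge0_fin_numE.
Qed.

HB.instance Definition _ := Measure_isSigmaFinite.Build _ _ _ lebesgue_cons
  lebesgue_cons_sigma_finite.

End LebesgueStep.

Fixpoint lebesgue_tuple (R : realType) (n : nat) :
    {sigma_finite_measure set (n.-tuple (measurableTypeR R)) -> \bar R} :=
  match n with
  | 0 => \d_([tuple] : 0.-tuple (measurableTypeR R))
  | m.+1 => lebesgue_cons (lebesgue_tuple R m)
  end.

Lemma lebesgue_tuple_box (R : realType) (n : nat) (A : 'I_n -> set (measurableTypeR R)) :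
  (forall i, measurable (A i)) ->
  lebesgue_tuple R n [set t | forall i, A i (tnth t i)] =
  (\prod_(i < n) lebesgue_measure (A i))%E.
Proof.
elim: n A => [|n IHn] A mA.
  rewrite big_ord0 /= diracE mem_set//= => i; by case: i.
rewrite big_ord_recl -IHn//= /lebesgue_cons /pushforward.
rewrite -product_measure1E//; last first.
  rewrite (_ : [set t | _] = \bigcap_(i in [set: 'I_n])
      (fun t : n.-tuple _ => tnth t i) @^-1` A (lift ord0 i)).
    apply: fin_bigcap_measurable => // i _.
    by rewrite -[X in measurable X]setTI; exact: measurable_tnth.
  by apply/seteqP; split => t /= h i; [move=> _|]; apply: h.
congr (product_measure1 _ _ _).
apply/seteqP; split => -[x t] /=.
  by move=> h; split=> [|i]; [exact: (h ord0)|have := h (lift ord0 i); rewrite tnthS].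
by move=> [hx ht] i; case: (unliftP ord0 i) => [j|] ->//; rewrite tnthS.
Qed.

(* Integral over R^n of an extended-real function; points of R^n are row
   vectors, on which the library has the norm, topology and derivatives. *)
Definition int_Rn (R : realType) (n : nat) (f : 'rV[R]_n -> \bar R) : \bar R :=
  (\int[lebesgue_tuple R n]_t f (\row_(i < n) tnth t i))%E.

Section Definitions.
Variable R : realType.

Section Nonlinearity.
Variables (a p mu : R).

Definition h (z : R) : R :=
  mu * (`|z| `^ (p - 1) * z / ln (2 + z ^+ 2) `^ a).

(* Oriented integral: for z < 0 it is minus the integral over [z, 0]. *)
Definition H (z : R) : R :=
  if 0 <= z then Rintegral (@lebesgue_measure R) `[0, z] h
  else - Rintegral (@lebesgue_measure R) `[z, 0] h.

End Nonlinearity.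

Section Space.
Variable n : nat.
Implicit Types (f : 'rV[R]_n -> R) (y : 'rV[R]_n).

(* The norm `|y| of the library is the sup norm; here the Euclidean one is
   needed. *)
Definition sqnorm y : R := \sum_(i < n) y 0 i ^+ 2.

Definition partial (i : 'I_n) f y : R := 'D_(delta_mx 0 i) f y.

Definition gradient f y : 'rV[R]_n := \row_(i < n) partial i f y.

Definition divergence (F : 'rV[R]_n -> 'rV[R]_n) y : R :=
  \sum_(i < n) partial i (fun z => F z 0 i) y.

Definition rho y : R := (4 * pi)^-1 `^ (n%:R / 2) * expR (- (sqnorm y / 4)).

End Space.

Section Equation.
Variables (n : nat) (a p mu : R).
Variable w : 'rV[R]_n -> R -> R.

Definition dt (y : 'rV[R]_n) (s : R) : R := derive1 (w y) s.

Definition eq_w (y : 'rV[R]_n) (s : R) : Prop :=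
  dt y s =
    (rho y)^-1 * divergence (fun z => rho z *: gradient (w^~ s) z) y
    - w y s / (p - 1) + `|w y s| `^ (p - 1) * w y s
    + expR (- (p * s / (p - 1))) * h a p mu (expR (s / (p - 1)) * w y s).

(* C^{2,1} regularity at all times s > s0: one time derivative and two space
   derivatives, jointly continuous in (y, s). *)
Definition C21_after (s0 : R) : Prop :=
  forall y s, s0 < s ->
  [/\ {for (y, s), continuous (fun x => w x.1 x.2)},
      derivable (w y) s 1 /\ {for (y, s), continuous (fun x => dt x.1 x.2)},
      forall i, derivable (w^~ s) y (delta_mx 0 i) /\
        {for (y, s), continuous (fun x => partial i (w^~ x.2) x.1)}
    & forall i j, derivable (partial i (w^~ s)) y (delta_mx 0 j) /\
        {for (y, s),
          continuous (fun x => partial j (partial i (w^~ x.2)) x.1)}].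

Definition locally_bounded_from (s0 : R) : Prop :=
  forall S, exists M, forall y s, s0 <= s <= S -> `|w y s| <= M.

(* Classical L^infty solution, bounded on each R^n x [s0, S]. In the original
   variables it is u(t) in L^infty, bounded on [0, T'] for all T' < T, with
   initial datum merely in L^infty: nothing more is asked at s = s0. *)
Definition classical_solution (s0 : R) : Prop :=
  [/\ C21_after s0, locally_bounded_from s0 & forall y s, s0 < s -> eq_w y s].

(* The data at time s0 have a gradient, and w and its gradient are continuous
   up to time s0; true for solutions that are classical on s >= s0. *)
Definition C1_up_to (s0 : R) : Prop :=
  (forall y i, derivable (w^~ s0) y (delta_mx 0 i)) /\
  {within [set x : 'rV[R]_n * R | s0 <= x.2], continuous (fun x => w x.1 x.2)} /\
  forall i, {within [set x : 'rV[R]_n * R | s0 <= x.2],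
    continuous (fun x => partial i (w^~ x.2) x.1)}.

(* Extended-real valued: w s is bounded, so the two potential terms are
   finite and the energy is +oo exactly when the Dirichlet integral is. *)
Definition energy (s : R) : \bar R :=
  (int_Rn (fun y : 'rV[R]_n =>
     ((2^-1 * sqnorm (gradient (w^~ s) y)
       + (2 * (p - 1))^-1 * `|w y s| ^+ 2
       - (p + 1)^-1 * `|w y s| `^ (p + 1)) * rho y)%:E)
   - (expR (- ((p + 1) / (p - 1) * s)))%:E
     * int_Rn (fun y : 'rV[R]_n =>
         (H a p mu (expR (s / (p - 1)) * w y s) * rho y)%:E))%E.

Definition lyapunov (gamma theta s : R) : \bar R :=
  (energy s * (expR (gamma / a * s `^ (- a)))%:E + (theta * s `^ (- a))%:E)%E.

Definition dissipation (s1 s2 : R) : \bar R :=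
  (\int[@lebesgue_measure R]_(s in `[s1, s2])
     int_Rn (fun y : 'rV[R]_n => (dt y s ^+ 2 * rho y)%:E))%E.

End Equation.
End Definitions.

(* Main.v *)
Require Import Defs.
From HB Require Import structures.
From mathcomp Require Import all_boot all_order all_algebra.
From mathcomp Require Import all_classical all_reals all_analysis.
From mathcomp Require Import measurable_realfun.
From mathcomp Require Import ring lra.
Import Order.TTheory GRing.Theory Num.Theory.
Import numFieldNormedType.Exports.
Local Open Scope classical_set_scope.
Local Open Scope ring_scope.
Set Implicit Arguments.
Unset Strict Implicit.
Unset Printing Implicit Defensive.

(* Formally, [d/ds E] is minus the integral of [(dt w)^2 rho] plus that of
   [e^(-(p+1)s/(p-1)) ((p+1) H z - z h z) rho / (p-1)], where [z = e^(s/(p-1)) w].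
   The leading parts of [(p+1) H z] and [z h z] cancel and one power of the
   logarithm is gained, so this remainder is [O(s^-(a+1) (|w|^(p+1) + 1))].
   Testing the equation with [w] bounds the integral of [|w|^(p+1) rho] by multiples
   of [E] and of the integral of [(dt w)^2 rho], up to a constant, whence
     [d/ds E <= - 1/2 int (dt w)^2 rho + gamma s^-(a+1) E + C s^-(a+1)],
   and the factor [exp (gamma/a s^-a)] and the term [theta s^-a] absorb the last
   two terms.
   Nothing is assumed on the derivatives of [w] at infinity, so this computation
   is carried out with [rho] multiplied by the square of a cutoff [phi] at scale
   [r].  The resulting error is [24/r] times the Dirichlet integral weighted by
   [phi rho], which the derivative of the integral of [w^2 phi rho] absorbs.
   The same device bounds the truncated Dirichlet integrals at later times
   uniformly in [r]; then [r] tends to infinity. *)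

(** * Integration on R^n *)

(* Tuples carry the product sigma-algebra, not the Borel one: approximate [f] by its
   values on the grid of mesh [1 / (k + 1)]. *)
Lemma continuous_row_measurable (R : realType) (n : nat) (f : 'rV[R]_n -> R) :
  continuous f -> measurable_fun setT
    (fun t : n.-tuple (measurableTypeR R) => f (\row_i tnth t i)).
Proof.
move=> cf.
pose N (k : nat) (t : n.-tuple (measurableTypeR R)) : 'rV[int]_n :=
  \row_i Num.floor (k.+1%:R * tnth t i).
pose q (k : nat) (z : 'rV[int]_n) : 'rV[R]_n := \row_i ((z 0 i)%:~R / k.+1%:R).
have mN k (B : set 'rV[int]_n) : measurable (N k @^-1` B).
  have -> : N k @^-1` B = \bigcup_z (N k @^-1` [set z] `&` [set _ | B z]).
    by apply/seteqP; split => [t Bt|t [z _ [/= <-]]//]; exists (N k t).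
  apply: countable_bigcupT_measurable => [|z]; first exact: countableP.
  have [Bz|nBz] := pselect (B z); last first.
    by rewrite (_ : _ `&` _ = set0)//; apply/seteqP; split => // t [].
  rewrite (_ : _ `&` _ = \bigcap_(i in [set: 'I_n])
     (fun t : n.-tuple (measurableTypeR R) => tnth t i) @^-1`
       `[(z 0 i)%:~R / k.+1%:R, (z 0 i + 1)%:~R / k.+1%:R[%classic).
    apply: fin_bigcap_measurable => // i _.
    rewrite -[X in measurable X]setTI.
    by apply: measurable_tnth => //; exact: measurable_itv.
  apply/seteqP; split => [t [/= <- _] i _ /=|t h]; last first.
    split => //=; apply/rowP => i; rewrite mxE.
    apply: floor_def; have := h i Logic.I; rewrite /= in_itv/= => /andP[h1 h2].
    by rewrite mulrC -ler_pdivrMr// h1 -ltr_pdivlMr.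
  by rewrite in_itv/= !mxE ler_pdivrMr// ltr_pdivlMr// mulrC floor_itv.
apply: (@measurable_fun_cvg _ _ _ _
  (fun k => f \o q k \o N k)) => [k|t _].
  by move=> _ B mB; rewrite setTI comp_preimage; exact: mN.
apply: (@cvg_comp _ _ _ (fun k => q k (N k t)) f _ (nbhs (\row_i tnth t i)));
  last exact: cf.
apply/cvgrPdist_le => /= e e0.
near=> k.
rewrite [leLHS]mx_normrE; apply/bigmax_leP; split=> [|[i j] _ /=].
  exact: ltW.
rewrite {i}(ord1 (i : 'I_1)) !mxE /=.
have /andP[h1 h2] := floor_itv (k.+1%:R * tnth t j).
have k0 : (0 : R) < k.+1%:R by [].
have -> : tnth t j - (Num.floor (k.+1%:R * tnth t j))%:~R / k.+1%:R =
  (k.+1%:R * tnth t j - (Num.floor (k.+1%:R * tnth t j))%:~R) / k.+1%:R.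
  by rewrite mulrBl mulrAC mulfV ?mul1r// lt0r_neq0.
rewrite ger0_norm; last by rewrite divr_ge0 ?subr_ge0.
apply: (@le_trans _ _ (k.+1%:R^-1)).
  rewrite ler_pdivrMr// mulVf ?lt0r_neq0//.
  by rewrite lerBlDl; move: h2; rewrite intrD1 => /ltW.
near: k.
have := @cvg_harmonic R; move/cvgrPdist_le => /(_ e e0).
apply: filterS => k /=; rewrite sub0r normrN ger0_norm//.
Unshelve. all: by end_near. Qed.

Lemma lebesgue_measure_shift (R : realType) (c : R) (A : set (measurableTypeR R)) :
  measurable A ->
  @lebesgue_measure R ((fun x : measurableTypeR R => x + c) @^-1` A) =
  @lebesgue_measure R A.
Proof.
have mc : measurable_fun setT
    ((fun x => x + c) : measurableTypeR R -> measurableTypeR R).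
  by apply: measurable_funD.
move=> mA; apply/esym.
apply: (@lebesgue_measure_unique R (pushforward lebesgue_measure
   ((fun x => x + c) : measurableTypeR R -> measurableTypeR R))) => // X.
case=> -[a b] _ <- /=.
rewrite /pushforward (_ : _ @^-1` _ = `]a - c, b - c]%classic).
  rewrite !lebesgue_measure_itv/= !lte_fin ltrD2r.
  by case: ifPn => // _; rewrite -!EFinB; congr EFin; ring.
by apply/seteqP; split => x /=; rewrite !in_itv/= ltrBlDr lerBrDr.
Qed.

Lemma ge0_integral_lebesgue_shift (R : realType) (c : R)
    (f : measurableTypeR R -> \bar R) : measurable_fun setT f ->
  (forall x, 0 <= f x)%E ->
  (\int[@lebesgue_measure R]_x f (x + c)%R = \int[@lebesgue_measure R]_x f x)%E.
Proof.
move=> mf f0.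
have mc : measurable_fun setT
    ((fun x => x + c) : measurableTypeR R -> measurableTypeR R).
  by apply: measurable_funD.
have := @ge0_integral_pushforward _ _ _ _ R _ mc lebesgue_measure setT f
  measurableT mf (fun x _ => f0 x).
rewrite preimage_setT => <-.
by apply: eq_measure_integral => A mA _; exact: lebesgue_measure_shift.
Qed.

Lemma ge0_integral_lebesgue_tupleS (R : realType) (n : nat)
    (f : n.+1.-tuple (measurableTypeR R) -> \bar R) : measurable_fun setT f ->
  (forall t, 0 <= f t)%E ->
  (\int[lebesgue_tuple R n.+1]_t f t =
   \int[@lebesgue_measure R]_x \int[lebesgue_tuple R n]_t f (cons_pair (x, t)))%E.
Proof.
move=> mf f0.
have mc := @measurable_cons_pair R n.
rewrite (ge0_integral_pushforward mc)//= preimage_setT.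
rewrite fubini_tonelli1//.
exact: measurableT_comp.
Qed.

Definition tuple_shift (R : realType) (n : nat) (c : 'I_n -> R)
    (t : n.-tuple (measurableTypeR R)) : n.-tuple (measurableTypeR R) :=
  [tuple tnth t i + c i | i < n].

Lemma measurable_tuple_shift (R : realType) (n : nat) (c : 'I_n -> R) :
  measurable_fun setT (tuple_shift c).
Proof.
apply/measurable_fun_tnthP => i.
rewrite (_ : _ \o _ = fun t => tnth t i + c i); last first.
  by apply/funext => t /=; rewrite tnth_mktuple.
by apply: measurable_funD => //; exact: measurable_tnth.
Qed.

Lemma ge0_integral_tuple_shift (R : realType) (n : nat) (c : 'I_n -> R)
    (f : n.-tuple (measurableTypeR R) -> \bar R) : measurable_fun setT f ->
  (forall t, 0 <= f t)%E ->
  (\int[lebesgue_tuple R n]_t f (tuple_shift c t) =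
   \int[lebesgue_tuple R n]_t f t)%E.
Proof.
elim: n c f => [|n IHn] c f mf f0.
  by apply: eq_integral => t _; rewrite (tuple0 t) (tuple0 (tuple_shift _ _)).
rewrite [RHS]ge0_integral_lebesgue_tupleS//.
have mfc : measurable_fun setT (f \o tuple_shift c).
  exact: measurableT_comp (measurable_tuple_shift c).
rewrite (ge0_integral_lebesgue_tupleS mfc (fun t => f0 (tuple_shift c t))).
have mcons x : measurable_fun setT
    (fun t : n.-tuple (measurableTypeR R) => cons_pair (x, t)).
  by apply: measurableT_comp => //; exact: measurable_cons_pair.
pose g x := (\int[lebesgue_tuple R n]_t f (cons_pair (x, t)))%E.
transitivity (\int[@lebesgue_measure R]_x g (x + c ord0)%R)%E.
  apply: eq_integral => x _; rewrite /g.
  rewrite -(IHn (c \o lift ord0) (fun t => f (cons_pair (x + c ord0, t))))//.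
    apply: eq_integral => t _; congr f; apply: eq_from_tnth => i.
    rewrite tnth_mktuple; case: (unliftP ord0 i) => [j ->|->].
      by rewrite !tnthS tnth_mktuple.
    by rewrite !tnth0.
  exact: measurableT_comp.
rewrite ge0_integral_lebesgue_shift//; last first.
  by move=> x; exact: integral_ge0.
apply: (@measurable_fun_fubini_tonelli_F _ _ _ _ _ (lebesgue_tuple R n)
  (f \o @cons_pair R n)) => [|x]; last exact: f0.
exact: measurableT_comp (@measurable_cons_pair R n).
Qed.

Lemma gaussian_integral_lty (R : realType) :
  (\int[@lebesgue_measure R]_x (expR (- (x ^+ 2 / 4)))%:E < +oo)%E.
Proof.
have s0 : (Num.sqrt 2 : R) != 0 by rewrite gt_eqF// sqrtr_gt0.
have pk0 : 0 < normal_peak (Num.sqrt 2 : R).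
  by rewrite invr_gt0 sqrtr_gt0 sqr_sqrtr// pmulrn_lgt0// mulr_gt0// pi_gt0.
rewrite (_ : (fun x : R => (expR (- (x ^+ 2 / 4)))%:E) =
   (fun x => (normal_peak (Num.sqrt 2 : R))^-1%:E * (normal_pdf 0 (Num.sqrt 2) x)%:E)%E); last first.
  apply/funext => x; rewrite -EFinM; congr EFin.
  rewrite /normal_pdf (negbTE s0) mulrA mulVf ?gt_eqF// mul1r /normal_fun subr0.
  by rewrite sqr_sqrtr//; congr expR; field.
rewrite ge0_integralZl//.
- by rewrite integral_normal_pdf mule1 ltry.
- by apply/measurable_EFinP; exact: measurable_normal_pdf.
- by move=> x _; rewrite lee_fin normal_pdf_ge0.
- by rewrite lee_fin invr_ge0 ltW.
Qed.

Lemma measurable_gaussian_tuple (R : realType) (n : nat) :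
  measurable_fun setT (fun t : n.-tuple (measurableTypeR R) =>
    (expR (- (\sum_(i < n) tnth t i ^+ 2 / 4)))%:E).
Proof.
apply/measurable_EFinP; apply: measurableT_comp => //; apply: measurableT_comp => //.
apply: measurable_sum => i; apply: measurable_funM => //.
by apply: measurable_funX; exact: measurable_tnth.
Qed.

Lemma gaussian_tuple_integral_lty (R : realType) (n : nat) :
  (\int[lebesgue_tuple R n]_t
     (expR (- (\sum_(i < n) tnth t i ^+ 2 / 4)))%:E < +oo)%E.
Proof.
elim: n => [|n IHn].
  rewrite /= integral_dirac//; last exact: measurable_gaussian_tuple.
  by rewrite diracE mem_set// mul1e ltry.
rewrite ge0_integral_lebesgue_tupleS; last 2 first.
- exact: measurable_gaussian_tuple.
- by move=> t; rewrite lee_fin expR_ge0.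
set c := (X in (X < _)%E) in IHn.
rewrite (_ : (fun x => _) = (fun x => (expR (- (x ^+ 2 / 4)))%:E * c)%E); last first.
  apply/funext => x; rewrite -(ge0_integralZl _ measurableT (@measurable_gaussian_tuple R n))//.
  apply: eq_integral => t _; rewrite -EFinM -expRD; congr (expR _)%:E.
  rewrite big_ord_recl/= tnth0 opprD; congr (_ - _).
  by apply: eq_bigr => i _; rewrite tnthS.
have c0 : (0 <= c)%E by apply: integral_ge0 => t _; rewrite lee_fin expR_ge0.
rewrite ge0_integralZr//.
- by apply: lte_mul_pinfty => //; [apply: integral_ge0 => x _; rewrite lee_fin expR_ge0|rewrite ge0_fin_numE//; [exact: gaussian_integral_lty|apply: integral_ge0 => x _; rewrite lee_fin expR_ge0]].
- apply/measurable_EFinP; apply: measurableT_comp => //; apply: measurableT_comp => //.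
  by apply: measurable_funM => //.
Qed.

Section IntegralRn.
Context {R : realType} {n : nat}.
Implicit Types (f g : 'rV[R]_n -> R) (y : 'rV[R]_n).

Definition row_of (t : n.-tuple (measurableTypeR R)) : 'rV[R]_n :=
  \row_(i < n) tnth t i.

Definition meas_Rn f := measurable_fun setT (f \o row_of).

Definition IR f : R := Rintegral (lebesgue_tuple R n) setT (f \o row_of).

Definition integrable_Rn f :=
  (lebesgue_tuple R n).-integrable setT (EFin \o (f \o row_of)).

Lemma continuous_meas_Rn f : continuous f -> meas_Rn f.
Proof. exact: continuous_row_measurable. Qed.

Lemma integrable_meas_Rn f : integrable_Rn f -> meas_Rn f.
Proof. by move=> /integrableP[/measurable_EFinP]. Qed.

Lemma int_RnE f : integrable_Rn f -> int_Rn (EFin \o f) = (IR f)%:E.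
Proof.
move=> fi; rewrite /IR /Rintegral fineK//.
exact: integrable_fin_num.
Qed.

Lemma integrable_RnD f g : integrable_Rn f -> integrable_Rn g ->
  integrable_Rn (fun y => f y + g y).
Proof. by move=> fi gi; exact: (integrableD measurableT fi gi). Qed.

Lemma integrable_RnB f g : integrable_Rn f -> integrable_Rn g ->
  integrable_Rn (fun y => f y - g y).
Proof. by move=> fi gi; exact: (integrableB measurableT fi gi). Qed.

Lemma integrable_RnZ c f : integrable_Rn f -> integrable_Rn (fun y => c * f y).
Proof. by move=> fi; exact: (integrableZl measurableT c fi). Qed.

Lemma integrable_Rn_le f g : meas_Rn f -> (forall y, `|f y| <= g y) ->
  integrable_Rn g -> integrable_Rn f.
Proof.
move=> mf fg; apply: le_integrable => //; first exact/measurable_EFinP.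
move=> t _ /=; rewrite lee_fin (le_trans (fg _))//; exact: ler_norm.
Qed.

Lemma IRD f g : integrable_Rn f -> integrable_Rn g ->
  IR (fun y => f y + g y) = IR f + IR g.
Proof. by move=> fi gi; exact: RintegralD. Qed.

Lemma IRB f g : integrable_Rn f -> integrable_Rn g ->
  IR (fun y => f y - g y) = IR f - IR g.
Proof. by move=> fi gi; exact: RintegralB. Qed.

Lemma IRZ c f : integrable_Rn f -> IR (fun y => c * f y) = c * IR f.
Proof. by move=> fi; exact: RintegralZl. Qed.

Lemma le_IR f g : integrable_Rn f -> integrable_Rn g ->
  (forall y, f y <= g y) -> IR f <= IR g.
Proof. by move=> fi gi fg; apply: le_Rintegral => // t _; exact: fg. Qed.

Lemma IR_ge0 f : (forall y, 0 <= f y) -> 0 <= IR f.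
Proof. by move=> f0; apply: Rintegral_ge0 => t _; exact: f0. Qed.

Lemma IR_shift f (c : 'rV[R]_n) : meas_Rn f -> IR (fun y => f (y + c)) = IR f.
Proof.
move=> mf; rewrite /IR /Rintegral; congr fine.
have E (F : n.-tuple (measurableTypeR R) -> \bar R) : measurable_fun setT F ->
    (forall t, 0 <= F t)%E ->
    (\int[lebesgue_tuple R n]_t F (tuple_shift (c ord0) t) =
     \int[lebesgue_tuple R n]_t F t)%E.
  exact: ge0_integral_tuple_shift.
have rs t : row_of t + c = row_of (tuple_shift (c ord0) t).
  by apply/rowP => i; rewrite !mxE tnth_mktuple.
rewrite integralE [RHS]integralE; congr (_ - _)%E.
- rewrite -[RHS]E//; last by apply: measurable_funepos; exact/measurable_EFinP.
  by apply: eq_integral => t _; rewrite !funeposE /= rs.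
- rewrite -[RHS]E//; last by apply: measurable_funeneg; exact/measurable_EFinP.
  by apply: eq_integral => t _; rewrite !funenegE /= rs.
Qed.

Lemma IR_cvg (F : nat -> 'rV[R]_n -> R) f g : (forall k, meas_Rn (F k)) ->
  (forall y, F k y @[k --> \oo] --> f y) -> integrable_Rn g ->
  (forall k y, `|F k y| <= g y) ->
  integrable_Rn f /\ IR (F k) @[k --> \oo] --> IR f.
Proof.
move=> mF Ff gi Fg.
have mf : meas_Rn f.
  by apply: (@measurable_fun_cvg _ _ _ _ (fun k => F k \o row_of)) => // t _; exact: Ff.
have [] := @dominated_convergence _ _ _ (lebesgue_tuple R n) setT measurableT
  (fun k => EFin \o (F k \o row_of)) (EFin \o (f \o row_of)) (EFin \o (g \o row_of)).
- by move=> k; apply/measurable_EFinP; exact: mF.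
- exact/measurable_EFinP.
- apply: aeW => t _; apply: cvg_EFin; first exact: nearW.
  exact: (Ff (row_of t)).
- exact: gi.
- by apply: aeW => t k _; rewrite /= lee_fin; exact: Fg.
move=> fi _ cF; split => //; apply: fine_cvg.
by rewrite fineK//; exact: integrable_fin_num.
Qed.
End IntegralRn.

Section Limits.
Context {R : realType} {n : nat}.
Implicit Types (f g : 'rV[R]_n -> R) (y : 'rV[R]_n).

Lemma IR_cvg_within (D : set R) (a : R) (Q : R -> 'rV[R]_n -> R) L g :
  meas_Rn L -> (forall y, `|L y| <= g y) -> integrable_Rn g ->
  (forall h, D h -> meas_Rn (Q h)) ->
  (forall h y, D h -> `|Q h y| <= g y) ->
  (forall y, Q h y @[h --> within D (nbhs a)] --> L y) ->
  IR (Q h) @[h --> within D (nbhs a)] --> IR L.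
Proof.
move=> mL Lg gi mQ Qg QL.
pose Q' h := if `[< D h >] then Q h else L.
have Q'E h : D h -> Q' h = Q h by move=> Dh; rewrite /Q' asboolT.
have Q'L y : Q' h y @[h --> a] --> L y.
  apply/cvgrPdist_lt => e e0.
  have /cvgrPdist_lt/(_ e e0) := QL y.
  change ((\forall h \near a, D h -> `|L y - Q h y| < e) ->
    \forall h \near a, `|L y - Q' h y| < e).
  apply: filterS => h Dh.
  by rewrite /Q'; case: asboolP => [/Dh//|_]; rewrite subrr normr0.
have IQ' : IR (Q' h) @[h --> a] --> IR L.
  apply/(@cvg_nbhsP _ R^o) => u ua.
  apply: (proj2 (@IR_cvg R n (fun k => Q' (u k)) L g _ _ gi _)).
  - by move=> k; rewrite /Q'; case: asboolP => // /mQ.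
  - by move=> y; apply: (cvg_comp _ _ ua (Q'L y)).
  - by move=> k y; rewrite /Q'; case: asboolP => // /Qg.
apply/cvgrPdist_lt => e e0.
have /cvgrPdist_lt/(_ e e0) := IQ'.
move=> IQ'e; change (\forall h \near a, D h -> `|IR L - IR (Q h)| < e).
by apply: filterS IQ'e => h hh Dh; rewrite -Q'E.
Qed.

Lemma is_derive_IR (G : R -> R) (s d : R) (Q : R -> 'rV[R]_n -> R) L g :
  0 < d -> meas_Rn L -> integrable_Rn g ->
  (forall h, h != 0 -> `|h| < d -> h^-1 * (G (h + s) - G s) = IR (Q h)) ->
  (forall h, h != 0 -> `|h| < d -> meas_Rn (Q h)) ->
  (forall h y, h != 0 -> `|h| < d -> `|Q h y| <= g y) ->
  (forall y, Q h y @[h --> 0^'] --> L y) ->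
  is_derive s 1 G (IR L).
Proof.
move=> d0 mL gi GQ mQ Qg QL.
pose D := [set h : R | h != 0 /\ `|h| < d].
have DE : within D (nbhs (0 : R)) = 0^'.
  apply/seteqP; split => P.
  - move=> DP.
    change (\forall h \near (0 : R), D h -> P h) in DP.
    change (\forall h \near (0 : R), h != 0 -> P h).
    have : \forall h \near (0 : R), `|h| < d.
      by near=> h; rewrite -normrN -[- h]sub0r; near: h; apply: nbhsx_ballx.
    by apply: filterS2 DP => h h1 h2 h3; apply: h1.
  - move=> P0; change (\forall h \near (0 : R), h != 0 -> P h) in P0.
    change (\forall h \near (0 : R), D h -> P h).
    by apply: filterS P0 => h hP [/hP].
have Lg y : `|L y| <= g y.
  rewrite -(cvg_lim _ (cvg_norm (QL y)))//; apply: limr_le.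
    by apply/cvg_ex; exists `|L y|; exact: cvg_norm.
  rewrite -DE; change (\forall h \near (0 : R), D h -> `|Q h y| <= g y).
  by apply: filterE => h [h0 hd]; exact: Qg.
have : (fun h : R => h^-1 *: ((G \o shift s) (h *: 1) - G s)) @ 0^' --> IR L.
  have := @IR_cvg_within D 0 Q L g mL Lg gi.
  rewrite DE => H.
  have {}H : IR (Q h) @[h --> 0^'] --> IR L.
    by apply: H => //; [move=> h []; exact: mQ|move=> h y []; exact: Qg].
  apply: cvg_trans H; apply: near_eq_cvg.
  rewrite -DE; near=> h.
  have [h0 hd] : D h by near: h; rewrite /prop_near1 /within /=; exact: nearW.
  by rewrite /= /shift/= -GQ// [h *: 1]mulr1.
move=> H; apply: DeriveDef; first by apply/cvg_ex; exists (IR L).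
exact/cvg_lim.
Unshelve. all: by end_near. Qed.
End Limits.

Lemma continuous_compact_norm_bound (R : realType) (T : topologicalType)
    (A : set T) (f : T -> R) : compact A -> {within A, continuous f} ->
  exists M : R, 0 <= M /\ forall x, A x -> `|f x| <= M.
Proof.
move=> cA cf.
have [M [_ /(_ (Num.max 0 (M + 1)))]] := compact_bounded (continuous_compact cf cA).
rewrite lt_max ltrDl ltr01 orbT => /(_ isT) HM.
exists (Num.max 0 (M + 1)); split; first by rewrite le_max lexx.
by move=> x Ax; apply: HM; exists x.
Qed.

Lemma mean_value_bound (R : realType) (f f' : R -> R) (u v M : R) (a b : R) :
  (forall x, x \in `[u, v] -> is_derive x 1 f (f' x)) ->
  (forall x, x \in `[u, v] -> `|f' x| <= M) ->
  a \in `[u, v] -> b \in `[u, v] -> `|f b - f a| <= M * `|b - a|.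
Proof.
move=> df fM; wlog ab : a b / a <= b.
  by move=> H auv buv; have [/H->//|/ltW/H] := leP a b; rewrite distrC (distrC b); apply.
rewrite !in_itv/= => /andP[ua av] /andP[ub bv].
have sub x : x \in `[a, b] -> x \in `[u, v].
  by rewrite !in_itv/= => /andP[ax xb]; rewrite (le_trans ua)// (le_trans xb).
have cf : {within `[a, b], continuous f}.
  by apply: derivable_within_continuous => x xab; have [] := df x (sub _ xab).
have dfo x : x \in `]a, b[ -> is_derive x 1 f (f' x).
  by move=> xab; apply: df; apply: sub; apply: subset_itv_oo_cc xab.
have [c cab E] := MVT_segment ab dfo cf.
by rewrite E normrM ler_wpM2r// fM// sub.
Qed.

Section Lines.
Context {R : realType} {V : normedModType R}.
Implicit Types (f : V -> R) (y v : V).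

Lemma is_derive_line f y v h : derivable f (h *: v + y) v ->
  is_derive h 1 (fun k => f (k *: v + y)) ('D_v f (h *: v + y)).
Proof.
move=> df.
have E : (fun k : R => k^-1 *: (((fun k0 => f (k0 *: v + y)) \o shift h) (k *: 1) - f (h *: v + y))) =
  (fun k : R => k^-1 *: ((f \o shift (h *: v + y)) (k *: v) - f (h *: v + y))).
  by apply/funext => k /=; rewrite [k *: 1]mulr1 scalerDl addrA.
by split; rewrite /derivable /derive E.
Qed.

End Lines.

Lemma cvg_sumr (R : realType) (T : Type) (F : set_system T) {FF : Filter F}
    (I : finType) (f : I -> T -> R) (l : I -> R) :
  (forall i, f i x @[x --> F] --> l i) ->
  (\sum_i f i x) @[x --> F] --> \sum_i l i.
Proof.
move=> fl; elim: (index_enum I) => [|i r IHr].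
  by rewrite big_nil; under eq_fun do rewrite big_nil; exact: cvg_cst.
by rewrite big_cons; under eq_fun do rewrite big_cons; exact: cvgD.
Qed.

Section ContinuousAt.
Context {R : realType} (T : topologicalType).
Implicit Types (f g : T -> R) (x : T).

Lemma cont_cst c x : continuous_at x (fun _ : T => c : R).
Proof. exact: cvg_cst. Qed.

Lemma contD f g x : continuous_at x f -> continuous_at x g ->
  continuous_at x (fun z => f z + g z).
Proof. by move=> cf cg; exact: (cvgD cf cg). Qed.

Lemma contN f x : continuous_at x f -> continuous_at x (fun z => - f z).
Proof. by move=> cf; exact: (cvgN cf). Qed.

Lemma contB f g x : continuous_at x f -> continuous_at x g ->
  continuous_at x (fun z => f z - g z).
Proof. by move=> cf cg; exact: (cvgB cf cg). Qed.

Lemma contM f g x : continuous_at x f -> continuous_at x g ->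
  continuous_at x (fun z => f z * g z).
Proof. by move=> cf cg; exact: (cvgM cf cg). Qed.

Lemma contX f x k : continuous_at x f ->
  continuous_at x (fun z => f z ^+ k).
Proof. by move=> cf; exact: (cvg_comp f (fun r => r ^+ k) cf (@exprn_continuous R k (f x))). Qed.

Lemma contV f x : f x != 0 -> continuous_at x f ->
  continuous_at x (fun z => (f z)^-1).
Proof. by move=> fx0 cf; exact: (cvgV fx0 cf). Qed.

Lemma cont_sum (I : finType) (F : I -> T -> R) x :
  (forall i, continuous_at x (F i)) ->
  continuous_at x (fun z => \sum_i F i z).
Proof. by move=> cF; apply: (@cvg_sumr R _ (nbhs x)) => i; exact: cF. Qed.

Lemma cont_comp (U S : topologicalType) (g : U -> S) (f : T -> U) x :
  continuous_at x f -> continuous_at (f x) g ->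
  continuous_at x (fun z => g (f z)).
Proof. by move=> cf cg; exact: (cvg_comp f g cf cg). Qed.

End ContinuousAt.

Section Chain.
Context {R : realType} {V : normedModType R}.
Implicit Types (f : V -> R) (y v : V).

Lemma is_derive_lineP f y v df :
  is_derive y v f df <-> is_derive (0 : R) 1 (fun h : R => f (h *: v + y)) df.
Proof.
have E : (fun k : R => k^-1 *: (((fun k0 : R => f (k0 *: v + y)) \o shift 0) (k *: 1) - f (0 *: v + y))) =
  (fun k : R => k^-1 *: ((f \o shift y) (k *: v) - f y)).
  by apply/funext => k /=; rewrite [k *: 1]mulr1 addr0 scale0r add0r.
by split=> -[]; rewrite /derivable /derive ?E => h1 h2; split; rewrite /derivable /derive ?E.
Qed.

Lemma is_derive_comp1 (g : R -> R) f y v a b :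
  is_derive y v f b -> is_derive (f y) 1 g a ->
  is_derive y v (fun z => g (f z)) (a * b).
Proof.
move=> /is_derive_lineP df dg; apply/is_derive_lineP.
apply: (@is_derive1_comp _ g (fun h : R => f (h *: v + y))) => //.
by rewrite scale0r add0r.
Qed.
End Chain.

Section Weights.
Context {R : realType} {n : nat}.
Implicit Types (f g : 'rV[R]_n -> R) (y : 'rV[R]_n).

Lemma sqnorm_ge0 y : 0 <= sqnorm y.
Proof. by apply: sumr_ge0 => i _; exact: sqr_ge0. Qed.

Lemma sqnorm_continuous : continuous (@sqnorm R n).
Proof.
move=> y; apply: (@cvg_sumr R _ (nbhs y)) => i.
by apply: (contX (T := 'rV[R]_n)); exact: coord_continuous.
Qed.

Lemma is_derive_sqnorm (i : 'I_n) y :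
  is_derive y (delta_mx 0 i) (@sqnorm R n) (2 * y 0 i).
Proof.
apply/is_derive_lineP.
rewrite (_ : (fun h => _) = (fun h : R => sqnorm y + (2 * y 0 i) * h + h ^+ 2)).
  by apply: is_derive_eq; rewrite /= -![_ *: _]/(_ * _); ring.
apply/funext => h; rewrite /sqnorm (bigD1 i)//= [in RHS](bigD1 i)//=.
rewrite !mxE !eqxx/= mulr1.
under eq_bigr => j ji do rewrite !mxE (negbTE ji) andbF mulr0 add0r.
by ring.
Qed.

Lemma rho_gt0 y : 0 < rho y.
Proof. by rewrite mulr_gt0// ?expR_gt0// powR_gt0 ?invr_gt0 ?mulr_gt0 ?pi_gt0. Qed.

Lemma rho_ge0 y : 0 <= rho y.
Proof. exact: ltW (rho_gt0 y). Qed.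

Lemma rho_continuous : continuous (@rho R n).
Proof.
rewrite (_ : @rho R n = fun z => (4 * pi)^-1 `^ (n%:R / 2) * expR (- (sqnorm z / 4)))// => y.
apply: (contM (T := 'rV[R]_n)); first exact: cont_cst.
apply: (cont_comp (T := 'rV[R]_n) (g := expR)); last exact: continuous_expR.
by apply: (contN (T := 'rV[R]_n)); apply: (contM (T := 'rV[R]_n)); [exact: sqnorm_continuous|exact: cont_cst].
Qed.

Lemma is_derive_rho (i : 'I_n) y :
  is_derive y (delta_mx 0 i) (@rho R n) (- (y 0 i / 2) * rho y).
Proof.
have H := @is_derive_sqnorm i y.
have H1 : is_derive y (delta_mx 0 i) (fun z : 'rV[R]_n => - (4^-1 * sqnorm z)) (- (y 0 i / 2)).
  by apply: is_derive_eq; rewrite -[4^-1 *: _]/(4^-1 * _); field.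
have H2 := is_derive_comp1 H1 (is_derive_expR (- (4^-1 * sqnorm y))).
rewrite (_ : @rho R n = fun z => (4 * pi)^-1 `^ (n%:R / 2) * expR (- (4^-1 * sqnorm z))); last first.
  by apply/funext => z /=; rewrite /rho (mulrC 4^-1).
by apply: is_derive_eq; rewrite /= -![_ *: _]/(_ * _); ring.
Qed.

Lemma integrable_rho : integrable_Rn (@rho R n).
Proof.
apply/integrableP; split.
  apply/measurable_EFinP; apply: continuous_meas_Rn; exact: rho_continuous.
rewrite (_ : (fun x => _) = (fun t : n.-tuple (measurableTypeR R) =>
   ((4 * pi)^-1 `^ (n%:R / 2))%:E * (expR (- (\sum_(i < n) tnth t i ^+ 2 / 4)))%:E)%E); last first.
  apply/funext => t /=; rewrite ger0_norm ?ltW ?rho_gt0// /rho EFinM /sqnorm mulr_suml.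
  by do 4 congr (_ _); apply: eq_bigr => i _; rewrite mxE.
rewrite ge0_integralZl//; last 2 first.
- exact: measurable_gaussian_tuple.
- by rewrite lee_fin powR_ge0.
rewrite lte_mul_pinfty ?lee_fin ?powR_ge0//.
exact: gaussian_tuple_integral_lty.
Qed.

Definition box (b : R) : set 'rV[R]_n := [set y | forall i, `|y 0 i| <= b].

Lemma box_compact b : compact (box b).
Proof.
have := @rV_compact R n (fun=> `[- b, b]%classic) (fun=> @segment_compact R (- b) b).
by congr compact; apply/seteqP; split => y /= h i; have := h i; rewrite /= in_itv/= ler_norml.
Qed.

Lemma box_dominated (b M : R) : 0 <= M -> exists g, [/\ integrable_Rn g,
  forall y, 0 <= g y & forall y, box b y -> M <= g y].
Proof.
move=> M0.
have cr : {within box b, continuous (fun y : 'rV[R]_n => (rho y)^-1)}.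
  apply: continuous_subspaceT => y; apply: (contV (T := 'rV[R]_n)); first exact: lt0r_neq0 (rho_gt0 y).
  exact: rho_continuous.
have [K [K0 HK]] := continuous_compact_norm_bound (@box_compact b) cr.
exists (fun y => M * K * rho y); split.
- by apply: integrable_RnZ; exact: integrable_rho.
- by move=> y; exact: mulr_ge0 (mulr_ge0 M0 K0) (rho_ge0 y).
move=> y /HK; rewrite ger0_norm ?invr_ge0 ?(ltW (rho_gt0 y))// => rK.
rewrite -mulrA ler_peMr// -ler_pdivrMr ?rho_gt0//.
by rewrite div1r.
Qed.

End Weights.

Section Weight.
Context {R : realType} {n : nat}.
Implicit Types (f g : 'rV[R]_n -> R) (y : 'rV[R]_n) (b : R) (i : 'I_n).

Definition weight b g := [/\ continuous g,
  forall i y, derivable g y (delta_mx 0 i),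
  forall i, continuous (partial i g) & forall y, ~ box b y -> g y = 0].

Lemma box_shift b i y h : `|h| < 1 -> ~ box (b + 1) y ->
  ~ box b (h *: delta_mx 0 i + y).
Proof.
move=> h1 nby by1; apply: nby => j.
have := by1 j; rewrite !mxE eqxx/=.
have hj : `|h * (j == i)%:R| < 1.
  by case: eqP => _; rewrite ?mulr1// mulr0 normr0.
move=> H; rewrite -(addKr (h * (j == i)%:R) (y 0 j)) addrC.
by rewrite (le_trans (ler_normB _ _))// lerD// ltW.
Qed.

Lemma partial_eq0 b i g y : (forall z, ~ box b z -> g z = 0) -> ~ box b y ->
  partial i g y = 0.
Proof.
move=> g0 nby.
have H : \forall z \near y, (fun _ => 0 : R) z = g z.
  have : open (~` @box R n b).
    apply: closed_openC; apply: compact_closed; last exact: box_compact.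
    exact: norm_hausdorff.
  rewrite openE => /(_ y nby); rewrite /interior; apply: filterS => z nbz.
  by rewrite g0.
have := near_eq_is_derive (v := delta_mx 0 i) H (is_derive_cst _ _ _).
by case.
Qed.

Lemma integrable_Rn_box b f : continuous f -> (forall y, ~ box b y -> f y = 0) ->
  integrable_Rn f.
Proof.
move=> cf f0.
have [M [M0 HM]] := continuous_compact_norm_bound (@box_compact R n b)
  (continuous_subspaceT cf).
have [g [gi g0 gM]] := @box_dominated R n b M M0.
apply: (integrable_Rn_le _ _ gi); first exact: continuous_meas_Rn.
move=> y; have [/[dup] /gM h1 /HM h2|/f0 ->] := pselect (box b y).
  exact: le_trans h1.
by rewrite normr0.
Qed.

(* By translation invariance the difference quotients of [f] have integral [0]. *)
Lemma IR_partial0 b i f : weight b f -> IR (partial i f) = 0.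
Proof.
move=> [cf df cdf f0].
have [M [M0 HM]] := continuous_compact_norm_bound (@box_compact R n (b + 2))
  (continuous_subspaceT (cdf i)).
have [g [gi g0 gM]] := @box_dominated R n (b + 1) M M0.
pose e : 'rV[R]_n := delta_mx 0 i.
pose Q h y := h^-1 * (f (h *: e + y) - f y).
have cs h : continuous (fun y => f (h *: e + y)).
  move=> y; apply: (@continuous_comp _ _ _ (fun z => h *: e + z) f); last exact: cf.
  exact: (cvgD (cvg_cst (h *: e)) (@cvg_id _ (nbhs y))).
have cQ h : continuous (Q h).
  change (continuous (fun y => h^-1 * (f (h *: e + y) - f y))) => y; apply: (contM (T := 'rV[R]_n)); first exact: cont_cst.
  apply: (contB (T := 'rV[R]_n)); last exact: cf.
  exact: cs.
have int_f : integrable_Rn f by exact: integrable_Rn_box f0.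
have Qg h y : h != 0 -> `|h| < 1 -> `|Q h y| <= g y.
  move=> h0 h1; rewrite /Q.
  have [by1|nby] := pselect (box (b + 1) y); last first.
    rewrite (f0 _ (box_shift h1 nby)) f0 ?subrr ?mulr0 ?normr0//.
    by move=> byy; apply: nby => j; rewrite (le_trans (byy j))// lerDl.
  apply: le_trans (gM _ by1).
  have H := @mean_value_bound R (fun k => f (k *: e + y)) (fun k => partial i f (k *: e + y))
    (-1) 1 M 0 h.
  rewrite normrM normfV mulrC ler_pdivrMr ?normr_gt0//.
  have := H; rewrite scale0r add0r subr0; apply.
  - by move=> x _; apply: (@is_derive_line R _ f y e x); exact: df.
  - move=> x; rewrite in_itv/= -ler_norml => x1; apply: HM => j.
    rewrite !mxE eqxx/= (le_trans (ler_normD _ _))// addrC -[2]/(1 + 1) addrA lerD//.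
    by case: eqP => _; rewrite ?mulr1// mulr0 normr0.
  - by rewrite in_itv/= lerN10 ler01.
  - by rewrite in_itv/= -ler_norml ltW.
have Qd y : Q h y @[h --> 0^'] --> partial i f y.
  have := df i y; rewrite /derivable => /cvg_ex[l] hl.
  rewrite /partial /derive (cvg_lim _ hl)//.
have IQ h : h != 0 -> `|h| < 1 -> h^-1 * (0 - 0) = IR (Q h).
  move=> h0 h1; have si : integrable_Rn (fun y => f (h *: e + y)).
    by apply: (@integrable_Rn_box (b + 1)) => // y nby; exact/f0/box_shift.
  rewrite /Q IRZ; last exact: integrable_RnB.
  rewrite IRB//; congr (_ * _).
  have <- := @IR_shift R n f (h *: e) (continuous_meas_Rn cf).
  by under [X in _ = _ - IR X]eq_fun do rewrite addrC; rewrite !subrr.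
have := @is_derive_IR R n (fun=> 0) 0 1 Q (partial i f) g ltr01
  (continuous_meas_Rn (cdf i)) gi IQ (fun h _ _ => continuous_meas_Rn (cQ h)) Qg Qd.
by case=> _; rewrite derive_cst.
Qed.

End Weight.

Lemma is_derive_mul (R : realType) (V : normedModType R) (f g : V -> R) (y v : V) (df dg : R) :
  is_derive y v f df -> is_derive y v g dg ->
  is_derive y v (fun z => f z * g z) (df * g y + f y * dg).
Proof.
move=> hf hg; rewrite (_ : df * g y + f y * dg = f y *: dg + g y *: df).
  exact: (is_deriveM hf hg).
by rewrite -![_ *: _]/(_ * _); ring.
Qed.

Section C1.
Context {R : realType} {n : nat}.
Implicit Types (f g : 'rV[R]_n -> R) (y : 'rV[R]_n) (b : R) (i : 'I_n).

Definition C1 f := [/\ continuous f, forall i y, derivable f y (delta_mx 0 i) &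
  forall i, continuous (partial i f)].

Lemma C1_is_derive f i y : C1 f -> is_derive y (delta_mx 0 i) f (partial i f y).
Proof. by case=> _ df _; apply: derivableP. Qed.

Lemma C1_of_is_derive f (df : 'I_n -> 'rV[R]_n -> R) : continuous f ->
  (forall i y, is_derive y (delta_mx 0 i) f (df i y)) ->
  (forall i, continuous (df i)) -> C1 f /\ forall i, partial i f = df i.
Proof.
move=> cf hf cdf; have E i : partial i f = df i.
  by apply/funext => y; case: (hf i y).
by split=> //; split=> // i; rewrite E.
Qed.

Lemma C1M f g : C1 f -> C1 g -> C1 (fun y => f y * g y) /\
  forall i, partial i (fun y => f y * g y) =
            fun y => partial i f y * g y + f y * partial i g y.
Proof.
move=> hf hg; apply: C1_of_is_derive.
- by move=> y; apply: (contM (T := 'rV[R]_n)); [case: hf => + _ _; apply|case: hg => + _ _; apply].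
- by move=> i y; apply: is_derive_mul; exact: C1_is_derive.
- move=> i y; have [cf df cdf] := hf; have [cg dg cdg] := hg.
  by apply: (contD (T := 'rV[R]_n)); apply: (contM (T := 'rV[R]_n));
    [exact: cdf|exact: cg|exact: cf|exact: cdg].
Qed.

Lemma C1D f g : C1 f -> C1 g -> C1 (fun y => f y + g y) /\
  forall i, partial i (fun y => f y + g y) = fun y => partial i f y + partial i g y.
Proof.
move=> hf hg; have [cf df cdf] := hf; have [cg dg cdg] := hg; apply: C1_of_is_derive.
- by move=> y; apply: (contD (T := 'rV[R]_n)); [exact: cf|exact: cg].
- by move=> i y; apply: is_deriveD; exact: C1_is_derive.
- by move=> i y; apply: (contD (T := 'rV[R]_n)); [exact: cdf|exact: cdg].
Qed.

Lemma C1B f g : C1 f -> C1 g -> C1 (fun y => f y - g y) /\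
  forall i, partial i (fun y => f y - g y) = fun y => partial i f y - partial i g y.
Proof.
move=> hf hg; have [cf df cdf] := hf; have [cg dg cdg] := hg; apply: C1_of_is_derive.
- by move=> y; apply: (contB (T := 'rV[R]_n)); [exact: cf|exact: cg].
- by move=> i y; apply: is_deriveB; exact: C1_is_derive.
- by move=> i y; apply: (contB (T := 'rV[R]_n)); [exact: cdf|exact: cdg].
Qed.

Lemma C1_rho : C1 (@rho R n) /\ forall i, partial i (@rho R n) =
  fun y => - (y 0 i / 2) * rho y.
Proof.
apply: C1_of_is_derive => [|i y|i y]; [exact: rho_continuous|exact: is_derive_rho|].
apply: (contM (T := 'rV[R]_n)); last exact: rho_continuous.
apply: (contN (T := 'rV[R]_n)); apply: (contM (T := 'rV[R]_n)); last exact: cont_cst.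
exact: coord_continuous.
Qed.

Lemma weight_C1 b g : weight b g -> C1 g.
Proof. by case=> h1 h2 h3 _; split. Qed.

Lemma weightM b g f : weight b g -> C1 f -> weight b (fun y => g y * f y).
Proof.
move=> wg hf; have [[h1 h2 h3] _] := C1M (weight_C1 wg) hf; split => //.
by case: wg => _ _ _ g0 y /g0 ->; rewrite mul0r.
Qed.

Lemma weight_rho b g : weight b g -> weight b (fun y => g y * rho y).
Proof. by move=> wg; apply: weightM => //; case: C1_rho. Qed.

Lemma integrable_Rn_sum (I : finType) (F : I -> 'rV[R]_n -> R) :
  (forall j, integrable_Rn (F j)) -> integrable_Rn (fun y => \sum_j F j y) /\
  IR (fun y => \sum_j F j y) = \sum_j IR (F j).
Proof.
move=> Fi; elim: (index_enum I) => [|i r [IH1 IH2]].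
  rewrite big_nil; under eq_fun do rewrite big_nil.
  have i0 : integrable_Rn (fun _ : 'rV[R]_n => 0) by exact: integrable0.
  split=> //; transitivity (0 * IR (fun _ : 'rV[R]_n => 0 : R)); last by rewrite mul0r.
  by rewrite -IRZ//; congr IR; apply/funext => y; rewrite mul0r.
rewrite big_cons; under eq_fun do rewrite big_cons; split.
  exact: integrable_RnD.
by rewrite IRD// IH2.
Qed.

Lemma IR_divergence b (F : 'I_n -> 'rV[R]_n -> R) : (forall i, weight b (F i)) ->
  integrable_Rn (fun y => \sum_i partial i (F i) y) /\
  IR (fun y => \sum_i partial i (F i) y) = 0.
Proof.
move=> wF; have iF i : integrable_Rn (partial i (F i)).
  have [_ _ cd F0] := wF i.
  apply: (@integrable_Rn_box _ _ b) => // y nby; exact: partial_eq0 nby.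
have [h1 h2] := @integrable_Rn_sum _ (fun i => partial i (F i)) iF.
by split => //; rewrite h2 big1// => i _; exact: IR_partial0 (wF i).
Qed.

End C1.

(** * Differentiation under the integral sign *)

Section Slabs.
Context {R : realType} {n : nat}.
Implicit Types (f g : 'rV[R]_n -> R) (y : 'rV[R]_n) (b s : R) (i : 'I_n).

Definition cont_after s1 (F : 'rV[R]_n -> R -> R) :=
  forall y s, s1 < s -> continuous_at (y, s) (fun x : 'rV[R]_n * R => F x.1 x.2).

Definition cont_from s1 (F : 'rV[R]_n -> R -> R) :=
  {within [set x : 'rV[R]_n * R | s1 <= x.2], continuous (fun x => F x.1 x.2)}.

Lemma cont_after_from s1 a F : s1 < a -> cont_after s1 F -> cont_from a F.
Proof.
move=> s1a cF; apply: continuous_in_subspaceT => -[y s]; rewrite inE/= => as_.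
exact/cF/(lt_le_trans s1a).
Qed.

Lemma slab_bound a b c F : cont_from a F -> exists M : R, 0 <= M /\
  forall y s, box b y -> a <= s -> s <= c -> `|F y s| <= M.
Proof.
move=> cF.
have cK : compact (@box R n b `*` `[a, c]%classic).
  by apply: compact_setX; [exact: box_compact|exact: segment_compact].
have cF' : {within @box R n b `*` `[a, c]%classic, continuous (fun x => F x.1 x.2)}.
  apply: continuous_subspaceW cF => -[y s] /= [_]; rewrite in_itv/=.
  by case/andP.
have [M [M0 HM]] := continuous_compact_norm_bound cK cF'.
exists M; split => // y s by_ as_ sc; apply: (HM (y, s)); split => //=.
by rewrite in_itv/= as_.
Qed.

Lemma cont_after_space s1 F s : s1 < s -> cont_after s1 F ->
  continuous (fun y => F y s).
Proof.
move=> s1s cF y.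
apply: (@continuous_comp _ _ _ (fun z : 'rV[R]_n => (z, s)) (fun x => F x.1 x.2)); last exact: cF.
exact: (cvg_pair (@cvg_id _ (nbhs y)) (cvg_cst s)).
Qed.

Lemma cont_after_time s1 F y s : s1 < s -> cont_after s1 F ->
  {for s, continuous (F y)}.
Proof.
move=> s1s cF.
apply: (@continuous_comp _ _ _ (fun z : R => (y, z)) (fun x => F x.1 x.2)); last exact: cF.
exact: (cvg_pair (cvg_cst y) (@cvg_id _ (nbhs s))).
Qed.

Lemma cont_fromP s1 F y s : cont_from s1 F -> s1 <= s -> forall e : R, 0 < e ->
  \forall x \near (y, s), s1 <= x.2 -> `|F y s - F x.1 x.2| < e.
Proof.
move=> cF s1s e e0.
have H : (fun x => F x.1 x.2) @ within [set x : 'rV[R]_n * R | s1 <= x.2] (nbhs (y, s)) --> F y s.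
  exact: ((subspace_continuousP _ (fun x : 'rV[R]_n * R => F x.1 x.2)).1 cF (y, s) s1s).
by have /cvgrPdist_lt/(_ e e0) := H.
Qed.

Lemma cont_from_space s1 F s : s1 <= s -> cont_from s1 F ->
  continuous (fun y => F y s).
Proof.
move=> s1s cF y; apply/(@cvgrPdist_lt _ _ _ (nbhs y)) => e e0.
have H := cont_fromP y cF s1s e0.
have : (fun z : 'rV[R]_n => (z, s)) @ y --> (y, s).
  exact: (cvg_pair (@cvg_id _ (nbhs y)) (cvg_cst s)).
by move=> c; apply: (@filterS _ (nbhs y) _ _ _ _ (c _ H)) => z /(_ s1s).
Qed.

Lemma cont_from_time s1 F y s : s1 <= s -> cont_from s1 F ->
  F y t @[t --> within [set t | s1 <= t] (nbhs s)] --> F y s.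
Proof.
move=> s1s cF; apply/cvgrPdist_lt => e e0.
have H := cont_fromP y cF s1s e0.
have : (fun t : R => (y, t)) @ s --> (y, s).
  exact: (cvg_pair (cvg_cst y) (@cvg_id _ (nbhs s))).
by move=> c; exact: (c _ H).
Qed.

Lemma is_derive_IR_time s1 s b (F F' : 'rV[R]_n -> R -> R) g : s1 < s ->
  (forall y t, s1 < t -> is_derive t 1 (F y) (F' y t)) ->
  cont_after s1 F -> cont_after s1 F' -> continuous g ->
  (forall y, ~ box b y -> g y = 0) ->
  is_derive s 1 (fun t => IR (fun y => F y t * g y)) (IR (fun y => F' y s * g y)).
Proof.
move=> s1s dF cF cF' cg g0.
pose d := (s - s1) / 2.
have d0 : 0 < d by rewrite divr_gt0// subr_gt0.
have s1d : s1 < s - d by rewrite /d; lra.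
have [M [M0 HM]] := slab_bound b (s + d) (cont_after_from s1d cF').
have [K [K0 HK]] := continuous_compact_norm_bound (@box_compact R n b)
  (continuous_subspaceT cg).
have [G [Gi G0 GM]] := @box_dominated R n b (M * K) (mulr_ge0 M0 K0).
have cFg t : s1 < t -> continuous (fun y => F y t * g y).
  move=> s1t y; apply: (contM (T := 'rV[R]_n)); last exact: cg.
  exact: (cont_after_space s1t cF).
have iFg t : s1 < t -> integrable_Rn (fun y => F y t * g y).
  move=> s1t; apply: (@integrable_Rn_box _ _ b); first exact: cFg.
  by move=> y /g0 ->; rewrite mulr0.
have near_s h : `|h| < d -> s - d <= h + s <= s + d.
  by move=> hd; rewrite -lerBlDr addrAC subrr sub0r addrC lerD2l -ler_norml ltW.
have after_s h : `|h| < d -> s1 < h + s.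
  by move=> /near_s /andP[h1 _]; exact: lt_le_trans h1.
apply: (@is_derive_IR _ _ _ s d (fun h y => h^-1 * (F y (h + s) - F y s) * g y) _ G) => //.
- apply: continuous_meas_Rn => y; apply: (contM (T := 'rV[R]_n)); last exact: cg.
  exact: (cont_after_space s1s cF').
- move=> h h0 hd; rewrite -IRB; [|exact/iFg/after_s|exact: iFg].
  rewrite -IRZ; last by apply: integrable_RnB; [exact/iFg/after_s|exact: iFg].
  by congr IR; apply/funext => y; ring.
- move=> h h0 hd; apply: continuous_meas_Rn => y.
  apply: (contM (T := 'rV[R]_n)); last exact: cg.
  apply: (contM (T := 'rV[R]_n)); first exact: cont_cst.
  apply: (contB (T := 'rV[R]_n)); last exact: (cont_after_space s1s cF).
  exact: (cont_after_space (after_s _ hd) cF).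
- move=> h y h0 hd; have [by_|/g0 ->] := pselect (box b y); last first.
    by rewrite mulr0 normr0.
  apply: le_trans (GM _ by_); rewrite normrM ler_pM//; last exact: HK.
  rewrite normrM normfV mulrC ler_pdivrMr ?normr_gt0//.
  have := @mean_value_bound R (F y) (F' y) (s - d) (s + d) M s (h + s).
  rewrite addrK; apply.
  + by move=> x; rewrite in_itv/= => /andP[xs _]; apply: dF; exact: lt_le_trans xs.
  + by move=> x; rewrite in_itv/= => /andP[xs sx]; exact: HM.
  + by rewrite in_itv/= gerBl lerDl ltW.
  + by rewrite in_itv/=; exact: near_s.
- move=> y; apply: cvgM; last exact: cvg_cst.
  have [] := dF y s s1s; rewrite /derivable /derive => /cvg_ex[l hl].
  rewrite (cvg_lim _ hl)// => <-.
  by move: hl; under eq_fun do rewrite /= [_ *: 1]mulr1.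
Qed.
End Slabs.

Section Gradient.
Context {R : realType} {n : nat}.
Variables (w : 'rV[R]_n -> R -> R) (s1 : R).
Hypothesis w21 : C21_after w s1.
Implicit Types (g : 'rV[R]_n -> R) (y : 'rV[R]_n) (b s : R) (i : 'I_n).

Let P i y s := partial i (w^~ s) y.
Let PP i y s := partial i (partial i (w^~ s)) y.

Lemma sol_cont : cont_after s1 w.
Proof. by move=> y s /(w21 y)[]. Qed.

Lemma sol_cont_dt : cont_after s1 (dt w).
Proof. by move=> y s /(w21 y)[_ []]. Qed.

Lemma sol_cont_partial i : cont_after s1 (fun y s => partial i (w^~ s) y).
Proof. by move=> y s /(w21 y)[_ _ /(_ i)[]]. Qed.

Lemma sol_cont_partial2 i j :
  cont_after s1 (fun y s => partial j (partial i (w^~ s)) y).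
Proof. by move=> y s /(w21 y)[_ _ _ /(_ i j)[]]. Qed.

Lemma sol_is_derive_time y s : s1 < s -> is_derive s 1 (w y) (dt w y s).
Proof.
by move=> /(w21 y)[_ [d _] _ _]; rewrite /dt derive1E; exact: derivableP.
Qed.

Lemma sol_C1 s : s1 < s -> C1 (w^~ s).
Proof.
move=> s1s; split.
- exact: (cont_after_space s1s sol_cont).
- by move=> i y; have [_ _ /(_ i)[]] := w21 y s1s.
- by move=> i; exact: (cont_after_space s1s (@sol_cont_partial i)).
Qed.

Lemma sol_partial_C1 i s : s1 < s -> C1 (partial i (w^~ s)).
Proof.
move=> s1s; split.
- exact: (cont_after_space s1s (@sol_cont_partial i)).
- by move=> j y; have [_ _ _ /(_ i j)[]] := w21 y s1s.
- by move=> j; exact: (cont_after_space s1s (@sol_cont_partial2 i j)).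
Qed.

Lemma sqnorm_gradientE (f : 'rV[R]_n -> R) y :
  sqnorm (gradient f y) = \sum_i partial i f y ^+ 2.
Proof. by apply: eq_bigr => i _; rewrite mxE. Qed.

Lemma is_derive_IR_grad b g s : s1 < s -> weight b g ->
  is_derive s 1
    (fun t => IR (fun y => 2^-1 * sqnorm (gradient (w^~ t) y) * g y))
    (IR (fun y => - (dt w y s *
       \sum_i (partial i g y * partial i (w^~ s) y
               + g y * partial i (partial i (w^~ s)) y)))).
Proof.
move=> s1s wg; have [cg dg cdg g0] := wg.
pose d := (s - s1) / 2.
have d0 : 0 < d by rewrite divr_gt0// subr_gt0.
have s1d : s1 < s - d by rewrite /d; lra.
have near_s h : `|h| < d -> s - d <= h + s <= s + d.
  by move=> hd; rewrite -lerBlDr addrAC subrr sub0r addrC lerD2l -ler_norml ltW.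
have after_s h : `|h| < d -> s1 < h + s.
  by move=> /near_s /andP[h1 _]; exact: lt_le_trans h1.
pose q i y h := P i y (h + s) + P i y s.
pose qq i y h := PP i y (h + s) + PP i y s.
pose v y h := w y (h + s) - w y s.
pose B y t := 2^-1 * \sum_i (partial i g y * (P i y t + P i y s)
                            + g y * (PP i y t + PP i y s)).
have C1q i h : `|h| < d -> C1 (fun y => q i y h) /\
    partial i (fun y => q i y h) = fun y => qq i y h.
  move=> hd; have [h1 h2] := C1D (sol_partial_C1 i (after_s _ hd)) (sol_partial_C1 i s1s).
  by split => //; rewrite h2.
have C1v h : `|h| < d -> C1 (fun y => v y h) /\
    forall i, partial i (fun y => v y h) = fun y => P i y (h + s) - P i y s.
  by move=> hd; exact: C1B (sol_C1 (after_s _ hd)) (sol_C1 s1s).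
have wF i h : `|h| < d -> weight b (fun y => g y * (v y h * q i y h)).
  move=> hd; apply: (weightM wg).
  by have [] := C1M (C1v _ hd).1 (C1q i _ hd).1.
have FE i h y : `|h| < d -> partial i (fun y => g y * (v y h * q i y h)) y =
    partial i g y * (v y h * q i y h) + g y * ((P i y (h + s) - P i y s) * q i y h
      + v y h * qq i y h).
  move=> hd; have [hv dv] := C1v _ hd; have [hq dq] := C1q i _ hd.
  have [hvq dvq] := C1M hv hq; have [_ ->] := C1M (weight_C1 wg) hvq.
  by rewrite dvq dv dq.
have cB : cont_after s1 B.
  have cf (f : 'rV[R]_n -> R) y t : continuous f ->
      continuous_at (y, t) (fun x : 'rV[R]_n * R => f x.1).
    by move=> cf; apply: (@continuous_comp _ _ _ fst f); [exact: cvg_fst|exact: cf].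
  move=> y t s1t; apply: (contM (T := ('rV[R]_n * R)%type)); first exact: cont_cst.
  apply: (cont_sum (T := ('rV[R]_n * R)%type)) => i.
  apply: (contD (T := ('rV[R]_n * R)%type)); apply: (contM (T := ('rV[R]_n * R)%type)).
  - exact: cf.
  - apply: (contD (T := ('rV[R]_n * R)%type)); first exact: sol_cont_partial.
    exact: (cf (partial i (w^~ s)) y t (cont_after_space s1s (@sol_cont_partial i))).
  - exact: cf.
  - apply: (contD (T := ('rV[R]_n * R)%type)); first exact: sol_cont_partial2.
    exact: (cf (partial i (partial i (w^~ s))) y t (cont_after_space s1s (@sol_cont_partial2 i i))).
have cv h : `|h| < d -> continuous (fun y => v y h).
  by move=> /C1v[[]].
have B0 y h : ~ box b y -> B y h = 0.
  move=> nby; rewrite /B big1 ?mulr0// => i _.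
  by rewrite (partial_eq0 _ g0 nby) g0// !mul0r addr0.
have dvE h : `|h| < d ->
   IR (fun y => 2^-1 * sqnorm (gradient (w^~ (h + s)) y) * g y) -
   IR (fun y => 2^-1 * sqnorm (gradient (w^~ s) y) * g y) =
   IR (fun y => - (v y h * B y (h + s))).
  move=> hd.
  have cG t : s1 < t -> integrable_Rn (fun y => 2^-1 * sqnorm (gradient (w^~ t) y) * g y).
    move=> s1t; apply: (@integrable_Rn_box _ _ b) => [y|y /g0->]; last by rewrite mulr0.
    apply: (contM (T := 'rV[R]_n)); last exact: cg.
    apply: (contM (T := 'rV[R]_n)); first exact: cont_cst.
    under eq_fun do rewrite sqnorm_gradientE.
    apply: (cont_sum (T := 'rV[R]_n)) => i; apply: (contX (T := 'rV[R]_n)).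
    exact: (cont_after_space s1t (@sol_cont_partial i)).
  have ivB : integrable_Rn (fun y => v y h * B y (h + s)).
    apply: (@integrable_Rn_box _ _ b) => [y|y /B0->]; last by rewrite mulr0.
    by apply: (contM (T := 'rV[R]_n)); [exact: cv|exact: (cont_after_space (after_s _ hd) cB)].
  have [iD D0] := @IR_divergence _ _ b (fun i y => g y * (v y h * q i y h)) (fun i => wF i h hd).
  rewrite -IRB; [|exact/cG/after_s|exact: cG].
  have i2D : integrable_Rn (fun y => 2^-1 * \sum_i partial i (fun y => g y * (v y h * q i y h)) y).
    exact: integrable_RnZ.
  transitivity (IR (fun y => 2^-1 * \sum_i partial i (fun y => g y * (v y h * q i y h)) y - v y h * B y (h + s))).
    congr IR; apply/funext => y; rewrite !sqnorm_gradientE.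
    under [X in _ = 2^-1 * X - _]eq_bigr do rewrite FE//.
    rewrite /B [X in _ = _ - X]mulrCA -2!(mulrA 2^-1) -2!(mulrBr 2^-1); congr (_ * _).
    rewrite !mulr_suml mulr_sumr -!sumrB; apply: eq_bigr => i _.
    rewrite -[partial i (w^~ (h + s)) y]/(P i y (h + s)) -[partial i (w^~ s) y]/(P i y s).
    rewrite /q /qq; move: (P i y (h + s)) (P i y s) (PP i y (h + s)) (PP i y s).
    by move: (partial i g y) (v y h) (g y) => *; ring.
  rewrite IRB// IRZ// D0 mulr0 sub0r -mulN1r -IRZ//.
  by congr IR; apply/funext => y; rewrite mulN1r.
have [M [M0 HM]] := slab_bound b (s + d) (cont_after_from s1d sol_cont_dt).
have [K [K0 HK]] := slab_bound b (s + d) (cont_after_from s1d cB).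
have [G [Gi G0 GM]] := @box_dominated R n b (M * K) (mulr_ge0 M0 K0).
have BE y : B y s = \sum_i (partial i g y * P i y s + g y * PP i y s).
  by rewrite /B mulr_sumr; apply: eq_bigr => i _; field.
apply: (@is_derive_IR _ _ _ s d (fun h y => - (h^-1 * v y h * B y (h + s))) _ G) => //.
- under eq_fun do rewrite -BE.
  apply: continuous_meas_Rn => y; apply: (contN (T := 'rV[R]_n)).
  apply: (contM (T := 'rV[R]_n)).
    exact: (cont_after_space s1s sol_cont_dt).
  exact: (cont_after_space s1s cB).
- move=> h h0 hd; rewrite dvE// -IRZ.
    by congr IR; apply/funext => y; ring.
  apply: (@integrable_Rn_box _ _ b) => [y|y /B0->]; last by rewrite mulr0 oppr0.
  apply: (contN (T := 'rV[R]_n)).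
  by apply: (contM (T := 'rV[R]_n)); [exact: cv|exact: (cont_after_space (after_s _ hd) cB)].
- move=> h h0 hd; apply: continuous_meas_Rn => y; apply: (contN (T := 'rV[R]_n)).
  apply: (contM (T := 'rV[R]_n)); last exact: (cont_after_space (after_s _ hd) cB).
  by apply: (contM (T := 'rV[R]_n)); [exact: cont_cst|exact: cv].
- move=> h y h0 hd; have [by_|/B0 ->] := pselect (box b y); last first.
    by rewrite mulr0 oppr0 normr0.
  apply: le_trans (GM _ by_); rewrite normrN normrM.
  have /andP[hs1 hs2] := near_s _ hd.
  rewrite ler_pM//; last exact: HK.
  rewrite normrM normfV mulrC ler_pdivrMr ?normr_gt0//.
  have := @mean_value_bound R (w y) (dt w y) (s - d) (s + d) M s (h + s).
  rewrite addrK; apply.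
  + move=> x; rewrite in_itv/= => /andP[xs _]; apply: sol_is_derive_time.
    exact: lt_le_trans xs.
  + by move=> x; rewrite in_itv/= => /andP[xs sx]; exact: HM.
  + by rewrite in_itv/= gerBl lerDl ltW.
  + by rewrite in_itv/= hs1.
- move=> y; rewrite -BE; apply: cvgN; apply: cvgM.
    have [] := sol_is_derive_time y s1s; rewrite /derivable /derive => /cvg_ex[l hl].
    rewrite (cvg_lim _ hl)// => <-.
    by move: hl; under eq_fun do rewrite /= [_ *: 1]mulr1.
  apply: cvg_within_filter.
  apply: (@cvg_comp _ _ _ (fun h : R => h + s) (B y) _ (nbhs s)); last first.
    exact: (cont_after_time s1s cB).
  have H : (fun h : R => h + s) @ (0 : R) --> 0 + s.
    exact: (cvgD (@cvg_id _ (nbhs (0 : R))) (cvg_cst s)).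
  by rewrite add0r in H.
Qed.

Lemma weak_formulation b (psi phi : 'rV[R]_n -> R) s : s1 < s ->
  weight b psi -> C1 phi ->
  let f := fun y => psi y * (phi y * divergence (fun z => rho z *: gradient (w^~ s) z) y
    + rho y * \sum_i (partial i phi y * partial i (w^~ s) y))
    + rho y * phi y * \sum_i (partial i psi y * partial i (w^~ s) y) in
  integrable_Rn f /\ IR f = 0.
Proof.
move=> s1s wpsi cphi f.
have [crho drho] := @C1_rho R n.
have cF i : C1 (fun y => rho y * partial i (w^~ s) y).
  by have [] := C1M crho (sol_partial_C1 i s1s).
have cF2 i : C1 (fun y => phi y * (rho y * partial i (w^~ s) y)).
  by have [] := C1M cphi (cF i).
have [h1 h2] := @IR_divergence R n b
  (fun i y => psi y * (phi y * (rho y * partial i (w^~ s) y)))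
  (fun i => weightM wpsi (cF2 i)).
suff E : f = fun y => \sum_i partial i (fun y => psi y * (phi y * (rho y * partial i (w^~ s) y))) y.
  by rewrite E.
apply/funext => y; rewrite /f /divergence !mulr_sumr.
rewrite -big_split/= mulr_sumr -big_split/=; apply: eq_bigr => i _.
have [_ ->] := C1M (weight_C1 wpsi) (cF2 i).
have [_ ->] := C1M cphi (cF i).
under [X in partial i X y]eq_fun do rewrite !mxE.
ring.
Qed.

End Gradient.

(** * The nonlinearity *)

Section AbsPower.
Context {R : realType}.
Implicit Types (x z q : R).

Lemma continuous_abs_powR q : 0 < q -> continuous (fun z : R => `|z| `^ q).
Proof.
move=> q0 z; have [->|z0] := eqVneq z 0.
  apply/(@cvgrPdist_lt _ _ _ (nbhs (0 : R))) => e e0.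
  have d0 : 0 < e `^ q^-1 by exact: powR_gt0.
  have H : \forall t \near nbhs (0 : R), `|t| < e `^ q^-1.
    exact: (@cvgr0_norm_lt _ _ _ (nbhs (0 : R)) _ id (@cvg_id _ (nbhs (0 : R)))).
  apply: filterS H => t te.
  rewrite normr0 powR0 ?gt_eqF// sub0r normrN ger0_norm ?powR_ge0//.
  rewrite -[ltRHS](@powRr1 _ e) ?ltW// -(mulVf (lt0r_neq0 q0)) powRrM.
  by rewrite gt0_ltr_powR// ?nnegrE ?powR_ge0.
have z0' : 0 < `|z| by rewrite normr_gt0.
refine (@cont_comp R R R (fun t : R => powR t q) (fun t : R => `|t|) z _ _).
  exact: norm_continuous.
apply: differentiable_continuous; apply/derivable1_diffP.
by have [] := is_derive1_powR q z0'.
Qed.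

Lemma is_derive_abs_powR q z : 1 < q ->
  is_derive z 1 (fun t : R => `|t| `^ (q + 1)) ((q + 1) * (`|z| `^ (q - 1) * z)).
Proof.
move=> q1.
have pos x : 0 < x -> is_derive x 1 (fun t : R => `|t| `^ (q + 1)) ((q + 1) * (`|x| `^ (q - 1) * x)).
  move=> x0.
  have H : \forall t \near x, powR t (q + 1) = `|t| `^ (q + 1).
    by apply: filterS (lt_nbhsr x0) => t t0; rewrite gtr0_norm.
  apply: near_eq_is_derive H _.
  have := is_derive1_powR (q + 1) x0; rewrite addrK gtr0_norm//.
  by rewrite [_ `^ (q - 1) * x]mulrC mulr_powRB1 ?ltW// (lt_trans _ q1).
have [z0|z0|->] := ltgtP z 0; last 1 first.
- have H : (fun h : R => h^-1 *: (((fun t : R => `|t| `^ (q + 1)) \o shift 0) (h *: 1) - `|0 : R| `^ (q + 1))) @ 0^' --> (0 : R).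
    have cq : (fun t : R => `|t| `^ q) @ 0^' --> (0 : R).
      apply: cvg_within_filter; have := @continuous_abs_powR q (lt_trans ltr01 q1) 0.
      by rewrite /continuous_at normr0 powR0 ?gt_eqF// (lt_trans ltr01 q1).
    apply/cvgr0Pnorm_lt => e e0.
    have /cvgr0Pnorm_lt/(_ e e0) := cq.
    apply: filterS2 (nbhs_dnbhs_neq 0) => h h0.
    rewrite /= /shift/= [h *: 1]mulr1 addr0 normr0 powR0 ?gt_eqF ?addr_gt0 ?(lt_trans ltr01 q1)// subr0.
    rewrite [in X in _ -> X]normrM normfV [`| `|h| `^ (q + 1)|]ger0_norm ?powR_ge0//.
    rewrite ger0_norm ?powR_ge0// powRD; last by rewrite normr_eq0 h0 implybT.
    by rewrite powRr1// mulrCA mulVf ?mulr1// normr_eq0.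
  by rewrite mulr0 mulr0; split; [apply/cvg_ex; exists 0|exact/cvg_lim].
- have nz0 : 0 < - z by rewrite oppr_gt0.
  have dN : is_derive z 1 (fun t : R => - t) (- 1).
    exact: is_deriveN.
  have := is_derive_comp1 dN (pos _ nz0).
  under [fun t : R => `|- t| `^ _]eq_fun do rewrite normrN.
  by rewrite normrN => H; apply: (is_derive_eq H); ring.
- exact: pos.
Unshelve. all: by end_near. Qed.

End AbsPower.

Section Nonlinear.
Context {R : realType}.
Variables (a p mu : R).
Hypotheses (a0 : 0 < a) (p1 : 1 < p).
Implicit Types (x z s m : R).

Let L z := ln (2 + z ^+ 2).

Lemma log_ge_ln2 z : ln 2 <= ln (2 + z ^+ 2) :> R.
Proof. by rewrite ler_ln ?posrE ?ltr_wpDr ?sqr_ge0// lerDl sqr_ge0. Qed.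

Lemma ln2_gt0 : 0 < ln 2 :> R.
Proof. by rewrite ln_gt0// ltr1n. Qed.

Lemma log_gt0 z : 0 < ln (2 + z ^+ 2) :> R.
Proof. exact: lt_le_trans ln2_gt0 (log_ge_ln2 z). Qed.

Lemma is_derive_log z : is_derive z 1 (fun t : R => ln (2 + t ^+ 2)) (2 * z / (2 + z ^+ 2)).
Proof.
have d0 : 0 < 2 + z ^+ 2 by rewrite ltr_wpDr ?sqr_ge0.
have H : is_derive z 1 (fun t : R => 2 + t ^+ 2) (2 * z).
  by apply: is_derive_eq; rewrite /= -![_ *: _]/(_ * _); ring.
by apply: (is_derive_eq (is_derive_comp1 H (is_derive1_ln d0))); rewrite mulrC.
Qed.

Lemma is_derive_log_pow b z : is_derive z 1 (fun t : R => ln (2 + t ^+ 2) `^ (- b))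
  (- b * ln (2 + z ^+ 2) `^ (- b - 1) * (2 * z / (2 + z ^+ 2))).
Proof.
exact: (is_derive_comp1 (is_derive_log z) (is_derive1_powR (- b) (log_gt0 z))).
Qed.

Lemma h_continuous : continuous (h a p mu).
Proof.
move=> z.
refine (@contM R R (fun _ => mu) (fun z => `|z| `^ (p - 1) * z / ln (2 + z ^+ 2) `^ a) z _ _).
  exact: cont_cst.
refine (@contM R R (fun z => `|z| `^ (p - 1) * z) (fun z => (ln (2 + z ^+ 2) `^ a)^-1) z _ _).
  refine (@contM R R (fun z => `|z| `^ (p - 1)) (fun z => z) z _ _).
    by apply: continuous_abs_powR; rewrite subr_gt0.
  exact: cvg_id.
rewrite (_ : (fun z => _) = fun z => ln (2 + z ^+ 2) `^ (- a)); last first.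
  by apply/funext => t; rewrite powRN.
apply: differentiable_continuous; apply/derivable1_diffP.
by have [] := is_derive_log_pow a z.
Qed.

Lemma h_odd z : h a p mu (- z) = - h a p mu z.
Proof. by rewrite /h normrN sqrrN mulrN mulNr mulrN. Qed.

Lemma H_at0 : H a p mu 0 = 0.
Proof. by rewrite /H lexx set_itv1 Rintegral_set1. Qed.

Lemma h_integrable x z : (@lebesgue_measure R).-integrable `[x, z] (EFin \o h a p mu).
Proof.
apply: continuous_compact_integrable; first exact: segment_compact.
exact/continuous_subspaceT/h_continuous.
Qed.

Lemma is_derive_H z : is_derive z 1 (H a p mu) (h a p mu z).
Proof.
pose c := `|z| + 1.
have c0 : 0 < c by rewrite ltr_wpDl.
pose F x := Rintegral (@lebesgue_measure R) `[- c, x] (h a p mu).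
have HF x : - c <= x -> x <= c -> H a p mu x = F x - F 0.
  move=> cx xc; rewrite /H /F; case: ifPn => [x0|].
    rewrite -[RHS]/(_ - _) Rintegral_itvB//; last first.
    - by rewrite bnd_simp oppr_le0 ltW.
    - exact: h_integrable.
    rewrite Rintegral_itv_obnd_cbnd//.
    by apply: integrableS (h_integrable 0 x) => //; apply: subset_itvr; rewrite bnd_simp.
  rewrite -ltNge => x0; rewrite -opprB; congr (- _).
  rewrite Rintegral_itvB//; last first.
  - by rewrite bnd_simp ltW.
  - exact: h_integrable.
  rewrite Rintegral_itv_obnd_cbnd//.
  by apply: integrableS (h_integrable x 0) => //; apply: subset_itvr; rewrite bnd_simp.
have zc : z < c by rewrite (le_lt_trans (ler_norm _))// ltrDl.
have cz : - c < z by rewrite ltrNl (le_lt_trans (ler_norm _))// normrN ltrDl.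
have [dF F'] := continuous_FTC1_closed zc (h_integrable (- c) c) cz (@h_continuous z).
have H1 : \forall x \near z, F x - F 0 = H a p mu x.
  have : \forall x \near z, - c < x by exact: lt_nbhsr.
  have : \forall x \near nbhs z, x < c by exact: lt_nbhsl.
  by apply: filterS2 => x h1 h2; rewrite HF ?ltW.
apply: near_eq_is_derive H1 _.
have dF' : is_derive z 1 F (h a p mu z).
  by split; [exact: dF|rewrite -derive1E; exact: F'].
by apply: (is_derive_eq (is_deriveB dF' (is_derive_cst (F 0) z 1))); rewrite subr0.
Qed.

Lemma H_continuous : continuous (H a p mu).
Proof.
move=> z; apply: differentiable_continuous; apply/derivable1_diffP.
by have [] := is_derive_H z.
Qed.

Lemma H_even z : H a p mu (- z) = H a p mu z.
Proof.
have d x : is_derive x 1 (fun t => H a p mu (- t) - H a p mu t) 0.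
  have dN : is_derive x 1 (fun t : R => - t) (- 1) by exact: is_deriveN.
  apply: (is_derive_eq (is_deriveB (is_derive_comp1 dN (is_derive_H (- x))) (is_derive_H x))).
  by rewrite h_odd; ring.
have E : `|H a p mu (- z) - H a p mu z - (H a p mu (- 0) - H a p mu 0)| <= 0 * `|z - 0|.
  apply: (@mean_value_bound R (fun t => H a p mu (- t) - H a p mu t) (fun=> 0)
    (- `|z|) `|z| 0 0 z (fun x _ => d x)).
  - by move=> x _; rewrite normr0.
  - by rewrite in_itv/= oppr_le0 normr_ge0.
  - by rewrite in_itv/= -ler_norml.
by move: E; rewrite oppr0 subrr subr0 mul0r normr_le0 subr_eq0 => /eqP.
Qed.

(* [Q z = (p + 1) H z - z h z] is the lower order remainder: the main parts of
   [(p + 1) H] and [z h] cancel and [Q'] gains a factor [1 / log]. *)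
Lemma is_derive_remainder z : 0 < z ->
  is_derive z 1 (fun t => (p + 1) * H a p mu t - t * h a p mu t)
    (2 * a * mu * (z `^ p * (z ^+ 2 / (2 + z ^+ 2)) * ln (2 + z ^+ 2) `^ (- (a + 1)))).
Proof.
move=> z0.
have dh : is_derive z 1 (fun t : R => t * h a p mu t)
  (mu * ((p + 1) * z `^ p * ln (2 + z ^+ 2) `^ (- a) +
    z `^ (p + 1) * (- a * ln (2 + z ^+ 2) `^ (- a - 1) * (2 * z / (2 + z ^+ 2))))).
  have H : \forall t \near z, mu * (powR t (p + 1) * ln (2 + t ^+ 2) `^ (- a)) = t * h a p mu t.
    apply: filterS (lt_nbhsr z0) => t t0; rewrite /h gtr0_norm// powRN.
    have -> : t `^ (p + 1) = t * (t `^ (p - 1) * t).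
      by rewrite [_ * t]mulrC mulr_powRB1 ?ltW// ?(lt_trans _ p1)// -(@mulr_powRB1 _ t (p + 1)) ?ltW// ?addrK// addr_gt0// (lt_trans _ p1).
    ring.
  apply: near_eq_is_derive H _.
  have D1 := is_derive1_powR (p + 1) z0; rewrite addrK in D1.
  have D2 := is_derive_mul D1 (is_derive_log_pow a z).
  by apply: (is_derive_eq (is_derive_mul (is_derive_cst mu z 1) D2)); rewrite mul0r add0r.
have dH : is_derive z 1 (fun t => (p + 1) * H a p mu t) ((p + 1) * h a p mu z).
  by apply: (is_derive_eq (is_derive_mul (is_derive_cst (p + 1) z 1) (is_derive_H z))); rewrite mul0r add0r.
apply: (is_derive_eq (is_deriveB dH dh)).
have -> : h a p mu z = mu * (z `^ p * ln (2 + z ^+ 2) `^ (- a)).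
  rewrite /h gtr0_norm// powRN [_ * z]mulrC mulr_powRB1 ?ltW// (lt_trans _ p1)//.
have -> : z `^ (p + 1) = z * z `^ p.
  by rewrite -(@mulr_powRB1 _ z (p + 1)) ?ltW// ?addrK// addr_gt0// (lt_trans _ p1).
by rewrite opprD; ring.
Qed.
End Nonlinear.

Section NonlinearBounds.
Context {R : realType}.
Implicit Types (x z s m b k : R).

Lemma expRN_le_powR k b : 0 < k -> 0 < b ->
  exists C : R, 0 < C /\ forall s, 0 < s -> expR (- (k * s)) <= C * s `^ (- b).
Proof.
move=> k0 b0; exists (expR (- b - b * ln (k / b))); split; first exact: expR_gt0.
move=> s s0; rewrite /powR gt_eqF// -expRD ler_expR.
have x0 : 0 < k * s / b by rewrite divr_gt0 ?mulr_gt0.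
have := @le_ln1Dx R (k * s / b - 1); rewrite addrCA subrr addr0 => /(_ _).
have -> : -1 < k * s / b - 1 by lra.
move=> /(_ isT); have E : k * s / b = (k / b) * s by ring.
rewrite {1}E lnM ?posrE ?divr_gt0// => H.
have : b * (ln (k / b) + ln s) <= b * (k * s / b - 1) by rewrite ler_pM2l.
rewrite mulrBr E mulrA [b * (k / b)]mulrC divfK ?gt_eqF// => H2; lra.
Qed.

Lemma powRN_le b x y : 0 <= b -> 0 < x -> x <= y -> y `^ (- b) <= x `^ (- b).
Proof.
move=> b0 x0 xy; have y0 := lt_le_trans x0 xy.
rewrite !powRN lef_pV2 ?posrE ?powR_gt0//.
by rewrite ge0_ler_powR// ?nnegrE ltW.
Qed.

Variables (a p mu : R).
Hypotheses (a0 : 0 < a) (p1 : 1 < p).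
Let p0 : 0 < p. Proof. exact: lt_trans p1. Qed.

Lemma log_split b z m : 0 < b -> 0 <= z -> 1 < m ->
  z `^ p * ln (2 + z ^+ 2) `^ (- b) <=
  m `^ p * ln 2 `^ (- b) + z `^ p * (2 * ln m) `^ (- b).
Proof.
move=> b0 z0 m1; have m0 : 0 < m := lt_trans ltr01 m1.
have [zm|mz] := leP z m.
  rewrite ler_wpDr ?mulr_ge0 ?powR_ge0// ler_pM ?powR_ge0//.
    by rewrite ge0_ler_powR ?nnegrE// ltW.
  by apply: powRN_le; [exact: ltW|exact: ln2_gt0|exact: log_ge_ln2].
rewrite ler_wpDl ?mulr_ge0 ?powR_ge0// ler_wpM2l ?powR_ge0//.
apply: powRN_le; first exact: ltW.
  by rewrite mulr_gt0// ln_gt0.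
rewrite mulr_natl -lnXn// ler_ln ?posrE ?exprn_gt0 ?ltr_wpDr ?sqr_ge0//.
by rewrite ler_wpDl// lerXn2r ?nnegrE ?(ltW m0) ?(ltW mz).
Qed.

Lemma mulr_absh_bound z m : 1 < m -> `|z * h a p mu z| <=
  `|mu| * (ln 2 `^ (- a) + 1) *
  (m `^ p * `|z| + `|z| `^ (p + 1) * (2 * ln m) `^ (- a)).
Proof.
move=> m1; have := log_split a0 (normr_ge0 z) m1; rewrite real_normK ?num_real// => H.
have E : `|z * h a p mu z| = `|mu| * (`|z| * (`|z| `^ p * ln (2 + z ^+ 2) `^ (- a))).
  rewrite /h -powRN !normrM [`|_ `^ (- a)|]ger0_norm ?powR_ge0//.
  rewrite [`| `|z| `^ _|]ger0_norm ?powR_ge0// [_ * `|z| in LHS]mulrC mulr_powRB1//.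
  by rewrite mulrCA.
rewrite E -mulrA ler_wpM2l//.
have -> : `|z| `^ (p + 1) = `|z| * `|z| `^ p.
  by rewrite -(@mulr_powRB1 _ `|z| (p + 1)) ?addrK// addr_gt0.
set l2 := ln 2 `^ (- a) in H *; set lm := (_ * ln m) `^ _ in H *.
have l20 : 0 <= l2 by exact: powR_ge0.
have lm0 : 0 <= lm by exact: powR_ge0.
apply: le_trans (ler_wpM2l (normr_ge0 z) H) _.
have zp0 : 0 <= `|z| `^ p by exact: powR_ge0.
have mp0 : 0 <= m `^ p by exact: powR_ge0.
have h1 : 0 <= m `^ p * `|z| by rewrite mulr_ge0.
have h2 : 0 <= `|z| * `|z| `^ p * lm * l2 by rewrite !mulr_ge0.
nra.
Qed.

Lemma remainder_bound z m : 1 < m ->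
  `|(p + 1) * H a p mu z - z * h a p mu z| <=
  2 * a * `|mu| * (ln 2 `^ (- (a + 1)) + 1) *
  (m `^ p * `|z| + `|z| `^ (p + 1) * (2 * ln m) `^ (- (a + 1))).
Proof.
move=> m1.
set l2 := ln 2 `^ _; set lm := (_ * ln m) `^ _; set c := 2 * a * _ * _.
have l20 : 0 <= l2 by exact: powR_ge0.
have lm0 : 0 <= lm by exact: powR_ge0.
have c1 : 0 <= 2 * a * `|mu| by rewrite !mulr_ge0// ltW.
have c0 : 0 <= c by rewrite mulr_ge0// addr_ge0.
pose Q t := (p + 1) * H a p mu t - t * h a p mu t.
pose B (t : R) := c * (m `^ p * t + `|t| `^ (p + 1) * lm).
have mp0 : 0 <= m `^ p by exact: powR_ge0.
pose Q' (t : R) := 2 * a * mu * (t `^ p * (t ^+ 2 / (2 + t ^+ 2)) * ln (2 + t ^+ 2) `^ (- (a + 1))).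
pose B' (t : R) := c * (m `^ p + (p + 1) * (`|t| `^ (p - 1) * t) * lm).
have dB (t : R) : is_derive t 1 B (B' t).
  have d1 := is_derive_mul (is_derive_abs_powR t p1) (is_derive_cst lm t 1).
  have d2 := is_derive_mul (is_derive_cst (m `^ p) t 1) (is_derive_id t 1).
  by apply: (is_derive_eq (is_derive_mul (is_derive_cst c t 1) (is_deriveD d2 d1))); rewrite /B' /cst !mul0r add0r mulr0 mulr1 addr0 add0r.
have QB t : 0 < t -> `|Q' t| <= B' t.
  move=> t0; have b0 : 0 < a + 1 by rewrite addr_gt0.
  have := log_split b0 (ltW t0) m1; rewrite -/l2 -/lm => H1.
  have f0 : 0 <= t ^+ 2 / (2 + t ^+ 2) by rewrite divr_ge0 ?sqr_ge0// ltW// ltr_wpDr ?sqr_ge0.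
  have f1 : t ^+ 2 / (2 + t ^+ 2) <= 1.
    by rewrite ler_pdivrMr ?mul1r ?lerDr// ltr_wpDr ?sqr_ge0.
  have E : `|Q' t| = 2 * a * `|mu| * (t `^ p * (t ^+ 2 / (2 + t ^+ 2)) * ln (2 + t ^+ 2) `^ (- (a + 1))).
    rewrite /Q' normrM [`|2 * a * mu|]normrM (ger0_norm (_ : 0 <= 2 * a)); last by rewrite mulr_ge0// ltW.
    by congr (_ * _); apply: ger0_norm; exact: mulr_ge0 (mulr_ge0 (powR_ge0 _ _) f0) (powR_ge0 _ _).
  rewrite E /B' /c -[leRHS]mulrA; apply: ler_wpM2l => //; rewrite gtr0_norm//.
  rewrite [_ `^ (p - 1) * t]mulrC mulr_powRB1 ?(ltW t0)//.
  have tp0 : 0 <= t `^ p by exact: powR_ge0.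
  have L0 : 0 <= ln (2 + t ^+ 2) `^ (- (a + 1)) by exact: powR_ge0.
  have h1 : t `^ p * (t ^+ 2 / (2 + t ^+ 2)) * ln (2 + t ^+ 2) `^ (- (a + 1)) <=
      t `^ p * ln (2 + t ^+ 2) `^ (- (a + 1)).
    by rewrite ler_wpM2r// ler_piMr.
  apply: le_trans h1 (le_trans H1 _).
  have h2 : 0 <= t `^ p * lm * l2 by rewrite !mulr_ge0.
  have h3 : 0 <= t `^ p * lm by rewrite !mulr_ge0.
  have h4 : 0 <= p * (t `^ p * lm) by rewrite mulr_ge0// ltW.
  have h5 : 0 <= p * (t `^ p * lm * l2) by rewrite mulr_ge0// ltW.
  nra.
have dQ (t : R) : 0 < t -> is_derive t 1 Q (Q' t) by exact: is_derive_remainder.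
have Q0 : Q 0 = 0 by rewrite /Q H_at0 mulr0 mul0r subrr.
have B0 : B 0 = 0 by rewrite /B normr0 powR0 ?gt_eqF ?addr_gt0// mulr0 mul0r addr0 mulr0.
have cQ : continuous Q.
  move=> t; refine (@contB R R (fun t => (p + 1) * H a p mu t) (fun t => t * h a p mu t) t _ _).
    refine (@contM R R (fun=> p + 1) (H a p mu) t _ _); first exact: cont_cst.
    exact: H_continuous.
  by refine (@contM R R id (h a p mu) t _ _); [exact: cvg_id|exact: h_continuous].
have cB : continuous B.
  move=> t; apply: differentiable_continuous; apply/derivable1_diffP.
  by have [] := dB t.
have pos t : 0 <= t -> `|Q t| <= B t.
  move=> t0; rewrite ler_norml; apply/andP; split.
  - rewrite -subr_ge0 opprK.
    have := @ger0_derive1_ndecr R (fun t => Q t + B t) 0 t.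
    move=> /(_ _ _ _ 0 t (lexx 0) t0 (lexx t)); rewrite Q0 B0 addr0; apply.
    + by move=> x; rewrite in_itv/= => /andP[x0 _]; have [] := is_deriveD (dQ x x0) (dB x).
    + move=> x; rewrite in_itv/= => /andP[x0 _]; rewrite derive1E.
      have [_ ->] := is_deriveD (dQ x x0) (dB x).
      by rewrite -lerBlDr sub0r; have := QB x x0; rewrite ler_norml => /andP[].
    + apply: continuous_subspaceT => x.
      by refine (@contD R R Q B x _ _); [exact: cQ|exact: cB].
  - rewrite -subr_ge0.
    have := @ger0_derive1_ndecr R (fun t => B t - Q t) 0 t.
    move=> /(_ _ _ _ 0 t (lexx 0) t0 (lexx t)); rewrite Q0 B0 subr0; apply.
    + by move=> x; rewrite in_itv/= => /andP[x0 _]; have [] := is_deriveB (dB x) (dQ x x0).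
    + move=> x; rewrite in_itv/= => /andP[x0 _]; rewrite derive1E.
      have [_ ->] := is_deriveB (dB x) (dQ x x0).
      by rewrite subr_ge0; have := QB x x0; rewrite ler_norml => /andP[].
    + apply: continuous_subspaceT => x.
      by refine (@contB R R B Q x _ _); [exact: cB|exact: cQ].
have [z0|z0] := leP 0 z.
  by have := pos z z0; rewrite /B (ger0_norm z0).
have := pos (- z); rewrite oppr_ge0 (ltW z0) => /(_ isT).
by rewrite /Q /B normrN (ltr0_norm z0) H_even// h_odd mulrNN.
Qed.

End NonlinearBounds.

Section ScaledBounds.
Context {R : realType}.
Variables (a p mu : R).
Hypotheses (a0 : 0 < a) (p1 : 1 < p).
Implicit Types (w x z s m b c : R).

Lemma norm_le_powR x : `|x| <= `|x| `^ (p + 1) + 1.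
Proof.
have [x1|x1] := leP `|x| 1; first by rewrite ler_wpDl// powR_ge0.
rewrite ler_wpDr// -{1}(@powRr1 _ `|x|)// ler_powR ?ltW//.
by rewrite ltrDr (lt_trans ltr01).
Qed.

Lemma scaled_bound b c : 0 < b -> 0 <= c -> exists C : R, 0 < C /\
  forall s w, 1 <= s ->
  expR (- ((p + 1) / (p - 1) * s)) *
    (c * (expR (s / (2 * (p - 1))) `^ p * `|expR (s / (p - 1)) * w|
      + `|expR (s / (p - 1)) * w| `^ (p + 1)
        * (2 * ln (expR (s / (2 * (p - 1))))) `^ (- b)))
  <= C * s `^ (- b) * (`|w| `^ (p + 1) + 1).
Proof.
move=> b0 c0; have q0 : 0 < p - 1 by rewrite subr_gt0.
have p0 : 0 < p := lt_trans ltr01 p1.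
have k0 : 0 < p / (2 * (p - 1)) by rewrite divr_gt0// mulr_gt0.
have [C1 [C10 HC1]] := expRN_le_powR k0 b0.
have D0 : 0 <= (p - 1) `^ b by exact: powR_ge0.
exists (c * (C1 + (p - 1) `^ b) + 1); split.
  by rewrite ltr_wpDl// mulr_ge0// addr_ge0// ltW.
move=> s w s1; have s0 : 0 < s := lt_le_trans ltr01 s1.
have W0 : 0 <= `|w| `^ (p + 1) by exact: powR_ge0.
have sb0 : 0 <= s `^ (- b) by exact: powR_ge0.
have E1 : expR (- ((p + 1) / (p - 1) * s)) *
    (expR (s / (2 * (p - 1))) `^ p * `|expR (s / (p - 1)) * w|) =
    expR (- (p / (2 * (p - 1)) * s)) * `|w|.
  rewrite normrM (ger0_norm (expR_ge0 _)) -expRM mulrA mulrA -!expRD; congr (expR _ * _).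
  by field; rewrite gt_eqF.
have E2 : expR (- ((p + 1) / (p - 1) * s)) *
    (`|expR (s / (p - 1)) * w| `^ (p + 1) * (2 * ln (expR (s / (2 * (p - 1))))) `^ (- b)) =
    `|w| `^ (p + 1) * (s `^ (- b) * (p - 1) `^ b).
  rewrite normrM (ger0_norm (expR_ge0 _)) (powRM (p + 1) (expR_ge0 _) (normr_ge0 w)) -expRM expRK.
  have -> : 2 * (s / (2 * (p - 1))) = s * (p - 1)^-1 by field; rewrite gt_eqF.
  rewrite powRM ?invr_ge0 ?ltW// -powR_inv1 ?ltW// -powRrM mulN1r opprK.
  rewrite !mulrA -expRD -[RHS]mul1r !mulrA; congr (_ * _ * _ * _).
  by rewrite -expR0; congr expR; ring.
rewrite mulrCA mulrDr E1 E2.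
have wW := norm_le_powR w.
have h1 : expR (- (p / (2 * (p - 1)) * s)) * `|w| <= C1 * s `^ (- b) * (`|w| `^ (p + 1) + 1).
  by rewrite ler_pM ?expR_ge0// HC1.
have h2 : `|w| `^ (p + 1) * (s `^ (- b) * (p - 1) `^ b) <= (p - 1) `^ b * s `^ (- b) * (`|w| `^ (p + 1) + 1).
  have : 0 <= (p - 1) `^ b * s `^ (- b) by rewrite mulr_ge0.
  nra.
rewrite (le_trans (ler_wpM2l c0 (lerD h1 h2)))//.
rewrite -mulrDl -mulrDl mulrA mulrA.
by rewrite ler_wpM2r ?addr_ge0// ler_wpM2r// lerDl.
Qed.

Lemma nonlinear_bounds : exists C : R, 0 < C /\ forall s w, 1 <= s ->
  let e := expR (- ((p + 1) / (p - 1) * s)) in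
  let z := expR (s / (p - 1)) * w in
  e * `|(p + 1) * H a p mu z - z * h a p mu z|
    <= C * s `^ (- (a + 1)) * (`|w| `^ (p + 1) + 1) /\
  e * `|z * h a p mu z| <= C * s `^ (- a) * (`|w| `^ (p + 1) + 1).
Proof.
have q0 : 0 < p - 1 by rewrite subr_gt0.
have a10 : 0 < a + 1 by rewrite addr_gt0.
have c10 : 0 <= 2 * a * `|mu| * (ln 2 `^ (- (a + 1)) + 1).
  by rewrite !mulr_ge0 ?addr_ge0 ?powR_ge0// ltW.
have c20 : 0 <= `|mu| * (ln 2 `^ (- a) + 1).
  by rewrite mulr_ge0 ?addr_ge0 ?powR_ge0.
have [C1 [C10 HC1]] := scaled_bound a10 c10.
have [C2 [C20 HC2]] := scaled_bound a0 c20.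
exists (C1 + C2); split; first exact: addr_gt0.
move=> s w s1 e z; have s0 : 0 < s := lt_le_trans ltr01 s1.
have W0 : 0 <= `|w| `^ (p + 1) + 1 by rewrite addr_ge0 ?powR_ge0.
have m1 : 1 < expR (s / (2 * (p - 1))) by rewrite expR_gt1 divr_gt0// mulr_gt0.
split.
- apply: (@le_trans _ _ (C1 * s `^ (- (a + 1)) * (`|w| `^ (p + 1) + 1))).
    apply: le_trans (HC1 s w s1); apply: ler_wpM2l; first exact: expR_ge0.
    exact: remainder_bound.
  by rewrite ler_wpM2r// ler_wpM2r ?powR_ge0// lerDl ltW.
- apply: (@le_trans _ _ (C2 * s `^ (- a) * (`|w| `^ (p + 1) + 1))).
    apply: le_trans (HC2 s w s1); apply: ler_wpM2l; first exact: expR_ge0.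
    exact: mulr_absh_bound.
  by rewrite ler_wpM2r// ler_wpM2r ?powR_ge0// lerDr ltW.
Qed.
End ScaledBounds.

(** * Cutoff functions and pointwise estimates *)

Section Cutoff.
Context {R : realType} {n : nat}.
Implicit Types (y : 'rV[R]_n) (r : R) (i : 'I_n).

(* The cube makes [cutoff r] continuously differentiable, with
   [|grad phi|^2 <= C phi / r^2]. *)
Definition cutoff r y : R := Num.max 0 (1 - sqnorm y / r ^+ 2) ^+ 3.

Lemma is_derive_pos_cube (x : R) :
  is_derive x 1 (fun t : R => Num.max 0 t ^+ 3) (3 * Num.max 0 x ^+ 2).
Proof.
have -> : (fun t : R => Num.max 0 t ^+ 3) = fun t : R => 2^-1 * (t ^+ 3 + `|t| `^ (2 + 1)).
  apply/funext => t; rewrite (_ : 2 + 1 = 3%:R :> R); last by ring.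
  rewrite powR_mulrn//; have [t0|t0] := leP 0 t; first by rewrite (ger0_norm t0); field.
  by rewrite (ltr0_norm t0); field.
have d1 := is_derive_abs_powR x (ltr1n R 2).
have d2 : is_derive x 1 (fun t : R => t ^+ 3) (3 * x ^+ 2).
  by apply: is_derive_eq; rewrite /= -![_ *: _]/(_ * _); ring.
have d3 := is_derive_mul (is_derive_cst (2^-1 : R) x 1) (is_deriveD d2 d1).
apply: (is_derive_eq d3).
rewrite mul0r add0r (_ : 2 - 1 = 1 :> R); last by ring.
rewrite powRr1//; have [t0|t0] := leP 0 x; first by rewrite (ger0_norm t0) /cst; field.
by rewrite (ltr0_norm t0) /cst; field.
Qed.

Lemma is_derive_cutoff r i y : is_derive y (delta_mx 0 i) (cutoff r)
  (3 * Num.max 0 (1 - sqnorm y / r ^+ 2) ^+ 2 * - (2 * y 0 i / r ^+ 2)).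
Proof.
have H := @is_derive_sqnorm R n i y.
have H2 : is_derive y (delta_mx 0 i) (fun z : 'rV[R]_n => 1 - sqnorm z / r ^+ 2) (- (2 * y 0 i / r ^+ 2)).
  have H3 := is_derive_mul H (is_derive_cst (r ^+ 2)^-1 y (delta_mx 0 i)).
  apply: (is_derive_eq (is_deriveB (is_derive_cst (1 : R) y (delta_mx 0 i)) H3)).
  by rewrite mulr0 addr0 sub0r.
exact: (is_derive_comp1 H2 (is_derive_pos_cube (1 - sqnorm y / r ^+ 2))).
Qed.

Lemma cutoff_arg_continuous r :
  continuous (fun y : 'rV[R]_n => Num.max 0 (1 - sqnorm y / r ^+ 2)).
Proof.
move=> y.
have H : continuous_at y (fun z : 'rV[R]_n => 1 - sqnorm z / r ^+ 2).
  apply: (contB (T := 'rV[R]_n)); first exact: cont_cst.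
  by apply: (contM (T := 'rV[R]_n)); [exact: sqnorm_continuous|exact: cont_cst].
rewrite (_ : (fun z => _) = fun z => 2^-1 * ((1 - sqnorm z / r ^+ 2) + `|1 - sqnorm z / r ^+ 2|)).
  apply: (contM (T := 'rV[R]_n)); first exact: cont_cst.
  apply: (contD (T := 'rV[R]_n)) => //.
  exact: (@cont_comp 'rV[R]_n R R (fun t : R => `|t|) _ y H (@norm_continuous _ R^o _)).
apply/funext => z; move: (1 - sqnorm z / r ^+ 2) => t; have [t0|t0] := leP 0 t.
  by rewrite (ger0_norm t0); field.
by rewrite (ltr0_norm t0); field.
Qed.

Lemma weight_cutoff r : 0 < r -> weight r (cutoff r).
Proof.
move=> r0; have cm := @cutoff_arg_continuous r.
have [[h1 h2 h3] _] := @C1_of_is_derive R n (cutoff r) (fun i y =>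
  3 * Num.max 0 (1 - sqnorm y / r ^+ 2) ^+ 2 * - (2 * y 0 i / r ^+ 2))
  (fun y => @contX R 'rV[R]_n _ y 3 (cm y)) (@is_derive_cutoff r) (fun i y =>
    @contM R 'rV[R]_n _ _ y (@contM R 'rV[R]_n _ _ y (@cont_cst R _ 3 y) (@contX R 'rV[R]_n _ y 2 (cm y)))
     (@contN R 'rV[R]_n _ y (@contM R 'rV[R]_n _ _ y (@contM R 'rV[R]_n _ _ y (@cont_cst R _ 2 y) (@coord_continuous R 1 n 0 i y)) (@cont_cst R _ (r ^+ 2)^-1 y)))).
split => // y /existsNP[i /negP]; rewrite -ltNge => ry.
rewrite /cutoff max_l ?expr0n// subr_le0 ler_pdivlMr ?exprn_gt0// mul1r.
rewrite /sqnorm (bigD1 i)//= -(real_normK (num_real (y 0 i))).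
rewrite ler_wpDr ?sumr_ge0// => [j _|]; first exact: sqr_ge0.
by rewrite lerXn2r ?nnegrE// ltW.
Qed.

Lemma cutoff_ge0 r y : 0 <= cutoff r y.
Proof. by rewrite exprn_ge0// le_max lexx. Qed.

Lemma cutoff_le1 r y : cutoff r y <= 1.
Proof.
rewrite exprn_ile1 ?le_max ?lexx// ge_max ler01/= gerBl.
by rewrite divr_ge0 ?sqnorm_ge0 ?sqr_ge0.
Qed.

Lemma partial_cutoff r i y : partial i (cutoff r) y =
  3 * Num.max 0 (1 - sqnorm y / r ^+ 2) ^+ 2 * - (2 * y 0 i / r ^+ 2).
Proof. by have [] := @is_derive_cutoff r i y. Qed.

Lemma grad_cutoff_le r y : 0 < r ->
  \sum_i partial i (cutoff r) y ^+ 2 <= (12 / r) ^+ 2 * cutoff r y.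
Proof.
move=> r0; under eq_bigr do rewrite partial_cutoff.
set x := Num.max _ _.
have -> : \sum_(i < n) (3 * x ^+ 2 * - (2 * y 0 i / r ^+ 2)) ^+ 2 =
    36 * x ^+ 4 * (sqnorm y / r ^+ 2) / r ^+ 2.
  rewrite /sqnorm !(mulr_suml, mulr_sumr); apply: eq_bigr => i _; field.
  by rewrite gt_eqF.
have [x0|x0] := leP (1 - sqnorm y / r ^+ 2) 0.
  by rewrite /cutoff /x (max_l x0) !expr0n/= !(mulr0, mul0r).
rewrite /cutoff -/x; have xE : x = 1 - sqnorm y / r ^+ 2 by rewrite /x max_r// ltW.
have q0 : 0 <= sqnorm y / r ^+ 2 by rewrite divr_ge0 ?sqnorm_ge0 ?sqr_ge0.
have xx0 : 0 < x by rewrite xE.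
have x1 : x <= 1 by rewrite xE gerBl.
have -> : (12 / r) ^+ 2 * x ^+ 3 = 144 * x ^+ 3 / r ^+ 2 by field; rewrite gt_eqF.
apply: ler_wpM2r; first by rewrite invr_ge0 sqr_ge0.
have -> : 36 * x ^+ 4 * (sqnorm y / r ^+ 2) = 36 * x ^+ 3 * (x * (sqnorm y / r ^+ 2)) by ring.
have -> : 144 * x ^+ 3 = 36 * x ^+ 3 * 4 by ring.
apply: ler_wpM2l; first by rewrite mulr_ge0// exprn_ge0// ltW.
have -> : sqnorm y / r ^+ 2 = 1 - x by rewrite xE; ring.
nra.
Qed.

Definition cutoff2 r y : R := cutoff r y * cutoff r y.

Lemma weight_cutoff2 r : 0 < r -> weight r (cutoff2 r).
Proof. by move=> r0; apply: weightM; [|apply: weight_C1 (r) _ _]; exact: weight_cutoff. Qed.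

Lemma grad_cutoff2_le r y : 0 < r ->
  \sum_i partial i (cutoff2 r) y ^+ 2 <= (24 / r) ^+ 2 * cutoff r y ^+ 3.
Proof.
move=> r0; have wc := weight_cutoff r0.
have [_ E] := C1M (weight_C1 wc) (weight_C1 wc).
have -> : \sum_i partial i (cutoff2 r) y ^+ 2 =
    4 * (cutoff r y ^+ 2 * \sum_i partial i (cutoff r) y ^+ 2).
  rewrite !mulr_sumr; apply: eq_bigr => i _.
  by rewrite (_ : cutoff2 r = fun y => cutoff r y * cutoff r y)// E; ring.
have := grad_cutoff_le y r0.
move: (cutoff_ge0 r y) => c0 H.
have : cutoff r y ^+ 2 * (\sum_i partial i (cutoff r) y ^+ 2) <= cutoff r y ^+ 2 * ((12 / r) ^+ 2 * cutoff r y).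
  by rewrite ler_wpM2l ?sqr_ge0.
move=> H2.
have -> : (24 / r) ^+ 2 * cutoff r y ^+ 3 = 4 * (cutoff r y ^+ 2 * ((12 / r) ^+ 2 * cutoff r y)).
  by field; rewrite gt_eqF.
by lra.
Qed.

Lemma cutoff_mono r r' y : 0 < r -> r <= r' -> cutoff r y <= cutoff r' y.
Proof.
move=> r0 rr; have r'0 := lt_le_trans r0 rr.
have AB : 1 - sqnorm y / r ^+ 2 <= 1 - sqnorm y / r' ^+ 2.
  rewrite lerD2l lerN2 ler_wpM2l ?sqnorm_ge0// lef_pV2 ?posrE ?exprn_gt0//.
  by rewrite lerXn2r ?nnegrE ?(ltW r0) ?(ltW r'0).
have M : Num.max 0 (1 - sqnorm y / r ^+ 2) <= Num.max 0 (1 - sqnorm y / r' ^+ 2).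
  by rewrite ge_max; apply/andP; split; rewrite le_max ?lexx// AB orbT.
by apply: lerXn2r => //; rewrite nnegrE le_max lexx.
Qed.

Lemma cutoff_cvg y : cutoff k.+1%:R y @[k --> \oo] --> (1 : R).
Proof.
have H : (fun k : nat => 1 - sqnorm y * (@harmonic R k) ^+ 2) @ \oo --> (1 : R).
  rewrite -[X in _ --> X](_ : 1 - sqnorm y * 0 ^+ 2 = 1); last by rewrite expr0n mulr0 subr0.
  have H1 : (fun k : nat => (@harmonic R k) ^+ 2) @ \oo --> (0 : R) ^+ 2.
    exact: (cvg_comp (@harmonic R) (fun x => x ^+ 2) (@cvg_harmonic R) (@exprn_continuous R 2 0)).
  exact: (cvgB (cvg_cst (1 : R)) (cvgM (cvg_cst (sqnorm y)) H1)).
have c1 : continuous_at (1 : R) (fun t : R => Num.max 0 t ^+ 3).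
  apply: differentiable_continuous; apply/derivable1_diffP.
  by have [] := is_derive_pos_cube 1.
have H2 := cvg_comp _ _ H c1.
move: H2; rewrite /= max_r// expr1n => H2.
apply: cvg_trans H2; apply: near_eq_cvg; apply: nearW => k.
by rewrite /= /cutoff /harmonic/= exprVn.
Qed.

End Cutoff.

Section Pointwise.
Context {R : realType}.
Implicit Types (v w W N G phi c eps : R).

Lemma cross_term_le (v c G phi eps : R) : 0 <= eps -> 0 <= phi -> 0 <= G ->
  c ^+ 2 <= G * (eps ^+ 2 * phi ^+ 3) ->
  `|v * c| <= eps / 2 * (v ^+ 2 * phi ^+ 2 + G * phi).
Proof.
move=> e0 f0 G0 hc.
have v0 : 0 <= v ^+ 2 * phi ^+ 2 by rewrite mulr_ge0 ?sqr_ge0.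
have g0 : 0 <= G * phi by rewrite mulr_ge0.
rewrite -(@ler_pXn2r _ 2)// ?nnegrE// ?mulr_ge0 ?addr_ge0// ?divr_ge0//.
rewrite real_normK ?num_real// exprMn.
apply: (@le_trans _ _ (v ^+ 2 * (G * (eps ^+ 2 * phi ^+ 3)))).
  by rewrite ler_wpM2l// sqr_ge0.
have -> : v ^+ 2 * (G * (eps ^+ 2 * phi ^+ 3)) =
  eps ^+ 2 * ((v ^+ 2 * phi ^+ 2) * (G * phi)) by ring.
move: (v ^+ 2 * phi ^+ 2) (G * phi) => x y.
have -> : (eps / 2 * (x + y)) ^+ 2 = eps ^+ 2 * ((x + y) ^+ 2 / 4) by field.
rewrite ler_wpM2l ?sqr_ge0// ler_pdivlMr//.
have := sqr_ge0 (x - y); nra.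
Qed.

(* Integrand of [d/ds E - 2 lam E], to which [lam] times the equation tested with [w psi]
   has been added; [c] stands for the scalar product of the gradients of [psi] and [w].
   The condition linking [lam] and [tau] makes the resulting [- lam |w|^(p+1)] term
   dominate the remainder. *)
Lemma energy_density_le (p C1 C3 tau lam eps v w W N hh Ht G phi c : R) :
  1 < p -> 0 <= lam -> lam <= 2^-1 -> 0 <= eps -> eps <= 2^-1 ->
  0 <= phi -> phi <= 1 -> 0 <= G -> 0 <= W ->
  w * N = W ->
  c ^+ 2 <= G * (eps ^+ 2 * phi ^+ 3) ->
  lam * ((p - 1) / (p + 1)) / 2 = C1 * tau ->
  `|(p + 1) * Ht - w * hh| / (p - 1) <= C1 * tau * (W + 1) ->
  `|w * hh| + 2 * `|Ht| <= (p - 1) / (p + 1) / 4 * (W + 1) ->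
  w ^+ 2 / 2 <= (p - 1) / (p + 1) / 4 * W + C3 ->
  forall d V V' psi : R, d = v + w / (p - 1) - N - hh ->
  V = w ^+ 2 / (2 * (p - 1)) - W / (p + 1) - Ht ->
  V' = (d - v) * v + ((p + 1) * Ht - w * hh) / (p - 1) ->
  psi = phi ^+ 2 ->
  - (v * d * psi) - v * c + V' * psi - 2 * lam * (G / 2 + V) * psi
    + lam * (psi * w * d + w * c + G * psi)
  <= - (2^-1 * v ^+ 2 * psi) + (C1 * tau + lam * (C3 + (p - 1) / (p + 1) / 4)) * psi
     + eps * (G * phi + w ^+ 2).
Proof.
move=> p1 l0 l2 e0 e2 f0 f1 G0 W0 wN hc lk hQ hH hw d V V' psi dE VE V'E psiE.
have q0 : 0 < p - 1 by rewrite subr_gt0.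
have r0 : 0 < p + 1 by rewrite addr_gt0// (lt_trans ltr01).
set k := (p - 1) / (p + 1) in lk hH hw *.
have k0 : 0 < k by rewrite divr_gt0.
set Q := ((p + 1) * Ht - w * hh) / (p - 1).
have psi0 : 0 <= psi by rewrite psiE; exact: sqr_ge0.
have psi1 : psi <= 1 by rewrite psiE exprn_ile1.
have E : - (v * d * psi) - v * c + V' * psi - 2 * lam * (G / 2 + V) * psi
    + lam * (psi * w * d + w * c + G * psi) =
    - (v ^+ 2 * psi) + Q * psi
    + lam * psi * (w * v - k * W - (w * hh - 2 * Ht)) + (lam * (w * c) - v * c).
  rewrite V'E VE dE /Q /k -wN; field.
  by rewrite !gt_eqF.
have hQ' : Q <= C1 * tau * (W + 1).
  by apply: le_trans hQ; rewrite ler_pdivrMr// divfK ?gt_eqF// ler_norm.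
have hwh : - (w * hh - 2 * Ht) <= k / 4 * (W + 1).
  apply: le_trans hH; rewrite opprB addrC.
  rewrite lerD//; first by rewrite -normrN ler_norm.
  by rewrite ler_wpM2l// ler_norm.
have hwv : w * v <= v ^+ 2 / 2 + w ^+ 2 / 2.
  have := sqr_ge0 (w - v); nra.
have hin : w * v - k * W - (w * hh - 2 * Ht) <= v ^+ 2 / 2 + (C3 + k / 4) - k / 2 * W by lra.
have cv := cross_term_le v e0 f0 G0 hc.
have cw := cross_term_le w e0 f0 G0 hc.
rewrite -psiE in cv cw.
have lp0 : 0 <= lam * psi by rewrite mulr_ge0.
have t1 : Q * psi <= C1 * tau * (W + 1) * psi by rewrite ler_wpM2r.
have t2 : lam * psi * (w * v - k * W - (w * hh - 2 * Ht)) <=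
    lam * psi * (v ^+ 2 / 2 + (C3 + k / 4) - k / 2 * W) by rewrite ler_wpM2l.
have t3 : - (v * c) <= eps / 2 * (v ^+ 2 * psi + G * phi).
  by apply: le_trans cv; rewrite -normrN ler_norm.
have t4 : lam * (w * c) <= eps / 4 * (w ^+ 2 + G * phi).
  have g0 : 0 <= G * phi by rewrite mulr_ge0.
  apply: (@le_trans _ _ (lam * (eps / 2 * (w ^+ 2 * psi + G * phi)))).
    by rewrite ler_wpM2l// (le_trans (ler_norm _) cw).
  have : w ^+ 2 * psi <= w ^+ 2 by rewrite ler_piMr ?sqr_ge0.
  move=> hh1.
  apply: (@le_trans _ _ (2^-1 * (eps / 2 * (w ^+ 2 * psi + G * phi)))).
    rewrite ler_wpM2r// mulr_ge0 ?divr_ge0// addr_ge0// mulr_ge0 ?sqr_ge0//.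
  have -> : 2^-1 * (eps / 2 * (w ^+ 2 * psi + G * phi)) =
    eps / 4 * (w ^+ 2 * psi + G * phi) by field.
  by rewrite ler_wpM2l ?divr_ge0// lerD2r.
have lW : lam * psi * (k / 2 * W) = C1 * tau * W * psi.
  by rewrite -lk; field.
have vp0 : 0 <= v ^+ 2 * psi by exact: mulr_ge0 (sqr_ge0 v) psi0.
have s1 : lam * psi * (v ^+ 2 / 2) <= 4^-1 * (v ^+ 2 * psi).
  have -> : lam * psi * (v ^+ 2 / 2) = lam / 2 * (v ^+ 2 * psi) by field.
  by apply: ler_wpM2r => //; lra.
have s2 : eps / 2 * (v ^+ 2 * psi) <= 4^-1 * (v ^+ 2 * psi).
  by apply: ler_wpM2r => //; lra.
have g0 : 0 <= eps * (G * phi) by rewrite !mulr_ge0.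
have g1 : 0 <= eps * w ^+ 2 by exact: mulr_ge0 e0 (sqr_ge0 w).
rewrite E; lra.
Qed.

Lemma mass_density_le (p M B eps v w W N hh G phi c : R) :
  1 < p -> 0 <= eps -> eps <= 1 -> 0 <= phi -> phi <= 1 -> 0 <= G ->
  `|w| <= M -> w * N = W -> W + `|w * hh| <= B ->
  0 <= B ->
  c ^+ 2 <= G * (eps ^+ 2 * phi) ->
  forall d : R, d = v + w / (p - 1) - N - hh ->
  w * v * phi - (phi * w * d + w * c + G * phi) <=
  - (2^-1 * (G * phi)) + (B + M ^+ 2).
Proof.
move=> p1 e0 e1 f0 f1 G0 wM wN hB B0 hc d dE.
have q0 : 0 < p - 1 by rewrite subr_gt0.
have M0 : 0 <= M by exact: le_trans wM.
have -> : w * v * phi - (phi * w * d + w * c + G * phi) =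
  phi * (W + w * hh) - phi * (w ^+ 2 / (p - 1)) - w * c - G * phi.
  by rewrite dE -wN; field; rewrite gt_eqF.
have h1 : phi * (W + w * hh) <= B.
  apply: (@le_trans _ _ (phi * B)); last by rewrite ler_piMl.
  by rewrite ler_wpM2l// (le_trans _ hB)// lerD2l ler_norm.
have h2 : 0 <= phi * (w ^+ 2 / (p - 1)) by rewrite mulr_ge0// divr_ge0 ?sqr_ge0 ?ltW.
have h3 : `|w * c| <= 2^-1 * (G * phi) + M ^+ 2.
  have g0 : 0 <= G * phi by rewrite mulr_ge0.
  rewrite -(@ler_pXn2r _ 2)// ?nnegrE// ?addr_ge0 ?mulr_ge0 ?sqr_ge0//.
  rewrite real_normK ?num_real// exprMn.
  have w2 : w ^+ 2 <= M ^+ 2 by rewrite -(real_normK (num_real w)) lerXn2r ?nnegrE.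
  have c2 : c ^+ 2 <= G * phi.
    apply: le_trans hc _; rewrite [eps ^+ 2 * _]mulrC mulrA ler_piMr// exprn_ile1//.
  have : w ^+ 2 * c ^+ 2 <= M ^+ 2 * (G * phi) by rewrite ler_pM ?sqr_ge0.
  move=> h; apply: le_trans h _.
  move: (G * phi) (M ^+ 2) => x y; have := sqr_ge0 (2^-1 * x - y); nra.
have : - (w * c) <= `|w * c| by rewrite -normrN ler_norm.
lra.
Qed.

Lemma square_le_power (p k : R) : 1 < p -> 0 < k -> exists C : R, 0 <= C /\
  forall w, w ^+ 2 / 2 <= k * `|w| `^ (p + 1) + C.
Proof.
move=> p1 k0; have q0 : 0 < p - 1 by rewrite subr_gt0.
pose A := (2 * k)^-1 `^ (p - 1)^-1.
have A0 : 0 <= A by exact: powR_ge0.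
exists (A ^+ 2 / 2); split; first by rewrite divr_ge0 ?sqr_ge0.
move=> w; have [wA|Aw] := leP `|w| A.
  have kp : 0 <= k * `|w| `^ (p + 1) by exact: mulr_ge0 (ltW k0) (powR_ge0 _ _).
  rewrite ler_wpDl// ler_pM2r ?invr_gt0//.
  by rewrite -(real_normK (num_real w)) lerXn2r ?nnegrE.
rewrite ler_wpDr ?divr_ge0 ?sqr_ge0//.
have w0 : 0 < `|w| by exact: le_lt_trans Aw.
have -> : `|w| `^ (p + 1) = `|w| ^+ 2 * `|w| `^ (p - 1).
  rewrite -powR_mulrn// -powRD; last by rewrite (gt_eqF w0) implybT.
  by congr (_ `^ _); ring.
rewrite (real_normK (num_real w)) mulrCA ler_wpM2l ?sqr_ge0//.
have h : (2 * k)^-1 <= `|w| `^ (p - 1).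
  have <- : A `^ (p - 1) = (2 * k)^-1.
    by rewrite -powRrM mulVf ?gt_eqF// powRr1// invr_ge0 mulr_ge0// ltW.
  by apply: ge0_ler_powR; rewrite ?nnegrE// ltW.
have := ler_wpM2l (ltW k0) h; rewrite invfM mulrCA divff ?gt_eqF// mulr1//.
Qed.

End Pointwise.

(** * Energy inequality with a cutoff *)

Section Densities.
Context {R : realType} {n : nat}.
Variables (a p mu : R) (w : 'rV[R]_n -> R -> R) (s1 : R).
Hypotheses (a0 : 0 < a) (p1 : 1 < p).
Hypothesis w21 : C21_after w s1.
Hypothesis weq : forall y s, s1 < s -> eq_w a p mu w y s.
Implicit Types (y : 'rV[R]_n) (s r : R) (i : 'I_n).

Definition source y s : R :=
  expR (- (p * s / (p - 1))) * h a p mu (expR (s / (p - 1)) * w y s).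

Definition source_primitive y s : R :=
  expR (- ((p + 1) / (p - 1) * s)) * H a p mu (expR (s / (p - 1)) * w y s).

Definition potential y s : R :=
  w y s ^+ 2 / (2 * (p - 1)) - `|w y s| `^ (p + 1) / (p + 1) - source_primitive y s.

Definition drift y s : R :=
  dt w y s + w y s / (p - 1) - `|w y s| `^ (p - 1) * w y s - source y s.

Definition potential_dt y s : R := (drift y s - dt w y s) * dt w y s
  + ((p + 1) * source_primitive y s - w y s * source y s) / (p - 1).

Definition grad_dot (f : 'rV[R]_n -> R) y s : R :=
  \sum_i partial i f y * partial i (w^~ s) y.

Let q0 : 0 < p - 1. Proof. by rewrite subr_gt0. Qed.
Let r0 : 0 < p + 1. Proof. by rewrite addr_gt0// (lt_trans ltr01). Qed.

Lemma mulr_source y s : w y s * source y s =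
  expR (- ((p + 1) / (p - 1) * s)) *
    (expR (s / (p - 1)) * w y s * h a p mu (expR (s / (p - 1)) * w y s)).
Proof.
rewrite /source.
have -> : - (p * s / (p - 1)) = - ((p + 1) / (p - 1) * s) + s / (p - 1).
  by field; rewrite gt_eqF.
by rewrite expRD; ring.
Qed.

Lemma drift_divergence y s : s1 < s ->
  divergence (fun z => rho z *: gradient (w^~ s) z) y = rho y * drift y s.
Proof.
move=> /(weq y); rewrite /eq_w -/(source y s) /drift => ->.
have rr0 : rho y != 0 := lt0r_neq0 (rho_gt0 y).
have q1 : p - 1 != 0 := lt0r_neq0 q0.
by field; rewrite ?rr0 ?q1.
Qed.

Lemma cont_expR (k : R) y s : continuous_at (y, s) (fun x : 'rV[R]_n * R => expR (k * x.2)).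
Proof.
apply: (@cont_comp _ R R expR (fun x : 'rV[R]_n * R => k * x.2)); last exact: continuous_expR.
apply: (contM (T := ('rV[R]_n * R)%type)); first exact: cont_cst.
exact: cvg_snd.
Qed.

Lemma cont_rescaled (f : R -> R) y s : continuous f ->
  continuous_at (y, s) (fun x : 'rV[R]_n * R => w x.1 x.2) ->
  continuous_at (y, s) (fun x : 'rV[R]_n * R => f (expR (x.2 / (p - 1)) * w x.1 x.2)).
Proof.
move=> cf cw.
apply: (@cont_comp _ R R f (fun x : 'rV[R]_n * R => expR (x.2 / (p - 1)) * w x.1 x.2)); last exact: cf.
apply: (contM (T := ('rV[R]_n * R)%type)); last exact: cw.
have := @cont_expR (p - 1)^-1 y s.
by congr continuous_at; apply/funext => x; rewrite mulrC.
Qed.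

Lemma potential_continuous_at (T : topologicalType) (u t : T -> R) (x : T) :
  continuous_at x u -> continuous_at x t ->
  continuous_at x (fun z => u z ^+ 2 / (2 * (p - 1)) - `|u z| `^ (p + 1) / (p + 1)
    - expR (- ((p + 1) / (p - 1) * t z)) * H a p mu (expR (t z / (p - 1)) * u z)).
Proof.
move=> cu ct.
have ce (k : R) : continuous_at x (fun z => expR (k * t z)).
  apply: (@cont_comp T R R expR (fun z => k * t z)); last exact: continuous_expR.
  by apply: (contM (T := T)); [exact: cont_cst|exact: ct].
apply: (contB (T := T)).
  apply: (contB (T := T)).
    by apply: (contM (T := T)); [exact: (contX (T := T))|exact: cont_cst].
  apply: (contM (T := T)); last exact: cont_cst.
  apply: (@cont_comp T R R (fun t : R => `|t| `^ (p + 1)) u) => //.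
  by apply: continuous_abs_powR; rewrite addr_gt0// (lt_trans ltr01).
apply: (contM (T := T)).
  have := ce (- ((p + 1) / (p - 1))).
  by congr continuous_at; apply/funext => z; rewrite mulNr.
apply: (@cont_comp T R R (H a p mu) (fun z => expR (t z / (p - 1)) * u z)); last exact: H_continuous.
apply: (contM (T := T)); last exact: cu.
have := ce (p - 1)^-1.
by congr continuous_at; apply/funext => z; rewrite mulrC.
Qed.

Lemma drift_cont : cont_after s1 drift.
Proof.
move=> y s s1s; have cw := @sol_cont R n w s1 w21 y s s1s; have cv := @sol_cont_dt R n w s1 w21 y s s1s.
apply: (contB (T := ('rV[R]_n * R)%type)).
  apply: (contB (T := ('rV[R]_n * R)%type)).
    apply: (contD (T := ('rV[R]_n * R)%type)); first exact: cv.
    by apply: (contM (T := ('rV[R]_n * R)%type)); [exact: cw|exact: cont_cst].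
  apply: (contM (T := ('rV[R]_n * R)%type)); last exact: cw.
  apply: (@cont_comp _ R R (fun t : R => `|t| `^ (p - 1)) (fun x : 'rV[R]_n * R => w x.1 x.2)) => //.
  exact: continuous_abs_powR.
apply: (contM (T := ('rV[R]_n * R)%type)).
  have := @cont_expR (- (p / (p - 1))) y s.
  by congr continuous_at; apply/funext => x; congr expR; ring.
by apply: (@cont_rescaled (h a p mu) y s _ cw); exact: h_continuous.
Qed.

Lemma potential_cont : cont_after s1 potential.
Proof.
move=> y s s1s.
have c2 : continuous_at (y, s) (fun x : 'rV[R]_n * R => x.2) by exact: cvg_snd.
exact: (potential_continuous_at (@sol_cont R n w s1 w21 y s s1s) c2).
Qed.

Lemma potential_dt_cont : cont_after s1 potential_dt.
Proof.
move=> y s s1s; have cw := @sol_cont R n w s1 w21 y s s1s; have cv := @sol_cont_dt R n w s1 w21 y s s1s.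
apply: (contD (T := ('rV[R]_n * R)%type)).
  apply: (contM (T := ('rV[R]_n * R)%type)); last exact: cv.
  by apply: (contB (T := ('rV[R]_n * R)%type)); [exact: drift_cont|exact: cv].
apply: (contM (T := ('rV[R]_n * R)%type)); last exact: cont_cst.
apply: (contB (T := ('rV[R]_n * R)%type)).
  apply: (contM (T := ('rV[R]_n * R)%type)); first exact: cont_cst.
  apply: (contM (T := ('rV[R]_n * R)%type)).
    have := @cont_expR (- ((p + 1) / (p - 1))) y s.
    by congr continuous_at; apply/funext => x; rewrite mulNr.
  by apply: (@cont_rescaled (H a p mu) y s _ cw); exact: H_continuous.
apply: (contM (T := ('rV[R]_n * R)%type)); first exact: cw.
apply: (contM (T := ('rV[R]_n * R)%type)).
  have := @cont_expR (- (p / (p - 1))) y s.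
  by congr continuous_at; apply/funext => x; congr expR; ring.
by apply: (@cont_rescaled (h a p mu) y s _ cw); exact: h_continuous.
Qed.

Lemma is_derive_potential y s : s1 < s ->
  is_derive s 1 (potential y) (potential_dt y s).
Proof.
move=> s1s; have dw := sol_is_derive_time w21 y s1s.
have d1 := is_derive_mul dw dw.
have d2 := is_derive_comp1 dw (is_derive_abs_powR (w y s) p1).
have dlin (k : R) : is_derive s 1 (fun t : R => k * t) k.
  by apply: (is_derive_eq (is_derive_mul (is_derive_cst k s 1) (is_derive_id s 1))); rewrite mul0r add0r mulr1.
have de (k : R) : is_derive s 1 (fun t : R => expR (k * t)) (k * expR (k * s)).
  by apply: (is_derive_eq (is_derive_comp1 (dlin k) (is_derive_expR (k * s)))); rewrite mulrC.
have dz := is_derive_mul (de (p - 1)^-1) dw.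
have dH := is_derive_comp1 dz (is_derive_H a mu p1 (expR ((p - 1)^-1 * s) * w y s)).
have d3 := is_derive_mul (de (- ((p + 1) / (p - 1)))) dH.
have d1' := is_derive_mul d1 (is_derive_cst (2 * (p - 1))^-1 s 1).
have d2' := is_derive_mul d2 (is_derive_cst (p + 1)^-1 s 1).
have D := is_deriveB (is_deriveB d1' d2') d3.
have E : potential y = fun t => w y t * w y t * (2 * (p - 1))^-1 -
    `|w y t| `^ (p + 1) * (p + 1)^-1 -
    expR (- ((p + 1) / (p - 1)) * t) * H a p mu (expR ((p - 1)^-1 * t) * w y t).
  by apply/funext => t; rewrite /potential /source_primitive mulNr [(p - 1)^-1 * t]mulrC expr2.
rewrite E; apply: (is_derive_eq D).
rewrite /potential_dt /drift mulr_source /source /source_primitive /cst.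
have -> : expR (- (p * s / (p - 1))) = expR (- ((p + 1) / (p - 1) * s)) * expR (s / (p - 1)).
  by rewrite -expRD; congr expR; field; rewrite gt_eqF.
rewrite (mulNr ((p + 1) / (p - 1)) s) [(p - 1)^-1 * s]mulrC.
have q1 : p - 1 != 0 := lt0r_neq0 q0.
have r1 : p + 1 != 0 := lt0r_neq0 r0.
clear -q1 r1.
set h0 := h a p mu _; set H0 := H a p mu _; set N := _ `^ (p - 1).
move: h0 H0 N (dt w y s) (w y s) (expR (s / (p - 1))) (expR (- ((p + 1) / (p - 1) * s))) => h0 H0 N v u e2 e1.
by field; rewrite ?q1 ?r1.
Qed.
End Densities.

Section GlobalContinuity.
Context {R : realType} {T : topologicalType}.
Implicit Types f g : T -> R.

Lemma continuous_mul f g : continuous f -> continuous g -> continuous (fun y => f y * g y).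
Proof. by move=> cf cg y; exact: (contM (cf y) (cg y)). Qed.

Lemma continuous_add f g : continuous f -> continuous g -> continuous (fun y => f y + g y).
Proof. by move=> cf cg y; exact: (contD (cf y) (cg y)). Qed.

Lemma continuous_opp f : continuous f -> continuous (fun y => - f y).
Proof. by move=> cf y; exact: (contN (cf y)). Qed.

Lemma continuous_const (c : R) : continuous (fun _ : T => c).
Proof. by move=> y; exact: cont_cst. Qed.

Lemma continuous_exprn f k : continuous f -> continuous (fun y => f y ^+ k).
Proof. by move=> cf y; exact: (contX (cf y)). Qed.

Lemma continuous_big_sum (I : finType) (F : I -> T -> R) :
  (forall i, continuous (F i)) -> continuous (fun y => \sum_i F i y).
Proof. by move=> cF y; exact: (cont_sum (fun i => cF i y)). Qed.

End GlobalContinuity.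

Lemma integrable_weighted (R : realType) (n : nat) (b : R) (f g : 'rV[R]_n -> R) :
  continuous f -> weight b g -> integrable_Rn (fun y => f y * (g y * rho y)).
Proof.
move=> cf [cg _ _ g0]; apply: (@integrable_Rn_box _ _ b).
  exact: continuous_mul cf (continuous_mul cg (@rho_continuous R n)).
by move=> y /g0 ->; rewrite mul0r mulr0.
Qed.

Lemma mulr_abs_powR (R : realType) (p u : R) : 0 < p ->
  u * (`|u| `^ (p - 1) * u) = `|u| `^ (p + 1).
Proof.
move=> p0; rewrite -(@mulr_powRB1 _ `|u| (p + 1)) ?addr_gt0// addrK.
rewrite -(@mulr_powRB1 _ `|u| p)// [RHS]mulrA -normrM ger0_norm -?expr2 ?sqr_ge0//.
ring.
Qed.

Lemma sqr_sum_mul_le (R : realType) (I : finType) (x z : I -> R) :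
  (\sum_i x i * z i) ^+ 2 <= (\sum_i z i ^+ 2) * (\sum_i x i ^+ 2).
Proof.
set A := \sum_i z i ^+ 2; set B := \sum_i x i ^+ 2; set S := \sum_i x i * z i.
have A0 : 0 <= A by apply: sumr_ge0 => i _; exact: sqr_ge0.
have quad (t : R) : 0 <= B - 2 * t * S + t ^+ 2 * A.
  have -> : B - 2 * t * S + t ^+ 2 * A = \sum_i (x i - t * z i) ^+ 2.
    rewrite /B /S /A !mulr_sumr -sumrB -big_split/=; apply: eq_bigr => i _; ring.
  by apply: sumr_ge0 => i _; exact: sqr_ge0.
have [A0'|A0'] := eqVneq A 0.
  have z0 i : z i = 0.
    have /eqP := A0'; rewrite psumr_eq0 => [/allP/(_ i (mem_index_enum i))|j _]; last exact: sqr_ge0.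
    by rewrite sqrf_eq0 => /eqP.
  by rewrite /S big1 ?expr0n/= ?A0' ?mul0r// => i _; rewrite z0 mulr0.
have A1 : 0 < A by rewrite lt0r A0'.
have := quad (S / A); rewrite -(pmulr_rge0 _ A1).
have -> : A * (B - 2 * (S / A) * S + (S / A) ^+ 2 * A) = A * B - S ^+ 2 by field.
by rewrite subr_ge0.
Qed.

Section EnergyInequality.
Context {R : realType} {n : nat}.
Variables (a p mu : R) (w : 'rV[R]_n -> R -> R) (s1 : R).
Hypotheses (a0 : 0 < a) (p1 : 1 < p).
Hypothesis w21 : C21_after w s1.
Hypothesis weq : forall y s, s1 < s -> eq_w a p mu w y s.
Variables Cn C3 : R.
Hypothesis Cn0 : 0 < Cn.
Hypothesis C30 : 0 <= C3.
Hypothesis nb : forall s u : R, 1 <= s ->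
  let e := expR (- ((p + 1) / (p - 1) * s)) in
  let z := expR (s / (p - 1)) * u in
  e * `|(p + 1) * H a p mu z - z * h a p mu z|
    <= Cn * s `^ (- (a + 1)) * (`|u| `^ (p + 1) + 1) /\
  e * `|z * h a p mu z| <= Cn * s `^ (- a) * (`|u| `^ (p + 1) + 1).
Hypothesis sq : forall u : R,
  u ^+ 2 / 2 <= (p - 1) / (p + 1) / 4 * `|u| `^ (p + 1) + C3.
Implicit Types (y : 'rV[R]_n) (s r M : R) (i : 'I_n).

Let q0 : 0 < p - 1. Proof. by rewrite subr_gt0. Qed.
Let r0 : 0 < p + 1. Proof. by rewrite addr_gt0// (lt_trans ltr01). Qed.
Let kappa := (p - 1) / (p + 1).
Let c1 := Cn / (p - 1).
Let gam := 4 * c1 / kappa.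
Let c5 := c1 + gam / 2 * (C3 + kappa / 4).
Let tau s := s `^ (- (a + 1)).
Let Z := IR (@rho R n).

Let k0 : 0 < kappa. Proof. exact: divr_gt0. Qed.

Local Notation V := (potential a p mu w).
Local Notation V' := (potential_dt a p mu w).
Local Notation D := (drift a p mu w).
Local Notation Gr s y := (sqnorm (gradient (w^~ s) y)).
Local Notation hh := (source a p mu w).
Local Notation Ht := (source_primitive a p mu w).

Definition cut_energy r s : R :=
  IR (fun y => 2^-1 * Gr s y * (cutoff2 r y * rho y))
  + IR (fun y => V y s * (cutoff2 r y * rho y)).

Definition cut_mass r s : R :=
  IR (fun y => 2^-1 * w y s ^+ 2 * (cutoff r y * rho y)).

Definition cut_dissipation r s : R :=
  IR (fun y => dt w y s ^+ 2 * (cutoff2 r y * rho y)).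

Definition cut_dirichlet r s : R :=
  IR (fun y => Gr s y * (cutoff r y * rho y)).

Lemma source_bound y s : 1 <= s ->
  `|w y s * hh y s| <= Cn * s `^ (- a) * (`|w y s| `^ (p + 1) + 1).
Proof.
move=> s1'; have [_ b] := nb (w y s) s1'.
by rewrite mulr_source// normrM (ger0_norm (expR_ge0 _)).
Qed.

Lemma remainder_source_bound y s : 1 <= s ->
  `|(p + 1) * Ht y s - w y s * hh y s|
    <= Cn * s `^ (- (a + 1)) * (`|w y s| `^ (p + 1) + 1).
Proof.
move=> s1'; have [b _] := nb (w y s) s1'; rewrite mulr_source// /source_primitive.
by rewrite mulrCA -mulrBr normrM (ger0_norm (expR_ge0 _)).
Qed.

Lemma source_primitive_bound y s : 1 <= s -> 5 * (Cn * s `^ (- a)) <= kappa / 4 ->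
  `|w y s * hh y s| + 2 * `|Ht y s| <= kappa / 4 * (`|w y s| `^ (p + 1) + 1).
Proof.
move=> s1' small; set W := _ + 1.
have W0 : 0 <= W by rewrite addr_ge0 ?powR_ge0.
have b1 := source_bound y s1'; have b2 := remainder_source_bound y s1'.
rewrite -/W in b1 b2.
have ss : s `^ (- (a + 1)) <= s `^ (- a) by rewrite ler_powR// lerN2 lerDl.
have b3 : `|(p + 1) * Ht y s - w y s * hh y s| <= Cn * s `^ (- a) * W.
  by apply: le_trans b2 _; rewrite ler_wpM2r// ler_wpM2l// ltW.
have b4 : `|Ht y s| <= `|(p + 1) * Ht y s|.
  rewrite [leRHS]normrM ler_peMl// gtr0_norm// lerDr.
  exact: ltW (lt_trans ltr01 p1).
have b5 : `|(p + 1) * Ht y s| <= Cn * s `^ (- a) * W + Cn * s `^ (- a) * W.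
  rewrite -[X in `|X|](subrK (w y s * hh y s)); apply: le_trans (ler_normD _ _) _.
  exact: lerD.
have b6 : 5 * (Cn * s `^ (- a)) * W <= kappa / 4 * W by rewrite ler_wpM2r.
rewrite -mulrA in b6.
lra.
Qed.

Lemma gradient_continuous s : s1 < s -> continuous (fun y => Gr s y).
Proof.
move=> s1s; under eq_fun do rewrite sqnorm_gradientE.
apply: continuous_big_sum => i; apply: continuous_exprn.
exact: (cont_after_space s1s (@sol_cont_partial _ _ w s1 w21 i)).
Qed.

Lemma weighted_divergence r y s : 0 < r -> s1 < s ->
  \sum_i (partial i (fun y => cutoff2 r y * rho y) y * partial i (w^~ s) y
    + cutoff2 r y * rho y * partial i (partial i (w^~ s)) y) =
  rho y * (grad_dot w (cutoff2 r) y s + cutoff2 r y * D y s).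
Proof.
move=> rp s1s; have [crho drho] := @C1_rho R n.
have [_ E] := C1M (weight_C1 (@weight_cutoff2 R n r rp)) crho.
rewrite mulrDr [rho y * (cutoff2 r y * _)]mulrCA -(drift_divergence p1 weq)//.
rewrite /divergence /grad_dot !mulr_sumr -big_split/=; apply: eq_bigr => i _.
have -> : (fun z : 'rV[R]_n => (rho z *: gradient (w^~ s) z) 0 i) =
    fun z => rho z * partial i (w^~ s) z.
  by apply/funext => z; rewrite !mxE.
have [_ ->] := C1M crho (sol_partial_C1 w21 i s1s).
by rewrite E; ring.
Qed.

Lemma cut_energy_ineq r s M : 48 <= r -> s1 < s -> 1 <= s ->
  5 * (Cn * s `^ (- a)) <= kappa / 4 -> gam * tau s <= 1 ->
  (forall y, `|w y s| <= M) ->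
  exists l, is_derive s 1 (cut_energy r) l /\
    l - gam * tau s * cut_energy r s <= - (2^-1 * cut_dissipation r s)
      + c5 * tau s * Z + 24 / r * (cut_dirichlet r s + M ^+ 2 * Z).
Proof.
move=> r48 s1s s1' small lam1 wM.
have rp : 0 < r by apply: lt_le_trans r48.
have e0 : 0 <= 24 / r by rewrite divr_ge0// ltW.
have e2 : 24 / r <= 2^-1 by rewrite ler_pdivrMr//; lra.
have wpsi := @weight_cutoff2 R n r rp; have wphi := @weight_cutoff R n r rp.
have wpr := weight_rho wpsi.
have [crho _] := @C1_rho R n.
have cpsi : continuous (@cutoff2 R n r) by case: wpsi.
have cdpsi i : continuous (partial i (@cutoff2 R n r)) by case: wpsi.
have cw : continuous (w^~ s) := cont_after_space s1s (sol_cont w21).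
have cP i : continuous (partial i (w^~ s)) := cont_after_space s1s (@sol_cont_partial _ _ w s1 w21 i).
have cv : continuous (fun y => dt w y s) := cont_after_space s1s (sol_cont_dt w21).
have cG := gradient_continuous s1s.
have cV : continuous (fun y => V y s) := cont_after_space s1s (@potential_cont R n a p mu w s1 p1 w21).
have cV' : continuous (fun y => V' y s) := cont_after_space s1s (@potential_dt_cont R n a p mu w s1 p1 w21).
have cD : continuous (fun y => D y s) := cont_after_space s1s (@drift_cont R n a p mu w s1 p1 w21).
have crh := @rho_continuous R n.
pose c y := grad_dot w (cutoff2 r) y s.
have cc : continuous c.
  by apply: continuous_big_sum => i; exact: continuous_mul (cdpsi i) (cP i).
have d1 := is_derive_IR_grad w21 s1s wpr.
have d2 := @is_derive_IR_time R n s1 s r V V' (fun y => cutoff2 r y * rho y) s1s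
  (fun y t s1t => @is_derive_potential R n a p mu w s1 p1 w21 y t s1t) (@potential_cont R n a p mu w s1 p1 w21)
  (@potential_dt_cont R n a p mu w s1 p1 w21) (continuous_mul cpsi crh).
have {}d2 := d2 (fun y nby => let: And4 _ _ _ h := wpr in h y nby).
pose A1 y := - (dt w y s * (rho y * (c y + cutoff2 r y * D y s))).
have {}d1 : is_derive s 1 (fun t => IR (fun y => 2^-1 * Gr t y * (cutoff2 r y * rho y))) (IR A1).
  apply: (is_derive_eq d1); congr IR; apply/funext => y.
  by rewrite weighted_divergence.
exists (IR A1 + IR (fun y => V' y s * (cutoff2 r y * rho y))); split.
  exact: is_deriveD.
have c0 y : ~ box r y -> c y = 0.
  move=> nby; rewrite /c /grad_dot big1// => i _.
  by have [_ _ _ h] := wpsi; rewrite (partial_eq0 _ h nby) mul0r.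
have iA1 : integrable_Rn A1.
  apply: (@integrable_Rn_box _ _ r).
    apply: continuous_opp; apply: continuous_mul cv (continuous_mul crh _).
    exact: continuous_add cc (continuous_mul cpsi cD).
  move=> y nby; rewrite /A1 c0//; have [_ _ _ h] := wpsi.
  by rewrite h// mul0r addr0 !mulr0 oppr0.
have iV' := integrable_weighted cV' wpsi.
have iV := integrable_weighted cV wpsi.
have chalf : continuous (fun _ : 'rV[R]_n => 2^-1 : R) by exact: continuous_const.
have iG := integrable_weighted (continuous_mul chalf cG) wpsi.
have [iT T0] := weak_formulation w21 s1s wpsi (sol_C1 w21 s1s).
pose f := fun y => rho y * (cutoff2 r y * w y s * D y s + w y s * c y + Gr s y * cutoff2 r y).
have fE : (fun y : 'rV[R]_n => cutoff2 r y * (w y s * divergence (fun z => rho z *: gradient (w^~ s) z) y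
    + rho y * \sum_i (partial i (w^~ s) y * partial i (w^~ s) y))
    + rho y * w y s * \sum_i (partial i (cutoff2 r) y * partial i (w^~ s) y)) = f.
  apply/funext => y; rewrite (drift_divergence p1 weq)// /f /c /grad_dot sqnorm_gradientE.
  under [in LHS]eq_bigr do rewrite -expr2.
  by ring.
rewrite fE in iT T0.
pose lam := gam * tau s / 2.
have iE : integrable_Rn (fun y => 2^-1 * Gr s y * (cutoff2 r y * rho y) + V y s * (cutoff2 r y * rho y)).
  exact: integrable_RnD iG iV.
have iK := integrable_weighted (continuous_exprn (k := 2) cv) wpsi.
have iGm := integrable_weighted cG wphi.
have irho := @integrable_rho R n.
pose B1 y := A1 y + V' y s * (cutoff2 r y * rho y) - 2 * lam * (2^-1 * Gr s y * (cutoff2 r y * rho y) + V y s * (cutoff2 r y * rho y)) + lam * f y.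
have iB1a := integrable_RnB (integrable_RnD iA1 iV') (integrable_RnZ (2 * lam) iE).
have iB1b := integrable_RnZ lam iT.
have iB1 : integrable_Rn B1 by exact: integrable_RnD iB1a iB1b.
have -> : IR A1 + IR (fun y => V' y s * (cutoff2 r y * rho y)) - gam * tau s * cut_energy r s = IR B1.
  rewrite /B1 IRD// IRB; [|exact: integrable_RnD|exact: integrable_RnZ].
  rewrite (IRZ lam iT) T0 mulr0 addr0 (IRZ (2 * lam) iE) IRD// IRD//.
  by rewrite /cut_energy /lam; field.
pose B2 y := - 2^-1 * (dt w y s ^+ 2 * (cutoff2 r y * rho y)) + (c5 * tau s * rho y
  + 24 / r * (Gr s y * (cutoff r y * rho y) + M ^+ 2 * rho y)).
have iB2a := integrable_RnZ (- 2^-1) iK.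
have iB2b := integrable_RnZ (c5 * tau s) irho.
have iB2d := integrable_RnD iGm (integrable_RnZ (M ^+ 2) irho).
have iB2c := integrable_RnZ (24 / r) iB2d.
have iB2 : integrable_Rn B2 by exact: integrable_RnD iB2a (integrable_RnD iB2b iB2c).
have -> : - (2^-1 * cut_dissipation r s) + c5 * tau s * Z + 24 / r * (cut_dirichlet r s + M ^+ 2 * Z) = IR B2.
  rewrite /B2 IRD//; last exact: integrable_RnD.
  rewrite (IRZ (- 2^-1) iK) IRD// (IRZ _ irho) (IRZ (24 / r) iB2d) IRD//; last exact: integrable_RnZ.
  by rewrite (IRZ _ irho) -/Z /cut_dissipation /cut_dirichlet mulNr addrA.
apply: le_IR => // y.
have tau0 : 0 <= tau s by exact: powR_ge0.
have c10 : 0 < c1 by exact: divr_gt0.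
have gam0 : 0 < gam by rewrite divr_gt0// mulr_gt0.
have lam0 : 0 <= lam by rewrite divr_ge0// mulr_ge0// ltW.
have lam2 : lam <= 2^-1 by rewrite /lam ler_pdivrMr// mulVf.
have phi0 := @cutoff_ge0 R n r y; have phi1 := @cutoff_le1 R n r y.
have G0 : 0 <= Gr s y by exact: sqnorm_ge0.
have W0 : 0 <= `|w y s| `^ (p + 1) by exact: powR_ge0.
have hWN : w y s * (`|w y s| `^ (p - 1) * w y s) = `|w y s| `^ (p + 1).
  by apply: mulr_abs_powR; exact: lt_trans ltr01 p1.
have hc : c y ^+ 2 <= Gr s y * ((24 / r) ^+ 2 * cutoff r y ^+ 3).
  rewrite /c /grad_dot sqnorm_gradientE; apply: le_trans (sqr_sum_mul_le _ _) _.
  apply: ler_wpM2l; first by apply: sumr_ge0 => i _; exact: sqr_ge0.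
  exact: grad_cutoff2_le.
have hlk : lam * ((p - 1) / (p + 1)) / 2 = c1 * tau s.
  by rewrite /lam /gam -/kappa; field; rewrite gt_eqF.
have hQ : `|(p + 1) * Ht y s - w y s * hh y s| / (p - 1) <= c1 * tau s * (`|w y s| `^ (p + 1) + 1).
  rewrite ler_pdivrMr// /c1; apply: le_trans (remainder_source_bound y s1') _.
  rewrite /tau le_eqVlt; apply/orP; left; apply/eqP; field.
  by rewrite gt_eqF.
have hH := source_primitive_bound y s1' small.
have := @energy_density_le R p c1 C3 (tau s) lam (24 / r) (dt w y s) (w y s) (`|w y s| `^ (p + 1))
  (`|w y s| `^ (p - 1) * w y s) (hh y s) (Ht y s) (Gr s y) (cutoff r y) (c y)
  p1 lam0 lam2 e0 e2 phi0 phi1 G0 W0 hWN hc hlk hQ hH (sq (w y s))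
  (D y s) (V y s) (V' y s) (cutoff2 r y) erefl erefl erefl erefl => H.
have H2 := ler_wpM2l (rho_ge0 y) H.
have -> : B1 y = rho y * (- (dt w y s * D y s * cutoff2 r y) - dt w y s * c y + V' y s * cutoff2 r y
  - 2 * lam * (Gr s y / 2 + V y s) * cutoff2 r y
  + lam * (cutoff2 r y * w y s * D y s + w y s * c y + Gr s y * cutoff2 r y)).
  by rewrite /B1 /A1 /f; field.
apply: le_trans H2 _.
rewrite -/kappa (_ : c1 * tau s + lam * (C3 + kappa / 4) = c5 * tau s); last first.
  by rewrite /c5 /lam; field.
have psi1 : cutoff2 r y <= 1 by rewrite mulr_ile1.
have psi0 : 0 <= cutoff2 r y by rewrite mulr_ge0.
have w2 : w y s ^+ 2 <= M ^+ 2.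
  by rewrite -(real_normK (num_real (w y s))) lerXn2r ?nnegrE// (le_trans _ (wM y)).
have c50 : 0 <= c5 * tau s.
  have g2 : 0 <= gam / 2 by rewrite divr_ge0 ?(ltW gam0).
  have k4 : 0 <= C3 + kappa / 4 by rewrite addr_ge0// divr_ge0// ltW.
  apply: mulr_ge0 tau0; apply: addr_ge0; [exact: ltW|exact: mulr_ge0].
have -> : B2 y = rho y * (- (2^-1 * dt w y s ^+ 2 * cutoff2 r y) + c5 * tau s
  + 24 / r * (Gr s y * cutoff r y + M ^+ 2)) by rewrite /B2; ring.
apply: ler_wpM2l; first exact: rho_ge0.
apply: lerD; first by rewrite lerD2l ler_piMr.
by apply: ler_wpM2l => //; rewrite lerD2l.
Qed.

Lemma cut_mass_ineq r s M : 48 <= r -> s1 < s -> 1 <= s ->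
  0 <= M -> (forall y, `|w y s| <= M) ->
  exists l, is_derive s 1 (cut_mass r) l /\
    l <= - (2^-1 * cut_dirichlet r s)
      + (M `^ (p + 1) + Cn * (M `^ (p + 1) + 1) + M ^+ 2) * Z.
Proof.
move=> r48 s1s s1' M0 wM.
have rp : 0 < r by apply: lt_le_trans r48.
have e0 : 0 <= 12 / r by rewrite divr_ge0// ltW.
have e1 : 12 / r <= 1 by rewrite ler_pdivrMr//; lra.
have wphi := @weight_cutoff R n r rp.
have wpr := weight_rho wphi.
have cphi : continuous (@cutoff R n r) by case: wphi.
have cdphi i : continuous (partial i (@cutoff R n r)) by case: wphi.
have cw : continuous (w^~ s) := cont_after_space s1s (sol_cont w21).
have cP i : continuous (partial i (w^~ s)) := cont_after_space s1s (@sol_cont_partial _ _ w s1 w21 i).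
have cv : continuous (fun y => dt w y s) := cont_after_space s1s (sol_cont_dt w21).
have cG := gradient_continuous s1s.
have crh := @rho_continuous R n.
pose c y := grad_dot w (cutoff r) y s.
pose F y t := 2^-1 * w y t ^+ 2.
pose F' y t := w y t * dt w y t.
have dF y t : s1 < t -> is_derive t 1 (F y) (F' y t).
  move=> s1t; have dw := sol_is_derive_time w21 y s1t.
  have E : F y = fun t => 2^-1 * (w y t * w y t) by apply/funext => t'; rewrite /F expr2.
  rewrite E; have := is_derive_mul (is_derive_cst (2^-1 : R) t 1) (is_derive_mul dw dw).
  by move=> H; apply: (is_derive_eq H); rewrite /F' /cst; field.
have cF : cont_after s1 F.
  move=> y t s1t; apply: (contM (T := ('rV[R]_n * R)%type)); first exact: cont_cst.
  by apply: (contX (T := ('rV[R]_n * R)%type)); exact: (@sol_cont R n w s1 w21 y t s1t).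
have cF' : cont_after s1 F'.
  move=> y t s1t.
  exact: (contM (T := ('rV[R]_n * R)%type) (@sol_cont R n w s1 w21 y t s1t) (@sol_cont_dt R n w s1 w21 y t s1t)).
have d := @is_derive_IR_time R n s1 s r F F' (fun y => cutoff r y * rho y) s1s dF cF cF'
  (continuous_mul cphi crh) (fun y nby => let: And4 _ _ _ h := wpr in h y nby).
exists (IR (fun y => F' y s * (cutoff r y * rho y))); split; first exact: d.
have iF' := integrable_weighted (continuous_mul cw cv) wphi.
have [iT T0] := weak_formulation w21 s1s wphi (sol_C1 w21 s1s).
pose f := fun y => rho y * (cutoff r y * w y s * D y s + w y s * c y + Gr s y * cutoff r y).
have fE : (fun y : 'rV[R]_n => cutoff r y * (w y s * divergence (fun z => rho z *: gradient (w^~ s) z) y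
    + rho y * \sum_i (partial i (w^~ s) y * partial i (w^~ s) y))
    + rho y * w y s * \sum_i (partial i (cutoff r) y * partial i (w^~ s) y)) = f.
  apply/funext => y; rewrite (drift_divergence p1 weq)// /f /c /grad_dot sqnorm_gradientE.
  under [in LHS]eq_bigr do rewrite -expr2.
  by ring.
rewrite fE in iT T0.
have iGm := integrable_weighted cG wphi.
have irho := @integrable_rho R n.
set B := M `^ (p + 1) + Cn * (M `^ (p + 1) + 1).
have iB2a := integrable_RnZ (- 2^-1) iGm.
have iB2b := integrable_RnZ (B + M ^+ 2) irho.
have -> : IR (fun y => F' y s * (cutoff r y * rho y)) = IR (fun y => F' y s * (cutoff r y * rho y) - f y).
  by rewrite IRB// T0 subr0.
have -> : - (2^-1 * cut_dirichlet r s) + (B + M ^+ 2) * Z =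
  IR (fun y => - 2^-1 * (Gr s y * (cutoff r y * rho y)) + (B + M ^+ 2) * rho y).
  by rewrite IRD// (IRZ (- 2^-1) iGm) (IRZ _ irho) mulNr.
apply: le_IR => [||y]; [exact: integrable_RnB|exact: integrable_RnD|].
have phi0 := @cutoff_ge0 R n r y; have phi1 := @cutoff_le1 R n r y.
have G0 : 0 <= Gr s y by exact: sqnorm_ge0.
have hWN : w y s * (`|w y s| `^ (p - 1) * w y s) = `|w y s| `^ (p + 1).
  by apply: mulr_abs_powR; exact: lt_trans ltr01 p1.
have hc : c y ^+ 2 <= Gr s y * ((12 / r) ^+ 2 * cutoff r y).
  rewrite /c /grad_dot sqnorm_gradientE; apply: le_trans (sqr_sum_mul_le _ _) _.
  apply: ler_wpM2l; first by apply: sumr_ge0 => i _; exact: sqr_ge0.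
  exact: grad_cutoff_le.
have WM : `|w y s| `^ (p + 1) <= M `^ (p + 1).
  by apply: ge0_ler_powR => //; rewrite ?nnegrE// ltW.
have hB : `|w y s| `^ (p + 1) + `|w y s * hh y s| <= B.
  apply: lerD => //; apply: le_trans (source_bound y s1') _.
  apply: ler_pM => //; rewrite ?mulr_ge0 ?addr_ge0 ?powR_ge0 ?(ltW Cn0)//.
    rewrite -[leRHS]mulr1 ler_wpM2l ?(ltW Cn0)//.
    by rewrite powRN invf_le1 ?powR_gt0 ?(lt_le_trans ltr01)// -(powRr0 s) ler_powR// ltW.
  by rewrite lerD2r.
have B0 : 0 <= B by rewrite addr_ge0 ?mulr_ge0 ?addr_ge0 ?powR_ge0 ?(ltW Cn0).
have H := @mass_density_le R p M B (12 / r) (dt w y s) (w y s) (`|w y s| `^ (p + 1))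
  (`|w y s| `^ (p - 1) * w y s) (hh y s) (Gr s y) (cutoff r y) (c y)
  p1 e0 e1 phi0 phi1 G0 (wM y) hWN hB B0 hc (D y s) erefl.
have H2 := ler_wpM2l (rho_ge0 y) H.
have -> : F' y s * (cutoff r y * rho y) - f y = rho y * (w y s * dt w y s * cutoff r y -
  (cutoff r y * w y s * D y s + w y s * c y + Gr s y * cutoff r y)) by rewrite /F' /f; ring.
by apply: le_trans H2 _; rewrite le_eqVlt; apply/orP; left; apply/eqP; ring.
Qed.

End EnergyInequality.

(** * Truncated Lyapunov functional *)

Section Decay.
Context {R : realType}.
Implicit Types (f K : R -> R) (s t : R).
Local Notation leb := (@lebesgue_measure R).

Lemma decay_nonincreasing f s t :
  (forall x, s <= x <= t -> exists l, is_derive x 1 f l /\ l <= 0) ->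
  s <= t -> f t <= f s.
Proof.
move=> df st; apply: (@ler0_derive1_nincr _ f s t) => // [x|x|].
- by rewrite in_itv/= => /andP[/ltW sx /ltW xt]; have [|l [[]]] := df x; rewrite ?sx.
- rewrite in_itv/= => /andP[/ltW sx /ltW xt]; have [|l [[_ dl] l0]] := df x; first by rewrite sx.
  by rewrite derive1E dl.
- apply: continuous_in_subspaceT => x; rewrite inE/= in_itv/= => /df[l [[+ _] _]].
  by move=> /derivable1_diffP/differentiable_continuous.
Qed.

Lemma decay_integral f K s0 s t c : s0 < s -> s < t ->
  (forall x, s0 < x -> {for x, continuous K}) ->
  (forall x, s <= x <= t -> exists l, is_derive x 1 f l /\ l <= - K x + c) ->
  (\int[leb]_(x in `[s, t]) (K x)%:E <= (f s - f t + c * (t - s))%:E)%E.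
Proof.
move=> s0s st cK df; pose s' := (s0 + s) / 2.
have s0s' : s0 < s' by rewrite /s'; lra.
have s's : s' < s by rewrite /s'; lra.
pose G y := Rintegral leb `[s', y] K.
have iK u : leb.-integrable `[s', u] (EFin \o K).
  apply: continuous_compact_integrable; first exact: segment_compact.
  apply: continuous_in_subspaceT => x; rewrite inE/= in_itv/= => /andP[sx _].
  by apply: cK; exact: lt_le_trans sx.
have dG x : s' < x -> is_derive x 1 G (K x).
  move=> s'x; have x1 : x < x + 1 by rewrite ltrDl.
  have [d1 d2] := @continuous_FTC1_closed R K s' x (x + 1) x1 (iK _) s'x (cK _ (lt_trans s0s' s'x)).
  by apply: DeriveDef; [exact: d1|rewrite -derive1E; exact: d2].
have -> : (\int[leb]_(x in `[s, t]) (K x)%:E = (G t)%:E - (G s)%:E)%E.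
  have cG x : s' < x -> {for x, continuous G}.
    by move=> /dG[+ _] => /derivable1_diffP/differentiable_continuous.
  apply: continuous_FTC2 => //.
  - apply: continuous_in_subspaceT => x; rewrite inE/= in_itv/= => /andP[sx _].
    by apply: cK; exact: lt_le_trans sx.
  - split.
    + by move=> x; rewrite in_itv/= => /andP[sx _]; have [] := dG x (lt_trans s's sx).
    + apply: cvg_at_right_filter; exact: cG.
    + apply: cvg_at_left_filter; apply: cG; exact: lt_trans st.
  - move=> x; rewrite in_itv/= => /andP[sx _]; have [_] := dG x (lt_trans s's sx).
    by rewrite derive1E.
rewrite -EFinB lee_fin.
have : (f t + G t) - c * t <= (f s + G s) - c * s.
  apply: (@decay_nonincreasing (fun x => (f x + G x) - c * x)); last exact: ltW.
  move=> x /andP[sx xt]; have [|l [dl lK]] := df x; first by rewrite sx.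
  exists (l + K x - c); split; last by lra.
  have dc : is_derive x 1 (fun y : R => c * y) c.
    by apply: (is_derive_eq (is_derive_mul (is_derive_cst c x 1) (is_derive_id x 1))); rewrite mul0r add0r mulr1.
  exact: is_deriveB (is_deriveD dl (dG _ (lt_le_trans s's sx))) dc.
by rewrite mulrBr; lra.
Qed.

Lemma integral_oc_le K s t B (U : nat -> R) : s < t ->
  (forall x, s < x -> {for x, continuous K}) ->
  (forall x, s < x <= t -> 0 <= K x) ->
  U @ \oo --> B ->
  (forall k : nat, (\int[leb]_(x in `[(s + (t - s) * k.+2%:R^-1)%R, t]) (K x)%:E <= (U k)%:E)%E) ->
  (\int[leb]_(x in `]s, t]) (K x)%:E <= B%:E)%E.
Proof.
move=> st cK K0 UB iU.
pose F (k : nat) := `[s + (t - s) * k.+2%:R^-1, t]%classic : set R.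
have Fs k x : F k x -> s < x <= t.
  rewrite /F/= in_itv/= => /andP[sx ->]; rewrite andbT; apply: lt_le_trans sx.
  by rewrite ltrDl mulr_gt0 ?subr_gt0.
have -> : `]s, t]%classic = \bigcup_k F k.
  apply/seteqP; split => x /=; last by move=> [k _ /Fs]; rewrite in_itv.
  rewrite in_itv/= => /andP[sx xt].
  have [k _ kx] := (near_infty_natSinv_lt (PosNum (divr_gt0 (etrans (subr_gt0 _ _) sx) (etrans (subr_gt0 _ _) st)))).
  exists k => //=; rewrite /F/= in_itv/= xt andbT.
  have := kx k.+1 (leqnSn _) => /=; rewrite ltr_pdivlMr ?subr_gt0// => h.
  by rewrite mulrC -lerBrDl ltW.
have mF k : measurable (F k) by exact: measurable_itv.
have mK k : measurable_fun (F k) (EFin \o K).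
  apply/measurable_EFinP; apply: subspace_continuous_measurable_fun => //.
  by apply: continuous_in_subspaceT => x; rewrite inE => /Fs/andP[sx _]; exact: cK.
have ndF : {homo F : n m / (n <= m)%N >-> (n <= m)%O}.
  move=> i j ij; apply/subsetPset => x; rewrite /F/= !in_itv/= => /andP[sx ->].
  rewrite andbT; apply: le_trans sx; rewrite lerD2l ler_wpM2l ?subr_ge0 ?(ltW st)//.
  by rewrite lef_pV2 ?posrE// ler_nat.
have K0' i x : F i x -> (0 <= (K x)%:E)%E by move=> /Fs; rewrite lee_fin; exact: K0.
have C := @ge0_nondecreasing_set_cvg_integral _ (measurableTypeR R) R F (EFin \o K) (@lebesgue_measure R) ndF mF mK K0'.
have UB' : (U k)%:E @[k --> \oo] --> B%:E by apply: cvg_EFin; [exact: nearW|exact: UB].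
rewrite -(cvg_lim _ C)// -(cvg_lim _ UB')//; apply: lee_lim.
- by apply/cvg_ex; eexists; exact: C.
- by apply/cvg_ex; eexists; exact: UB'.
- exact: nearW.
Qed.
End Decay.

Section Truncation.
Context {R : realType} {n : nat}.
Variables (a p mu : R) (w : 'rV[R]_n -> R -> R) (s1 s2 : R).
Hypotheses (a0 : 0 < a) (p1 : 1 < p) (s12 : s1 < s2) (s1ge1 : 1 <= s1).
Hypotheses (w21 : C21_after w s1) (w1 : C1_up_to w s1).
Implicit Types (y : 'rV[R]_n) (s t r : R) (F : 'rV[R]_n -> R -> R) (g : 'rV[R]_n -> R).

Lemma IR_cont_from F b g c s : cont_from c F -> c <= s -> continuous g ->
  (forall y, ~ box b y -> g y = 0) ->
  IR (fun y => F y t * g y) @[t --> within [set t | c <= t] (nbhs s)]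
    --> IR (fun y => F y s * g y).
Proof.
move=> cF cs cg g0.
have [M [M0 HM]] := @slab_bound R n c b (s + 1) F cF.
have [N [N0 HN]] : exists N : R, 0 <= N /\ forall y, box b y -> `|g y| <= N.
  apply: (@continuous_compact_norm_bound _ _ (@box R n b)); first exact: box_compact.
  exact: continuous_subspaceT.
have [G [iG G0 HG]] := @box_dominated R n b (M * N) (mulr_ge0 M0 N0).
pose D := [set t : R | c <= t <= s + 1].
have bnd t y : D t -> `|F y t * g y| <= G y.
  move=> /andP[ct ts]; have [by_|/g0 ->] := pselect (box b y).
    by apply: le_trans (HG y by_); rewrite normrM ler_pM// ?HM ?HN.
  by rewrite mulr0 normr0; apply: G0.
have mD t : D t -> meas_Rn (fun y => F y t * g y).
  move=> /andP[ct _]; apply: continuous_meas_Rn; apply: continuous_mul cg.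
  exact: cont_from_space ct cF.
have Ds : D s by rewrite /D/= cs lerDl ler01.
have H := @IR_cvg_within R n D s (fun t y => F y t * g y) (fun y => F y s * g y) G
  (mD _ Ds) (bnd s ^~ Ds) iG mD bnd.
have DE : within D (nbhs s) = within [set t | c <= t] (nbhs s).
  apply/seteqP; split => P DP.
  - change (\forall t \near s, D t -> P t) in DP.
    change (\forall t \near s, c <= t -> P t).
    have : \forall t \near s, t <= s + 1 by apply: lt_le_nbhsl; rewrite ltrDl.
    by apply: filterS2 DP => t h1 h2 h3; apply: h1; rewrite /D/= h3.
  - change (\forall t \near s, c <= t -> P t) in DP.
    change (\forall t \near s, D t -> P t).
    by apply: filterS DP => t h /andP[/h].
rewrite -DE; apply: H => y; rewrite DE; apply: cvgM; last exact: cvg_cst.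
exact: cont_from_time cs cF.
Qed.

Lemma IR_cont_after F b g s : cont_after s1 F -> s1 < s -> continuous g ->
  (forall y, ~ box b y -> g y = 0) ->
  {for s, continuous (fun t => IR (fun y => F y t * g y))}.
Proof.
move=> cF s1s cg g0; pose c := (s1 + s) / 2.
have s1c : s1 < c by rewrite /c; lra.
have cs : c < s by rewrite /c; lra.
have := IR_cont_from (cont_after_from s1c cF) (ltW cs) cg g0.
suff -> : within [set t | c <= t] (nbhs s) = nbhs s by [].
apply/seteqP; split => P DP; last first.
  change (\forall t \near s, c <= t -> P t); exact: filterS DP.
change (\forall t \near s, c <= t -> P t) in DP.
have : \forall t \near s, c <= t by exact: lt_le_nbhsr.
by apply: filterS2 DP => t h1 /h1.
Qed.

Lemma cont_from_w : cont_from s1 w. Proof. by have [_ []] := w1. Qed.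

Lemma cont_from_grad i : cont_from s1 (fun y s => partial i (w^~ s) y).
Proof. by have [_ [_ /(_ i)]] := w1. Qed.

Lemma cont_from_sqnorm : cont_from s1 (fun y s => sqnorm (gradient (w^~ s) y)).
Proof.
have -> : (fun y s => sqnorm (gradient (w^~ s) y)) = fun y s => \sum_i partial i (w^~ s) y ^+ 2.
  by apply/funext => y; apply/funext => s; rewrite sqnorm_gradientE.
move=> x; apply: (@cont_sum R (subspace [set x : 'rV[R]_n * R | s1 <= x.2])) => i.
apply: (@contX R (subspace [set x : 'rV[R]_n * R | s1 <= x.2])).
exact: cont_from_grad.
Qed.

Lemma cont_from_potential : cont_from s1 (potential a p mu w).
Proof.
move=> x.
have c2 : {within [set x : 'rV[R]_n * R | s1 <= x.2], continuous (@snd 'rV[R]_n R)}.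
  by apply: continuous_subspaceT => z; exact: cvg_snd.
pose S := subspace [set x : 'rV[R]_n * R | s1 <= x.2].
have cw : continuous_at (x : S) (fun x : S => w x.1 x.2) by exact: cont_from_w.
have cs : continuous_at (x : S) (fun x : S => x.2) by exact: c2.
exact (@potential_continuous_at R a p mu p1 S _ _ x cw cs).
Qed.

Variables (gam c5 M B theta : R).
Hypotheses (gam0 : 0 < gam) (c50 : 0 <= c5) (M0 : 0 <= M) (B0 : 0 <= B).
Hypothesis wM : forall y s, s1 <= s <= s2 -> `|w y s| <= M.
Let Z := IR (@rho R n).
Let tau s := s `^ (- (a + 1)).
Let weight_exp s := expR (gam / a * s `^ (- a)).
Let e0 := expR (gam / a).
Local Notation E := (cut_energy a p mu w).
Local Notation K := (cut_dissipation w).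
Local Notation Gm := (cut_dirichlet w).
Local Notation Gr s y := (sqnorm (gradient (w^~ s) y)).
Hypothesis energy_ineq : forall r s, 48 <= r -> s1 < s <= s2 ->
  exists l, is_derive s 1 (E r) l /\
    l - gam * tau s * E r s <= - (2^-1 * K r s)
      + c5 * tau s * Z + 24 / r * (Gm r s + M ^+ 2 * Z).
Hypothesis mass_ineq : forall r s, 48 <= r -> s1 < s <= s2 ->
  exists l, is_derive s 1 (cut_mass w r) l /\ l <= - (2^-1 * Gm r s) + B.
Hypothesis theta_ge : e0 * (c5 * Z) <= a * theta.

Definition cut_lyapunov r s : R := E r s * weight_exp s + theta * s `^ (- a).

Let Z0 : 0 <= Z. Proof. by apply: IR_ge0 => y; exact: rho_ge0. Qed.

Let weight_exp_ge1 s : 1 <= weight_exp s.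
Proof. by rewrite -expR0 ler_expR mulr_ge0 ?powR_ge0// divr_ge0// ltW. Qed.

Let weight_exp_le s : s1 <= s -> weight_exp s <= e0.
Proof.
move=> s1s; rewrite ler_expR ler_piMr ?divr_ge0 ?(ltW a0) ?(ltW gam0)//.
have s0 : 1 <= s := le_trans s1ge1 s1s.
by rewrite -(powRr0 s) ler_powR// oppr_le0 ltW.
Qed.

Let e01 : 1 <= e0. Proof. by rewrite -expR0 ler_expR divr_ge0// ltW. Qed.

Lemma potential_bounded : exists C, 0 <= C /\
  forall y s, s1 <= s <= s2 -> `|potential a p mu w y s| <= C.
Proof.
pose F (x : R * R) := x.1 ^+ 2 / (2 * (p - 1)) - `|x.1| `^ (p + 1) / (p + 1)
    - expR (- ((p + 1) / (p - 1) * x.2)) * H a p mu (expR (x.2 / (p - 1)) * x.1).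
have cF : continuous F.
  move=> x; have c1 : continuous_at x (@fst R R) by exact: cvg_fst.
  have c2 : continuous_at x (@snd R R) by exact: cvg_snd.
  exact (@potential_continuous_at R a p mu p1 (R * R)%type fst snd x c1 c2).
have cK : compact (`[- M, M] `*` `[s1, s2] : set (R * R)).
  by apply: compact_setX; exact: segment_compact.
have [C [C0 HC]] := continuous_compact_norm_bound cK (continuous_subspaceT cF).
exists C; split => // y s ss; apply: (HC (w y s, s)); split => /=; rewrite in_itv/=//.
by rewrite -ler_norml wM.
Qed.

Let s_range s : s1 <= s <= s2 -> s1 <= s. Proof. by case/andP. Qed.

Let cont_w s : s1 <= s -> continuous (w^~ s).
Proof. by move=> s1s; exact: (cont_from_space s1s cont_from_w). Qed.

Let cont_G s : s1 <= s -> continuous (fun y => Gr s y).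
Proof. by move=> s1s; exact: (cont_from_space s1s cont_from_sqnorm). Qed.

Let cont_V s : s1 <= s -> continuous (fun y => potential a p mu w y s).
Proof. by move=> s1s; exact: (cont_from_space s1s cont_from_potential). Qed.

Let chalf : continuous (fun _ : 'rV[R]_n => 2^-1 : R).
Proof. exact: continuous_const. Qed.

Lemma cut_mass_ge0 r s : 0 <= cut_mass w r s.
Proof.
apply: IR_ge0 => y; apply: mulr_ge0; first by rewrite mulr_ge0 ?sqr_ge0.
by rewrite mulr_ge0 ?cutoff_ge0 ?rho_ge0.
Qed.

Lemma cut_mass_le r s : 0 < r -> s1 <= s <= s2 -> cut_mass w r s <= 2^-1 * (M ^+ 2 * Z).
Proof.
move=> r0 ss; have s1s := s_range ss.
rewrite mulrA -IRZ; last exact: integrable_rho.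
apply: le_IR => [||y].
- exact: integrable_weighted (continuous_mul chalf (continuous_exprn (cont_w s1s))) (weight_cutoff r0).
- exact/integrable_RnZ/integrable_rho.
have w2 : w y s ^+ 2 <= M ^+ 2.
  by rewrite -(real_normK (num_real (w y s))) lerXn2r ?nnegrE ?wM.
apply: ler_pM.
- by rewrite mulr_ge0 ?sqr_ge0.
- by rewrite mulr_ge0 ?cutoff_ge0 ?rho_ge0.
- by rewrite ler_wpM2l.
by rewrite ler_piMl ?rho_ge0 ?cutoff_le1.
Qed.

Lemma cut_dissipation_ge0 r s : 0 <= K r s.
Proof.
apply: IR_ge0 => y; apply: mulr_ge0; first exact: sqr_ge0.
by rewrite mulr_ge0 ?rho_ge0// mulr_ge0 ?cutoff_ge0.
Qed.

Lemma cut_dirichlet_ge0 r s : 0 <= Gm r s.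
Proof.
apply: IR_ge0 => y; apply: mulr_ge0; first exact: sqnorm_ge0.
by rewrite mulr_ge0 ?rho_ge0 ?cutoff_ge0.
Qed.

Lemma cut_energy_bounds C r s : 0 < r -> s1 <= s <= s2 ->
  (forall y, `|potential a p mu w y s| <= C) ->
  2^-1 * IR (fun y => Gr s y * (cutoff2 r y * rho y)) <= E r s + C * Z /\
  E r s <= 2^-1 * Gm r s + C * Z.
Proof.
move=> r0 ss VC; have s1s := s_range ss.
have psi0 y : 0 <= cutoff2 r y by rewrite mulr_ge0 ?cutoff_ge0.
have psi1 y : cutoff2 r y <= cutoff r y by rewrite ler_piMl ?cutoff_ge0 ?cutoff_le1.
have psi2 y : cutoff2 r y <= 1 by apply: le_trans (psi1 y) (cutoff_le1 _ _).
have iG := integrable_weighted (cont_G s1s) (@weight_cutoff2 R n r r0).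
have iGm := integrable_weighted (cont_G s1s) (@weight_cutoff R n r r0).
have iV := integrable_weighted (cont_V s1s) (@weight_cutoff2 R n r r0).
have EE : E r s = 2^-1 * IR (fun y => Gr s y * (cutoff2 r y * rho y)) +
    IR (fun y => potential a p mu w y s * (cutoff2 r y * rho y)).
  by rewrite -IRZ//; congr (_ + _); congr IR; apply/funext => y; rewrite mulrA.
have VZ : `|IR (fun y => potential a p mu w y s * (cutoff2 r y * rho y))| <= C * Z.
  have bnd y : `|potential a p mu w y s * (cutoff2 r y * rho y)| <= C * rho y.
    rewrite normrM ler_pM//.
    have h0 : 0 <= cutoff2 r y * rho y by apply: mulr_ge0; [exact: psi0|exact: rho_ge0].
    by rewrite ger0_norm// -[leRHS]mul1r ler_wpM2r ?rho_ge0.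
  rewrite -IRZ; last exact: integrable_rho.
  rewrite ler_norml -mulN1r; apply/andP; split.
    rewrite -IRZ; last exact/integrable_RnZ/integrable_rho.
    apply: le_IR => [||y]; [exact/integrable_RnZ/integrable_RnZ/integrable_rho|exact: iV|].
    by rewrite mulN1r; have := bnd y; rewrite ler_norml => /andP[].
  apply: le_IR => [||y]; [exact: iV|exact/integrable_RnZ/integrable_rho|].
  by apply: le_trans (bnd y); exact: ler_norm.
have GG : IR (fun y => Gr s y * (cutoff2 r y * rho y)) <= Gm r s.
  apply: le_IR => // y; rewrite ler_wpM2l ?sqnorm_ge0// ler_wpM2r ?rho_ge0//.
move: VZ; rewrite ler_norml => /andP[V1 V2]; rewrite EE; split; first lra.
by apply: lerD => //; rewrite ler_wpM2l.
Qed.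

Lemma is_derive_weight_exp s : 0 < s ->
  is_derive s 1 (fun t : R => t `^ (- a)) (- a * tau s) /\
  is_derive s 1 weight_exp (- gam * tau s * weight_exp s).
Proof.
move=> s0; have d := is_derive1_powR (- a) s0.
have E : - a * s `^ (- a - 1) = - a * tau s by rewrite /tau opprD.
split; first exact: (is_derive_eq d).
have d2 := is_derive_mul (is_derive_cst (gam / a) s 1) d.
apply: (is_derive_eq (is_derive_comp1 d2 (is_derive_expR _))).
rewrite /weight_exp /cst mul0r add0r E.
by field; rewrite gt_eqF.
Qed.

Lemma cut_lyapunov_ineq r s : 48 <= r -> s1 < s <= s2 ->
  exists l, is_derive s 1 (cut_lyapunov r) l /\
    l <= - (2^-1 * K r s) + 24 / r * e0 * (Gm r s + M ^+ 2 * Z).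
Proof.
move=> r48 ss; have [l [dl hl]] := energy_ineq r48 ss.
have s1s : s1 <= s by case/andP: ss => /ltW.
have s0 : 0 < s by apply: lt_le_trans s1s; exact: lt_le_trans s1ge1.
have [dp de] := is_derive_weight_exp s0.
exists ((l - gam * tau s * E r s) * weight_exp s - a * theta * tau s); split.
  have dt' := is_derive_mul (is_derive_cst theta s 1) dp.
  apply: (is_derive_eq (is_deriveD (is_derive_mul dl de) dt')).
  by rewrite /cst mul0r add0r; ring.
have w1' := weight_exp_ge1 s; have w2' := weight_exp_le s1s.
have t0 : 0 <= tau s by exact: powR_ge0.
have h1 := ler_wpM2r (le_trans ler01 w1') hl.
have K0 := cut_dissipation_ge0 r s.
have r0 : 0 < r by apply: lt_le_trans r48.
have r0' : 0 <= 24 / r by rewrite divr_ge0// ltW.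
have GM0 : 0 <= 24 / r * (Gm r s + M ^+ 2 * Z).
  by rewrite mulr_ge0// addr_ge0 ?cut_dirichlet_ge0// mulr_ge0// sqr_ge0.
have h2 : - (2^-1 * K r s) * weight_exp s <= - (2^-1 * K r s).
  by rewrite mulNr lerN2 ler_peMr// mulr_ge0.
have h3 : c5 * tau s * Z * weight_exp s <= a * theta * tau s.
  have -> : c5 * tau s * Z * weight_exp s = (weight_exp s * (c5 * Z)) * tau s by ring.
  rewrite ler_wpM2r//; apply: le_trans theta_ge; rewrite ler_wpM2r// mulr_ge0//.
have h4 := ler_wpM2l GM0 w2'.
rewrite 2!mulrDl in h1.
have -> : 24 / r * e0 * (Gm r s + M ^+ 2 * Z) = 24 / r * (Gm r s + M ^+ 2 * Z) * e0 by ring.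
lra.
Qed.

Let theta0 : 0 <= theta.
Proof.
rewrite -(pmulr_rge0 _ a0); apply: le_trans theta_ge.
by rewrite mulr_ge0 ?mulr_ge0// (le_trans ler01).
Qed.

Let powN_le1 s : s1 <= s -> s `^ (- a) <= 1.
Proof.
move=> s1s; rewrite -(powRr0 s) ler_powR ?oppr_le0 ?(ltW a0)//.
exact: le_trans s1s.
Qed.

(* The functional multiplied by [x - s] vanishes at [x = s], so that no bound on the
   initial Dirichlet integral is needed. *)
Lemma cut_grad_bounded t : s1 < t <= s2 -> exists C, forall r, 48 <= r ->
  IR (fun y => Gr t y * (cutoff2 r y * rho y)) <= C.
Proof.
move=> /andP[s1t ts2]; have [CV [CV0 VC]] := potential_bounded.
pose s := (s1 + t) / 2; have s1s : s1 < s by rewrite /s; lra.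
have st : s < t by rewrite /s; lra.
have e00 : 0 <= e0 := le_trans ler01 e01.
have M2 : 0 <= M ^+ 2 by exact: sqr_ge0.
pose N := e0 * (t - s) + e0.
have N0 : 0 <= N by rewrite addr_ge0// mulr_ge0// subr_ge0 ltW.
pose D := (t - s) * (2^-1 * e0 * (M ^+ 2 * Z)) + e0 * (CV * Z) + theta + N * B.
have D0 : 0 <= D.
  by rewrite !addr_ge0// ?mulr_ge0// ?subr_ge0 ?(ltW st)// ?mulr_ge0.
pose C1 := N * (2^-1 * (M ^+ 2 * Z)) + D * (t - s).
have C10 : 0 <= C1.
  by rewrite addr_ge0 ?mulr_ge0// ?subr_ge0 ?(ltW st)// ?mulr_ge0.
pose C2 := C1 / (t - s).
have C20 : 0 <= C2 by rewrite divr_ge0// subr_ge0 ltW.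
exists (2 * (C2 + CV * Z)) => r r48; have r0 : 0 < r by apply: lt_le_trans r48.
have dg x : s <= x <= t -> exists l, is_derive x 1
    (fun x => (x - s) * cut_lyapunov r x + N * cut_mass w r x - D * x) l /\ l <= 0.
  move=> /andP[sx xt]; have s1x := lt_le_trans s1s sx.
  have xx : s1 < x <= s2 by rewrite s1x (le_trans xt).
  have [l [dl hl]] := cut_lyapunov_ineq r48 xx; have [m [dm hm]] := mass_ineq r48 xx.
  exists (cut_lyapunov r x + (x - s) * l + N * m - D); split.
    have did := is_deriveB (is_derive_id x (1 : R)) (is_derive_cst s x (1 : R)).
    have d := is_deriveB (is_deriveD (is_derive_mul did dl)
      (is_derive_mul (is_derive_cst N x 1) dm))
      (is_derive_mul (is_derive_cst D x (1 : R)) (is_derive_id x (1 : R))).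
    apply: (is_derive_eq d).
    by rewrite /cst !(mul0r, add0r, subr0, mulr1, mul1r).
  have ss : s1 <= x <= s2 by rewrite (ltW s1x) (le_trans xt).
  have [_ EU] := cut_energy_bounds r0 ss (fun y => VC y x ss).
  have G0 := cut_dirichlet_ge0 r x; have K0 := cut_dissipation_ge0 r x.
  have MZ : 0 <= M ^+ 2 * Z by rewrite mulr_ge0.
  have CVZ : 0 <= CV * Z by rewrite mulr_ge0.
  have hJ : cut_lyapunov r x <= e0 * (2^-1 * Gm r x + CV * Z) + theta.
    apply: lerD; last by rewrite ler_piMr// powN_le1// ltW.
    apply: (@le_trans _ _ ((2^-1 * Gm r x + CV * Z) * weight_exp x)).
      by rewrite ler_wpM2r// (le_trans ler01).
    rewrite mulrC; apply: ler_wpM2r; last by exact: weight_exp_le (ltW s1x).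
    by rewrite addr_ge0// mulr_ge0.
  have he : 24 / r <= 2^-1 by rewrite ler_pdivrMr//; lra.
  have hl2 : l <= 2^-1 * e0 * (Gm r x + M ^+ 2 * Z).
    apply: le_trans hl _; rewrite -[leRHS]add0r; apply: lerD.
      by rewrite oppr_le0 mulr_ge0.
    by rewrite ler_wpM2r ?addr_ge0// ler_wpM2r.
  have hl3 : (x - s) * l <= (t - s) * (2^-1 * e0 * (Gm r x + M ^+ 2 * Z)).
    apply: (@le_trans _ _ ((x - s) * (2^-1 * e0 * (Gm r x + M ^+ 2 * Z)))).
      by rewrite ler_wpM2l// subr_ge0.
    by rewrite ler_wpM2r ?lerD2r// mulr_ge0 ?mulr_ge0// addr_ge0.
  have hm2 := ler_wpM2l N0 hm.
  have : e0 * (2^-1 * Gm r x + CV * Z) + theta + (t - s) * (2^-1 * e0 * (Gm r x + M ^+ 2 * Z))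
    + N * (- (2^-1 * Gm r x) + B) - D = 0 by rewrite /D /N; field.
  lra.
have := decay_nonincreasing dg (ltW st); rewrite subrr mul0r add0r.
have ss : s1 <= s <= s2 by rewrite (ltW s1s) (le_trans (ltW st)).
have tt' : s1 <= t <= s2 by rewrite (ltW s1t).
have m1 := ler_wpM2l N0 (cut_mass_le r0 ss).
have m2 := mulr_ge0 N0 (cut_mass_ge0 r t).
move=> hg.
have hJ : (t - s) * cut_lyapunov r t <= C1 by rewrite /C1 mulrBr; lra.
have hE : E r t * weight_exp t <= C2.
  rewrite /C2 ler_pdivlMr ?subr_gt0// mulrC; apply: le_trans hJ.
  rewrite ler_wpM2l ?subr_ge0 ?(ltW st)// /cut_lyapunov lerDl.
  by rewrite mulr_ge0 ?powR_ge0.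
have hE2 : E r t <= C2.
  have [E0|/ltW E0] := leP 0 (E r t); last exact: le_trans C20.
  by apply: le_trans hE; rewrite ler_peMr.
have [EL _] := cut_energy_bounds r0 tt' (fun y => VC y t tt').
lra.
Qed.

Lemma cut_dissipation_cont r s : 0 < r -> s1 < s -> {for s, continuous (K r)}.
Proof.
move=> r0 s1s; have [cpsi _ _ g0] := @weight_cutoff2 R n r r0.
have cF : cont_after s1 (fun y t => dt w y t ^+ 2).
  move=> y t s1t; apply: (contX (T := ('rV[R]_n * R)%type)).
  exact: (@sol_cont_dt R n w s1 w21 y t s1t).
have cg := continuous_mul cpsi (@rho_continuous R n).
have g0' y : ~ box r y -> cutoff2 r y * rho y = 0 by move=> /g0 ->; rewrite mul0r.
exact (IR_cont_after cF s1s cg g0').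
Qed.

Lemma cut_lyapunov_cont r : 0 < r ->
  cut_lyapunov r t @[t --> within [set t | s1 <= t] (nbhs s1)] --> cut_lyapunov r s1.
Proof.
move=> r0; have [cpsi _ _ g0] := @weight_cutoff2 R n r r0.
have s10 : 0 < s1 := lt_le_trans ltr01 s1ge1.
have [[+ _] [+ _]] := is_derive_weight_exp s10.
move=> /derivable1_diffP/differentiable_continuous cp /derivable1_diffP/differentiable_continuous ce.
have cg := continuous_mul cpsi (@rho_continuous R n).
have g0' y : ~ box r y -> cutoff2 r y * rho y = 0 by move=> /g0 ->; rewrite mul0r.
have cG : cont_from s1 (fun y t => 2^-1 * Gr t y).
  move=> x; apply: (@contM R (subspace [set x : 'rV[R]_n * R | s1 <= x.2])).
    exact: cont_cst.
  exact: cont_from_sqnorm.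
apply: cvgD.
  apply: cvgM; last exact: (cvg_within_filter [set t | s1 <= t] ce).
  apply: cvgD; first exact: (IR_cont_from cG (lexx s1) cg g0').
  exact: (IR_cont_from cont_from_potential (lexx s1) cg g0').
apply: cvgM; first exact: cvg_cst.
exact: (cvg_within_filter [set t | s1 <= t] cp).
Qed.

Lemma cut_dissipation_le : exists C, forall r, 48 <= r ->
  (\int[@lebesgue_measure R]_(x in `]s1, s2]) (2^-1 * K r x)%:E
    <= (cut_lyapunov r s1 - cut_lyapunov r s2 + C / r)%:E)%E.
Proof.
pose A := e0 * (M ^+ 2 * Z + 2 * B).
have MZ : 0 <= M ^+ 2 * Z by rewrite mulr_ge0// sqr_ge0.
have e00 : 0 <= e0 := le_trans ler01 e01.
have A0 : 0 <= A by rewrite mulr_ge0// addr_ge0// mulr_ge0.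
exists (24 * (e0 * (M ^+ 2 * Z) + A * (s2 - s1))) => r r48.
have r0 : 0 < r by apply: lt_le_trans r48.
have r0' : 0 <= 24 / r by rewrite divr_ge0// ltW.
set C := 24 * _.
pose sk (k : nat) := s1 + (s2 - s1) * k.+2%:R^-1.
have sk1 k : s1 < sk k by rewrite ltrDl mulr_gt0 ?subr_gt0.
have sk2 k : sk k < s2.
  rewrite /sk -ltrBrDl -[ltRHS]mulr1 ltr_pM2l ?subr_gt0// invf_lt1//.
  by rewrite ltr1n.
pose U k := cut_lyapunov r (sk k) - cut_lyapunov r s2 + C / r.
apply: (@integral_oc_le R (fun x => 2^-1 * K r x) s1 s2 _ U) => //.
- by move=> x s1x; apply: (contM (T := R)); [exact: cont_cst|exact: cut_dissipation_cont].
- by move=> x _; rewrite mulr_ge0// cut_dissipation_ge0.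
- apply: cvgD; last exact: cvg_cst.
  apply: cvgB; last exact: cvg_cst.
  have csk : sk @ \oo --> within [set t | s1 <= t] (nbhs s1).
    have H : sk @ \oo --> s1.
      rewrite -[X in _ --> X]addr0 -[X in _ --> _ + X](mulr0 (s2 - s1)).
      apply: cvgD; first exact: cvg_cst.
      apply: cvgM; first exact: cvg_cst.
      have := @cvg_harmonic R; rewrite -(cvg_shiftS (@harmonic R)); exact.
    move=> P HP.
    have {}HP : \forall k \near \oo, s1 <= sk k -> P (sk k) := H _ HP.
    change (\forall k \near \oo, P (sk k)).
    by apply: filterS HP => k; apply; exact: ltW.
  exact: (cvg_comp sk (cut_lyapunov r) csk (cut_lyapunov_cont r0)).
move=> k; set s := sk k; have s1s := sk1 k; have ss2 := sk2 k.
pose f x := cut_lyapunov r x + 2 * e0 * (24 / r) * cut_mass w r x.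
have N0 : 0 <= 2 * e0 * (24 / r) by rewrite mulr_ge0// mulr_ge0.
have H : (\int[@lebesgue_measure R]_(x in `[s, s2]) (2^-1 * K r x)%:E
    <= (f s - f s2 + 24 / r * A * (s2 - s))%:E)%E.
  apply: (@decay_integral R f (fun x => 2^-1 * K r x) s1 s s2) => //.
    by move=> x s1x; apply: (contM (T := R)); [exact: cont_cst|exact: cut_dissipation_cont].
  move=> x /andP[sx xs2]; have xx : s1 < x <= s2 by rewrite xs2 (lt_le_trans s1s).
  have [l [dl hl]] := cut_lyapunov_ineq r48 xx; have [m [dm hm]] := mass_ineq r48 xx.
  exists (l + 2 * e0 * (24 / r) * m); split.
    have d := is_deriveD dl (is_derive_mul (is_derive_cst (2 * e0 * (24 / r)) x (1 : R)) dm).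
    by apply: (is_derive_eq d); rewrite /cst mul0r add0r.
  have hm2 := ler_wpM2l N0 hm.
  have : 24 / r * e0 * (Gm r x + M ^+ 2 * Z) + 2 * e0 * (24 / r) * (- (2^-1 * Gm r x) + B)
    = 24 / r * A by rewrite /A; field; rewrite gt_eqF.
  lra.
apply: le_trans H _; rewrite lee_fin /U /f -/s.
have ss : s1 <= s <= s2 by rewrite !ltW.
have m1 := ler_wpM2l N0 (cut_mass_le r0 ss).
have m2 := mulr_ge0 N0 (cut_mass_ge0 r s2).
have h1 : 24 / r * A * (s2 - s) <= 24 / r * A * (s2 - s1).
  apply: ler_wpM2l; first exact: mulr_ge0.
  by rewrite lerD2l lerN2 ltW.
have : C / r = 2 * e0 * (24 / r) * (2^-1 * (M ^+ 2 * Z)) + 24 / r * A * (s2 - s1).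
  by rewrite /C; field; rewrite gt_eqF.
lra.
Qed.
End Truncation.

(** * Removing the cutoff *)

Section CutoffLimit.
Context {R : realType} {n : nat}.
Implicit Types (f : 'rV[R]_n -> R) (y : 'rV[R]_n).

Lemma cutoff2_mono r r' y : 0 < r -> r <= r' -> @cutoff2 R n r y <= cutoff2 r' y.
Proof. by move=> r0 rr; rewrite ler_pM ?cutoff_ge0 ?cutoff_mono. Qed.

Lemma cutoff2_cvg y : @cutoff2 R n (k + 47).+1%:R y @[k --> \oo] --> (1 : R).
Proof.
rewrite -[X in _ --> X](mulr1 1).
have H : cutoff (k + 47).+1%:R y @[k --> \oo] --> (1 : R).
  have := @cutoff_cvg R n y; rewrite -(cvg_shiftn 47); apply: cvg_trans.
  by apply: near_eq_cvg; apply: nearW => k /=.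
exact: (cvgM H H).
Qed.

Lemma cutoff2_range r y : 0 <= @cutoff2 R n r y <= 1.
Proof. by rewrite mulr_ge0 ?cutoff_ge0//= mulr_ile1 ?cutoff_ge0 ?cutoff_le1. Qed.

Lemma IR_cutoff_cvg f : continuous f -> integrable_Rn (fun y => f y * rho y) ->
  IR (fun y => f y * (cutoff2 (k + 47).+1%:R y * rho y)) @[k --> \oo] --> IR (fun y => f y * rho y).
Proof.
move=> cf fi.
have mc (k : nat) : continuous (fun y => f y * (cutoff2 (k + 47).+1%:R y * rho y)).
  have [cg _ _ _] := @weight_cutoff2 R n (k + 47).+1%:R (ltr0Sn _ _).
  exact: continuous_mul cf (continuous_mul cg (@rho_continuous R n)).
have [] := @IR_cvg R n (fun k y => f y * (cutoff2 (k + 47).+1%:R y * rho y))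
  (fun y => f y * rho y) (fun y => `|f y * rho y|) _ _ _ _; last by [].
- by move=> k; exact: continuous_meas_Rn.
- move=> y; apply: cvgM; first exact: cvg_cst.
  rewrite -[X in _ --> X]mul1r; apply: cvgM; last exact: cvg_cst.
  exact: cutoff2_cvg.
- have := integrable_abse fi; congr (_.-integrable _ _).
- move=> k y; have /andP[c0 c1] := @cutoff2_range (k + 47).+1%:R y.
  rewrite [_ * (cutoff2 _ _ * _)]mulrCA normrM ler_piMl// ger0_norm//.
Qed.

Lemma int_Rn_cutoff_cvg f : continuous f -> (forall y, 0 <= f y) ->
  (IR (fun y => f y * (cutoff2 (k + 47).+1%:R y * rho y)))%:E @[k --> \oo]
    --> int_Rn (fun y => (f y * rho y)%:E).
Proof.
move=> cf f0.
pose F (k : nat) y := f y * (cutoff2 (k + 47).+1%:R y * rho y).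
have iF k : integrable_Rn (F k).
  exact: integrable_weighted cf (@weight_cutoff2 R n (k + 47).+1%:R (ltr0Sn _ _)).
have -> : (fun k => (IR (F k))%:E) = fun k => int_Rn (EFin \o F k).
  by apply/funext => k; rewrite int_RnE.
have F0 k y : 0 <= F k y.
  have /andP[c0 _] := @cutoff2_range (k + 47).+1%:R y.
  by apply: mulr_ge0 (f0 y) _; apply: mulr_ge0 c0 (rho_ge0 y).
have FC y : F k y @[k --> \oo] --> f y * rho y.
  apply: cvgM; first exact: cvg_cst.
  rewrite -[X in _ --> X]mul1r; apply: cvgM; last exact: cvg_cst.
  exact: cutoff2_cvg.
have := @cvg_monotone_convergence _ _ R (lebesgue_tuple R n) setT measurableT
  (fun k => EFin \o F k \o @row_of R n) _ _ _.
move=> H; rewrite /int_Rn.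
have -> : (\int[lebesgue_tuple R n]_t (f (\row_i tnth t i) * rho (\row_i tnth t i))%:E =
   \int[lebesgue_tuple R n]_t limn (fun k => (EFin \o F k \o @row_of R n) t))%E.
  apply: eq_integral => t _; apply/esym/cvg_lim => //.
  apply: cvg_EFin; first exact: nearW.
  exact: FC.
apply: H.
- by move=> k; have := integrable_meas_Rn (iF k) => /measurable_EFinP.
- by move=> k t _ /=; rewrite lee_fin.
- move=> t _ k k' kk' /=; rewrite lee_fin ler_wpM2l// ler_wpM2r ?rho_ge0//.
  by apply: cutoff2_mono; rewrite ?ltr0Sn// ler_nat ltnS leq_add2r.
Qed.

Lemma integrable_Rn_cutoff f C : continuous f -> (forall y, 0 <= f y) ->
  (forall r, 48 <= r -> IR (fun y => f y * (cutoff2 r y * rho y)) <= C) ->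
  integrable_Rn (fun y => f y * rho y).
Proof.
move=> cf f0 fC.
have cfr := continuous_mul cf (@rho_continuous R n).
have H := int_Rn_cutoff_cvg cf f0.
have HC : (int_Rn (fun y => (f y * rho y)%:E) <= C%:E)%E.
  rewrite -(cvg_lim _ H)//; apply: lime_le.
    by apply/cvg_ex; eexists; exact: H.
  by apply: nearW => k; rewrite lee_fin; apply: fC; rewrite ler_nat ltnS leq_addl.
apply/integrableP; split.
  by apply/measurable_EFinP; exact: continuous_meas_Rn.
apply: le_lt_trans (ltry C); apply: le_trans HC; rewrite /int_Rn le_eqVlt; apply/orP; left.
apply/eqP; apply: eq_integral => t _ /=; rewrite ger0_norm//.
by rewrite mulr_ge0 ?rho_ge0.
Qed.
End CutoffLimit.

Lemma int_Rn_infty (R : realType) (n : nat) (A P : 'rV[R]_n -> R) :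
  meas_Rn A -> (forall y, 0 <= A y) -> ~ integrable_Rn A -> integrable_Rn P ->
  int_Rn (fun y => (A y + P y)%:E) = +oo%E.
Proof.
move=> mA A0 nA iP; have mP := integrable_meas_Rn iP.
have mAP : meas_Rn (fun y => A y + P y) by exact: measurable_funD.
pose fp y := Num.max (A y + P y) 0; pose fm y := Num.max (- (A y + P y)) 0.
have mfp : meas_Rn fp by apply: measurable_maxr => //; exact: measurable_cst.
have mfm : meas_Rn fm.
  by apply: measurable_maxr; [exact: measurableT_comp mAP|exact: measurable_cst].
have inP : integrable_Rn (fun y => `|P y|) by have := integrable_abse iP; congr (_.-integrable _ _).
have ifm : integrable_Rn fm.
  apply: integrable_Rn_le mfm _ inP => y; rewrite ger0_norm ?le_max ?lexx ?orbT//.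
  rewrite ge_max normr_ge0 andbT.
  by have := ler_norm (- P y); have := A0 y; rewrite normrN; lra.
rewrite /int_Rn integralE.
have -> : (\int[lebesgue_tuple R n]_t (fun t => (A (\row_i tnth t i) + P (\row_i tnth t i))%:E)^\- t)%E
    = (IR fm)%:E.
  rewrite -(int_RnE ifm) /int_Rn; apply: eq_integral => t _.
  by rewrite funenegE /= EFin_max EFinN.
have -> : (\int[lebesgue_tuple R n]_t (fun t => (A (\row_i tnth t i) + P (\row_i tnth t i))%:E)^\+ t)%E
    = int_Rn (EFin \o fp).
  by rewrite /int_Rn; apply: eq_integral => t _; rewrite funeposE /= EFin_max.
suff -> : int_Rn (EFin \o fp) = +oo%E by rewrite addye.
apply/eqP; rewrite eq_le leey/= leNgt; apply/negP => fin; apply: nA.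
have fp0 y : 0 <= fp y by rewrite le_max lexx orbT.
have ifp : integrable_Rn fp.
  apply/integrableP; split; first exact/measurable_EFinP.
  rewrite (_ : (\int[_]_(x in _) _)%E = int_Rn (EFin \o fp))//.
  by apply: eq_integral => t _ /=; rewrite ger0_norm.
apply: integrable_Rn_le mA _ (integrable_RnD ifp inP) => y.
rewrite ger0_norm//; apply: (@le_trans _ _ (A y + P y + `|P y|)).
  by have := ler_norm (- P y); rewrite normrN; lra.
by rewrite lerD2r le_max lexx.
Qed.

Section Energy.
Context {R : realType} {n : nat}.
Variables (a p mu : R) (w : 'rV[R]_n -> R -> R) (s M : R).
Hypotheses (p1 : 1 < p) (cw : continuous (w^~ s)) (wM : forall y, `|w y s| <= M).
Hypothesis cG : continuous (fun y => sqnorm (gradient (w^~ s) y)).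
Local Notation G := (fun y => sqnorm (gradient (w^~ s) y)).

Lemma integrable_Rn_comp (g : R -> R) : continuous g ->
  integrable_Rn (fun y => g (w y s) * rho y) /\
  exists C, 0 <= C /\ forall y, `|g (w y s)| <= C.
Proof.
move=> cg; have [C [C0 HC]] := continuous_compact_norm_bound
  (@segment_compact R (- M) M) (continuous_subspaceT cg).
have bnd y : `|g (w y s)| <= C.
  by apply: (HC (w y s)); rewrite /= in_itv/= -ler_norml.
split; last by exists C.
have cgw : continuous (fun y => g (w y s)).
  by move=> y; apply: (@cont_comp _ R R g (w^~ s)); [exact: cw|exact: cg].
apply: (@integrable_Rn_le _ _ _ (fun y => C * rho y)).
- exact: continuous_meas_Rn (continuous_mul cgw (@rho_continuous R n)).
- by move=> y; rewrite normrM (ger0_norm (rho_ge0 y)) ler_wpM2r ?rho_ge0.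
- exact/integrable_RnZ/integrable_rho.
Qed.

Let g1 (u : R) := (2 * (p - 1))^-1 * `|u| ^+ 2 - (p + 1)^-1 * `|u| `^ (p + 1).
Let g2 (u : R) := H a p mu (expR (s / (p - 1)) * u).

Let cg1 : continuous g1.
Proof.
move=> u; apply: (contB (T := R)).
  apply: (contM (T := R)); first exact: cont_cst.
  by apply: (contX (T := R)); exact: norm_continuous.
apply: (contM (T := R)); first exact: cont_cst.
by apply: continuous_abs_powR; rewrite addr_gt0// (lt_trans ltr01).
Qed.

Let cg2 : continuous g2.
Proof.
move=> u; apply: (@cont_comp R R R (H a p mu) (fun u => expR (s / (p - 1)) * u)).
  by apply: (contM (T := R)); [exact: cont_cst|exact: cvg_id].
exact: H_continuous.
Qed.

Let P1 y := g1 (w y s) * rho y.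
Let P2 y := g2 (w y s) * rho y.

Let energyE : energy a p mu w s =
  (int_Rn (fun y => (2^-1 * (G y * rho y) + P1 y)%:E)
    - (expR (- ((p + 1) / (p - 1) * s)))%:E * int_Rn (EFin \o P2))%E.
Proof.
rewrite /energy; congr (int_Rn _ - _)%E; apply/funext => y; congr EFin.
by rewrite /P1 /g1; ring.
Qed.

Lemma integrable_potential : integrable_Rn (fun y => potential a p mu w y s * rho y).
Proof.
have [i1 _] := integrable_Rn_comp cg1; have [i2 _] := integrable_Rn_comp cg2.
have := integrable_RnB i1 (integrable_RnZ (expR (- ((p + 1) / (p - 1) * s))) i2).
congr integrable_Rn; apply/funext => y.
rewrite /potential /source_primitive /g1 /g2 -(real_normK (num_real (w y s))).
by ring.
Qed.

Lemma energy_fin : integrable_Rn (fun y => G y * rho y) ->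
  energy a p mu w s = (2^-1 * IR (fun y => G y * rho y) + IR (fun y => potential a p mu w y s * rho y))%:E.
Proof.
move=> iG; have [i1 _] := integrable_Rn_comp cg1; have [i2 _] := integrable_Rn_comp cg2.
have iG2 := integrable_RnZ (2^-1) iG.
rewrite energyE (int_RnE (integrable_RnD iG2 i1)) (int_RnE i2) -EFinM -EFinB.
congr EFin; rewrite IRD// (IRZ _ iG) -addrA; congr (_ + _).
rewrite -(IRZ _ i2) -IRB//; last exact: integrable_RnZ.
congr IR; apply/funext => y.
rewrite /potential /source_primitive /g1 /g2 -(real_normK (num_real (w y s))).
by ring.
Qed.

Lemma energy_infty : ~ integrable_Rn (fun y => G y * rho y) -> energy a p mu w s = +oo%E.
Proof.
move=> niG; have [i1 [C [C0 HC]]] := integrable_Rn_comp cg1.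
have [i2 _] := integrable_Rn_comp cg2.
rewrite energyE (int_RnE i2) -EFinM.
suff -> : int_Rn (fun y => (2^-1 * (G y * rho y) + P1 y)%:E) = +oo%E by rewrite addye.
apply: int_Rn_infty i1.
- apply: continuous_meas_Rn; apply: continuous_mul; first exact: continuous_const.
  exact: continuous_mul cG (@rho_continuous R n).
- by move=> y; rewrite mulr_ge0// mulr_ge0 ?sqnorm_ge0 ?rho_ge0.
move=> i; apply: niG; have := integrable_RnZ 2 i.
by congr integrable_Rn; apply/funext => y; rewrite mulrA divff ?mul1r.
Qed.
End Energy.

Section Monotonicity.
Context {R : realType} {n : nat}.
Variables (a p mu : R) (w : 'rV[R]_n -> R -> R) (s1 s2 : R).
Hypotheses (a0 : 0 < a) (p1 : 1 < p) (s12 : s1 < s2) (s1ge1 : 1 <= s1).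
Hypotheses (w21 : C21_after w s1) (w1 : C1_up_to w s1).
Variables (gam c5 M B theta : R).
Hypotheses (gam0 : 0 < gam) (c50 : 0 <= c5) (M0 : 0 <= M) (B0 : 0 <= B).
Hypothesis wM : forall (y : 'rV[R]_n) s, s1 <= s <= s2 -> `|w y s| <= M.
Let Z := IR (@rho R n).
Hypothesis energy_ineq : forall r s, 48 <= r -> s1 < s <= s2 ->
  exists l, is_derive s 1 (cut_energy a p mu w r) l /\
    l - gam * s `^ (- (a + 1)) * cut_energy a p mu w r s <= - (2^-1 * cut_dissipation w r s)
      + c5 * s `^ (- (a + 1)) * Z + 24 / r * (cut_dirichlet w r s + M ^+ 2 * Z).
Hypothesis mass_ineq : forall r s, 48 <= r -> s1 < s <= s2 ->
  exists l, is_derive s 1 (cut_mass w r) l /\ l <= - (2^-1 * cut_dirichlet w r s) + B.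
Hypothesis theta_ge : expR (gam / a) * (c5 * Z) <= a * theta.
Implicit Types (y : 'rV[R]_n) (s t r : R).
Local Notation G s := (fun y => sqnorm (gradient (w^~ s) y)).
Local Notation V s := (fun y => potential a p mu w y s).
Local Notation leb := (@lebesgue_measure R).

Let cont_w s : s1 <= s -> continuous (w^~ s).
Proof. by move=> s1s; exact: (cont_from_space s1s (cont_from_w w1)). Qed.

Let cont_G s : s1 <= s -> continuous (G s).
Proof. by move=> s1s; exact: (cont_from_space s1s (cont_from_sqnorm w1)). Qed.

Let cont_V s : s1 <= s -> continuous (V s).
Proof. by move=> s1s; exact: (cont_from_space s1s (@cont_from_potential R n a p mu w s1 p1 w1)). Qed.

Definition lyapunov_value s : R :=
  (2^-1 * IR (fun y => G s y * rho y) + IR (fun y => V s y * rho y))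
    * expR (gam / a * s `^ (- a)) + theta * s `^ (- a).

Lemma lyapunov_fin s : s1 <= s <= s2 -> integrable_Rn (fun y => G s y * rho y) ->
  lyapunov a p mu w gam theta s = (lyapunov_value s)%:E.
Proof.
move=> ss iG; have s1s : s1 <= s by case/andP: ss.
rewrite /lyapunov (@energy_fin _ _ a p mu w s M)//; first exact: cont_w.
by move=> y; exact: wM.
Qed.

Lemma cut_lyapunov_cvg s : s1 <= s <= s2 -> integrable_Rn (fun y => G s y * rho y) ->
  cut_lyapunov a p mu w gam theta (k + 47).+1%:R s @[k --> \oo] --> lyapunov_value s.
Proof.
move=> ss iG; have s1s : s1 <= s by case/andP: ss.
have wMs y : `|w y s| <= M by exact: wM.
have iV := @integrable_potential _ _ a p mu w s M p1 (cont_w s1s) wMs.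
apply: cvgD; last exact: cvg_cst.
apply: cvgM; last exact: cvg_cst.
apply: cvgD; last exact: (IR_cutoff_cvg (cont_V s1s) iV).
have chalf : continuous (fun _ : 'rV[R]_n => 2^-1 : R) by exact: continuous_const.
have := @IR_cutoff_cvg R n _ (continuous_mul chalf (cont_G s1s)).
have -> : (fun y => 2^-1 * sqnorm (gradient (w^~ s) y) * rho y) = fun y => 2^-1 * (G s y * rho y).
  by apply/funext => y; rewrite [RHS]mulrA.
by rewrite (IRZ _ iG); apply; exact: integrable_RnZ.
Qed.

Lemma integrable_gradient : integrable_Rn (fun y => G s2 y * rho y).
Proof.
have ss : s1 < s2 <= s2 by rewrite s12/=.
have [C HC] := cut_grad_bounded a0 p1 s1ge1 w1 gam0 c50 M0 B0 wM energy_ineq mass_ineq theta_ge ss.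
apply: integrable_Rn_cutoff HC; first exact/cont_G/ltW.
by move=> y; exact: sqnorm_ge0.
Qed.

Lemma cut_dissipation_cvg :
  (\int[leb]_(x in `]s1, s2]) (2^-1 * cut_dissipation w (k + 47).+1%:R x)%:E)%E @[k --> \oo]
    --> ((2^-1)%:E * dissipation w s1 s2)%E.
Proof.
pose K k x := (cut_dissipation w (k + 47).+1%:R x : R).
have r0 k : 0 < (k + 47).+1%:R :> R by [].
have mK k : measurable_fun (`]s1, s2] : set (measurableTypeR R)) (K k).
  apply: subspace_continuous_measurable_fun => //.
  apply: continuous_in_subspaceT => x; rewrite inE/= in_itv/= => /andP[s1x _].
  exact: (cut_dissipation_cont w21 (r0 k) s1x).
have m2K k : measurable_fun (`]s1, s2] : set (measurableTypeR R)) (fun x => (2^-1 * K k x)%:E).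
  by apply/measurable_EFinP; exact: measurable_funM.
have K0 k x : 0 <= K k x by exact: cut_dissipation_ge0.
have cvD x : s1 < x -> continuous (fun y => dt w y x ^+ 2).
  by move=> s1x; apply: continuous_exprn; exact: (cont_after_space s1x (sol_cont_dt w21)).
have ndK x : s1 < x -> {homo K ^~ x : i j / (i <= j)%N >-> i <= j}.
  move=> s1x i j ij; apply: le_IR.
  - exact: integrable_weighted (cvD x s1x) (@weight_cutoff2 R n _ (r0 i)).
  - exact: integrable_weighted (cvD x s1x) (@weight_cutoff2 R n _ (r0 j)).
  move=> y; rewrite ler_wpM2l ?sqr_ge0// ler_wpM2r ?rho_ge0//.
  by apply: cutoff2_mono => //; rewrite ler_nat ltnS leq_add2r.
have Kcvg x : s1 < x -> (K k x)%:E @[k --> \oo] --> int_Rn (fun y => (dt w y x ^+ 2 * rho y)%:E).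
  by move=> s1x; apply: int_Rn_cutoff_cvg; [exact: cvD|move=> y; exact: sqr_ge0].
have K2cvg x : s1 < x -> (2^-1 * K k x)%:E @[k --> \oo] -->
    ((2^-1)%:E * int_Rn (fun y => (dt w y x ^+ 2 * rho y)%:E))%E.
  move=> s1x; under eq_fun do rewrite EFinM.
  by apply: cvgeZl => //; exact: Kcvg.
have E : ((2^-1)%:E * dissipation w s1 s2 = \int[leb]_(x in `]s1, s2])
    limn (fun k => (2^-1 * K k x)%:E))%E.
  have mD : measurable_fun (`]s1, s2] : set (measurableTypeR R)) (fun x => int_Rn (fun y => (dt w y x ^+ 2 * rho y)%:E)).
    apply: (@emeasurable_fun_cvg _ _ _ _ (fun k x => (K k x)%:E)).
      by move=> k; apply/measurable_EFinP; exact: mK.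
    by move=> x; rewrite /= in_itv/= => /andP[s1x _]; exact: Kcvg.
  rewrite /dissipation -(integral_itv_obnd_cbnd mD) -ge0_integralZl_EFin//.
    apply: eq_integral => x; rewrite inE/= in_itv/= => /andP[s1x _].
    by apply/esym/cvg_lim => //; exact: K2cvg.
  by move=> x _; apply: integral_ge0 => t _; rewrite lee_fin mulr_ge0 ?sqr_ge0 ?rho_ge0.
rewrite E.
apply: cvg_monotone_convergence => //.
  by move=> k x _; rewrite lee_fin; apply: mulr_ge0 => //; exact: K0.
move=> x; rewrite /= in_itv/= => /andP[s1x _] i j ij.
by rewrite lee_fin ler_wpM2l// ndK.
Qed.

Lemma lyapunov_decrease :
  lyapunov a p mu w gam theta s2 \is a fin_num /\
  (lyapunov a p mu w gam theta s2 - lyapunov a p mu w gam theta s1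
     <= - ((2^-1)%:E * dissipation w s1 s2))%E.
Proof.
have ss1 : s1 <= s1 <= s2 by rewrite lexx ltW.
have ss2 : s1 <= s2 <= s2 by rewrite lexx ltW.
have iG2 := integrable_gradient.
rewrite (lyapunov_fin ss2 iG2); split => //.
have [iG1|niG1] := pselect (integrable_Rn (fun y => G s1 y * rho y)); last first.
  have -> : lyapunov a p mu w gam theta s1 = +oo%E.
    have Ei : energy a p mu w s1 = +oo%E.
      apply: (@energy_infty R n a p mu w s1 M p1 (cont_w (lexx s1)) _ (cont_G (lexx s1)) niG1).
      by move=> y; exact: wM.
    by rewrite /lyapunov Ei gt0_mulye ?lte_fin ?expR_gt0// addye.
  by rewrite addeC leNye.
rewrite (lyapunov_fin ss1 iG1).
have [C HC] := cut_dissipation_le a0 p1 s12 s1ge1 w21 w1 gam0 c50 M0 B0 wM energy_ineq mass_ineq theta_ge.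
have D := cut_dissipation_cvg.
have U : (cut_lyapunov a p mu w gam theta (k + 47).+1%:R s1
    - cut_lyapunov a p mu w gam theta (k + 47).+1%:R s2 + C / (k + 47).+1%:R)%:E @[k --> \oo]
    --> (lyapunov_value s1 - lyapunov_value s2 + C * 0)%:E.
  apply: cvg_EFin; first exact: nearW.
  apply: cvgD; first by apply: cvgB; exact: cut_lyapunov_cvg.
  apply: cvgM; first exact: cvg_cst.
  by have := @cvg_harmonic R; rewrite -(cvg_shiftn 47).
have : ((2^-1)%:E * dissipation w s1 s2 <= (lyapunov_value s1 - lyapunov_value s2 + C * 0)%:E)%E.
  rewrite -(cvg_lim _ D)// -(cvg_lim _ U)//; apply: lee_lim.
  - by apply/cvg_ex; eexists; exact: D.
  - by apply/cvg_ex; eexists; exact: U.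
  - by apply: nearW => k; apply: HC; rewrite ler_nat ltnS leq_addl.
by rewrite mulr0 addr0 leeNr -EFinB -EFinN opprB.
Qed.
End Monotonicity.

Lemma powRN_small (R : realType) (a e : R) : 0 < a -> 0 < e ->
  exists S, 1 <= S /\ forall s, S <= s -> s `^ (- a) <= e.
Proof.
move=> a0 e0; exists (Num.max 1 (e^-1 `^ a^-1)); rewrite le_max lexx; split => // s.
rewrite ge_max => /andP[s1 Ss]; have s0 : 0 < s := lt_le_trans ltr01 s1.
rewrite powRN -[leRHS]invrK lef_pV2 ?posrE ?powR_gt0 ?invr_gt0//.
rewrite -[leLHS]powRr1 ?invr_ge0 ?(ltW e0)// -(mulVf (lt0r_neq0 a0)) powRrM.
by apply: ge0_ler_powR; rewrite ?nnegrE ?powR_ge0 ?(ltW a0) ?(ltW s0).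
Qed.

Lemma C21_after_le (R : realType) (n : nat) (w : 'rV[R]_n -> R -> R) s0 s1 :
  s0 <= s1 -> C21_after w s0 -> C21_after w s1.
Proof. by move=> s01 w21 y s s1s; apply: w21; exact: le_lt_trans s1s. Qed.

Lemma C21_C1_up_to (R : realType) (n : nat) (w : 'rV[R]_n -> R -> R) s0 s1 :
  s0 < s1 -> C21_after w s0 -> C1_up_to w s1.
Proof.
move=> s01 w21; split; [|split].
- by move=> y i; have [_ _ /(_ i)[]] := w21 y s1 s01.
- exact: (cont_after_from s01 (sol_cont w21)).
- by move=> i; exact: (cont_after_from s01 (@sol_cont_partial _ _ w s0 w21 i)).
Qed.

Theorem theorem1 (R : realType) (n : nat) (a p mu : R) (hn : (1 <= n)%N)
    (ha : 0 < a) (hp : 1 < p)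
    (hpn : (3 <= n)%N -> p < (n%:R + 2) / (n%:R - 2)) :
  exists shat thetahat gamma : R,
    [/\ 0 < shat, 0 < thetahat, 0 < gamma &
      forall (T : R) (w : 'rV[R]_n -> R -> R),
        0 < T -> classical_solution a p mu w (- ln T) ->
      forall theta : R, thetahat <= theta ->
      forall s1 s2 : R, Num.max shat (- ln T) <= s1 -> s1 < s2 ->
        (s1 = - ln T -> C1_up_to w (- ln T)) ->
        lyapunov a p mu w gamma theta s2 \is a fin_num /\
        (lyapunov a p mu w gamma theta s2 - lyapunov a p mu w gamma theta s1
           <= - ((2^-1)%:E * dissipation w s1 s2))%E].
Proof.
have q0 : 0 < p - 1 by rewrite subr_gt0.
have r0 : 0 < p + 1 by rewrite addr_gt0// (lt_trans ltr01).
have [Cn [Cn0 nb]] := nonlinear_bounds mu ha hp.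
pose kappa := (p - 1) / (p + 1).
have kappa0 : 0 < kappa by exact: divr_gt0.
have kappa4 : 0 < kappa / 4 by exact: divr_gt0.
have [C3 [C30 sq]] := square_le_power hp kappa4.
pose gam := 4 * (Cn / (p - 1)) / kappa.
have gam0 : 0 < gam by rewrite divr_gt0// mulr_gt0// divr_gt0.
pose c5 := Cn / (p - 1) + gam / 2 * (C3 + kappa / 4).
have c50 : 0 <= c5.
  apply: addr_ge0; first by rewrite divr_ge0 ?(ltW Cn0) ?(ltW q0).
  apply: mulr_ge0; first by rewrite divr_ge0 ?(ltW gam0).
  by rewrite addr_ge0// ltW.
pose Z := IR (@rho R n).
have Z0 : 0 <= Z by apply: IR_ge0 => y; exact: rho_ge0.
have e1 : 0 < kappa / 4 / 5 / Cn by rewrite !divr_gt0.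
have e2 : 0 < gam^-1 by rewrite invr_gt0.
have a10 : 0 < a + 1 by rewrite addr_gt0.
have [S1 [S11 HS1]] := powRN_small ha e1.
have [S2 [S21 HS2]] := powRN_small a10 e2.
exists (Num.max S1 S2), (expR (gam / a) * (c5 * Z) / a + 1), gam.
split => //.
- by rewrite lt_max (lt_le_trans ltr01).
- by rewrite ltr_wpDl// divr_ge0 ?mulr_ge0 ?expR_ge0 ?(ltW ha).
move=> T w T0 [w21' wb weq'] theta thetage s1 s2.
rewrite !ge_max => /andP[/andP[S1s S2s] Ts] s12 C1T.
have s1ge1 : 1 <= s1 := le_trans S11 S1s.
have w21 := C21_after_le Ts w21'.
have weq y s : s1 < s -> eq_w a p mu w y s.
  by move=> s1s; apply: weq'; exact: le_lt_trans s1s.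
have w1 : C1_up_to w s1.
  move: Ts; rewrite le_eqVlt => /predU1P[E|Ts]; first by rewrite -E; apply: C1T.
  exact: C21_C1_up_to Ts w21'.
have [M HM] := wb s2.
have wM y s : s1 <= s <= s2 -> `|w y s| <= M.
  by move=> /andP[s1s ss2]; apply: HM; rewrite ss2 (le_trans Ts).
have ss1 : s1 <= s1 <= s2 by rewrite lexx ltW.
have M0 : 0 <= M := le_trans (normr_ge0 _) (wM 0 s1 ss1).
have Mp0 : 0 <= M `^ (p + 1) by exact: powR_ge0.
pose B := (M `^ (p + 1) + Cn * (M `^ (p + 1) + 1) + M ^+ 2) * Z.
have B0 : 0 <= B.
  by apply: mulr_ge0 Z0; rewrite !addr_ge0 ?sqr_ge0// mulr_ge0 ?(ltW Cn0)// addr_ge0.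
apply: (@lyapunov_decrease R n a p mu w s1 s2 ha hp s12 s1ge1 w21 w1 gam c5 M B theta) => //.
- move=> r s r48 /andP[s1s ss2]; have s1' : 1 <= s := le_trans s1ge1 (ltW s1s).
  have small : 5 * (Cn * s `^ (- a)) <= kappa / 4.
    have := HS1 s (le_trans S1s (ltW s1s)).
    by rewrite ler_pdivlMr// ler_pdivlMr// mulrC [s `^ _ * _]mulrC.
  have lam1 : gam * s `^ (- (a + 1)) <= 1.
    by rewrite -ler_pdivlMl// mulr1; apply: HS2; exact: le_trans S2s (ltW s1s).
  apply: (@cut_energy_ineq R n a p mu w s1 hp w21 weq Cn C3 Cn0 C30 nb sq r s M) => //.
  by move=> y; apply: wM; rewrite (ltW s1s).
- move=> r s r48 /andP[s1s ss2]; have s1' : 1 <= s := le_trans s1ge1 (ltW s1s).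
  apply: (@cut_mass_ineq R n a p mu w s1 ha hp w21 weq Cn Cn0 nb r s M) => //.
  by move=> y; apply: wM; rewrite (ltW s1s).
- by rewrite [leRHS]mulrC -ler_pdivrMr//; apply: le_trans thetage; rewrite lerDl.
Qed.
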